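(* Let $X$ be a Euclidean polyhedral space of pure dimension $n$, $U\subset X$ a balanced open subset, and $f$ a weakly concave function on $U$. Then $f$ is continuous.
   Context: Polyhedral spaces. Let $X$ be a second countable topological space. A polyhedral structure $\Pi$ on $X$ is a locally finite covering of $X$ by distinct closed subsets $\sigma$ (polyhedra), each with a finite-dimensional vector space $M_\sigma$ of continuous real functions on $\sigma$ such that, with $N_\sigma=\operatorname{Hom}(M_\sigma,\mathbb{R})$, the evaluation map $\phi_\sigma\colon\sigma\to N_\sigma$ is a homeomorphism onto a full-dimensional convex polyhedron of an affine hyperplane of $N_\sigma$ not containing $0$. Faces of $\sigma$ are preimages of faces of $\phi_\sigma(\sigma)$ (including the empty face); every face of a polyhedron is a polyhedron of $\Pi$ with function space the restrictions of $M_\sigma$; any two polyhedra meet in a common face. Each polyhedron has an affine structure, dimension, facets. $\Pi'$ subdivides $\Pi$ if each polyhedron of $\Pi'$ lies in one of $\Pi$ with affine inclusion; structures are equivalent if they have a common subdivision. A polyhedral space is $X$ with an equivalence class of structures; a polyhedral complex on $X$ is a member; $X$ has pure dimension $n$ if all maximal polyhedra have dimension $n$. $\tau\prec\sigma$ means $\tau$ is a face of $\sigma$. A Euclidean polyhedral space is a polyhedral space $X$ with a finite-dimensional Euclidean vector space $N_X$ and a map $\iota\colon X\to N_X$ with image in an affine hyperplane $H_X\not\ni0$ such that some polyhedral complex has $\iota$ injective and affine on each polyhedron; only such complexes are considered. For a nonempty facet $\tau$ of $\sigma$, $v_{\sigma\setminus\tau}$ is the unit vector orthogonal to the affine span of $\iota(\tau)$,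 parallel to that of $\iota(\sigma)$, pointing towards $\iota(\sigma)$. Weights and cycles. $\Pi|_W$: polyhedra meeting an open $W$; $\Pi|_W(k)$: those of dimension $k$. A $k$-dimensional weight $c\colon\Pi|_W(k)\to\mathbb{R}$ is positive if $c\ge0$, a Minkowski weight if $\sum_{\sigma\in\Pi|_W(k),\sigma\succ\tau}c(\sigma)v_{\sigma\setminus\tau}=0$ for all $\tau\in\Pi|_W(k-1)$. A piecewise affine function on $W$ defined on $\Pi$ is affine on each $\sigma\cap W$; with $g=g_\sigma\circ\iota$ there ($g_\sigma$ linear), $(g\cdot c)(\tau)=-\sum_{\sigma\succ\tau}c(\sigma)g_\sigma(v_{\sigma\setminus\tau})$. Minkowski cycles: Minkowski weights modulo pullback to subdivisions ($c_{\Pi'}(\sigma')=c(\sigma)$ if $\sigma'\subset\sigma$ of equal dimension, else $0$); positive if represented by a positive weight; $g\cdot[c]=[g\cdot c]$. A balancing condition on $U$ is an $n$-dimensional Minkowski cycle $\beta_U$ represented by a weight $b$ with $b(\sigma)>0$ for all $\sigma\in\Pi|_U(n)$; $U$ with $\beta_U$ is balanced. A piecewise affine $g$ on $U$ is concave (PA sense) if $g\cdot\gamma$ is positive for every open $W\subset U$ and every positive Minkowski cycle $\gamma$ on $W$. A $k$-dimensional Minkowski cycle on $U$ is $\beta_U$-positive if it is $\sum_j\alpha_jg_{1,j}\cdots g_{n-k,j}\cdot\beta_U$ with $\alpha_j>0$, $g_{i,j}$ concave piecewise affine; a weight is $\beta_U$-positive if it represents one. Weak concavity. A convex combination in $U$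 is $(x,(x_i)_{i\in I},(\nu_i)_{i\in I})$, $I$ finite, $x,x_i\in U$, $\nu_i\ge0$, $\sum\nu_i=1$, $\sum\nu_i\iota(x_i)=\iota(x)$. It is balanced if there are a polyhedral complex $\Pi$, $\tau\in\Pi$ with $x\in\tau$, and $\sigma_i\in\Pi$ with $\sigma_i\succ\tau$, $\sigma_i\subset U$, $x_i\in\sigma_i$, such that, with $k=\dim\tau+1$, the $\sigma_i$ are the distinct $k$-dimensional polyhedra of $\Pi$ having $\tau$ as a face, and there is a $\beta_U$-positive $k$-dimensional Minkowski weight $c$ on $\Pi|_U$ with $\nu_i\,d(x_i,\tau)=c(\sigma_i)$ ($d$ = distance from $\iota(x_i)$ to the affine span of $\iota(\tau)$). A function $f\colon U\to\mathbb{R}$ is weakly concave if $f(x)\ge\sum\nu_if(x_i)$ for every balanced convex combination in $U$. *)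

(* Defs.v *)
From mathcomp Require Export all_boot all_order all_algebra.
From mathcomp Require Export all_classical all_reals all_analysis.
Import GRing.Theory Num.Theory numFieldNormedType.Exports.

Set Implicit Arguments.
Unset Strict Implicit.
Unset Printing Implicit Defensive.

Local Open Scope classical_set_scope.
Local Open Scope ring_scope.

Definition second_countable_space (T : topologicalType) : Prop :=
  exists B : nat -> set T, (forall k, open (B k)) /\
    forall (O : set T) (x : T), open O -> O x -> exists k, B k x /\ B k `<=` O.

Arguments second_countable_space T : clear implicits.

Section Polyhedral.
Context {R : realType} {d : nat}.

Definition dotv (u v : 'rV[R]_d) : R := (u *m v^T) 0 0.
Definition enorm (u : 'rV[R]_d) : R := Num.sqrt (dotv u u).

Definition is_polyhedron (P : set 'rV[R]_d) : Prop :=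
  exists m (A : 'I_m -> 'rV[R]_d) (b : 'I_m -> R),
    P = [set v | forall i, dotv (A i) v <= b i].

Context {X : topologicalType} (iota : X -> 'rV[R]_d).

(* a closed subset on which iota is injective and a homeomorphism onto a
   convex polyhedron (its affine structure is the one pulled back by iota) *)
Definition ipolyhedron (s : set X) : Prop :=
  [/\ closed s,
      (forall x y, s x -> s y -> iota x = iota y -> x = y),
      is_polyhedron (iota @` s),
      {within s, continuous iota} &
      (forall O : set X, open O -> exists O' : set 'rV[R]_d,
          open O' /\ iota @` (s `&` O) = iota @` s `&` O')].

(* t is a face of s (preimage of a face of iota(s), empty face included) *)
Definition is_face (t s : set X) : Prop :=
  t `<=` s /\ exists (a : 'rV[R]_d) (b : R),
    (forall x, s x -> dotv a (iota x) <= b) /\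
    t = [set x | s x /\ dotv a (iota x) = b].

Definition indep_pts (S : set X) (m : nat) : Prop :=
  exists v : 'I_m -> X, (forall i, S (v i)) /\
    row_free (\matrix_(i < m, j < d) iota (v i) 0 j).

(* S has dimension k: the (linear) span of iota(S) has dimension k+1,
   i.e. (as iota(X) lies in an affine hyperplane not through 0) the affine
   span of iota(S) has dimension k *)
Definition pdim (S : set X) (k : nat) : Prop :=
  indep_pts S k.+1 /\ ~ indep_pts S k.+2.

Definition is_complex (P : set (set X)) : Prop :=
  [/\ (forall x, exists s, P s /\ s x),
      (forall x : X, exists N : set X, nbhs x N /\
          finite_set [set s | P s /\ s `&` N !=set0]),
      (forall s, P s -> ipolyhedron s),
      (forall s t, P s -> is_face t s -> P t) &
      (forall s s', P s -> P s' -> is_face (s `&` s') s /\ is_face (s `&` s') s')].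

Definition subdivides (P' P : set (set X)) : Prop :=
  forall s', P' s' -> exists s, P s /\ s' `<=` s.

(* complexes of the polyhedral space whose class is represented by P0 *)
Definition admissible (P0 P : set (set X)) : Prop :=
  is_complex P /\ exists P'', is_complex P'' /\ subdivides P'' P /\ subdivides P'' P0.

Definition restr (P : set (set X)) (W : set X) (k : nat) : set (set X) :=
  [set s | P s /\ s `&` W !=set0 /\ pdim s k].

Definition is_normal (s t : set X) (v : 'rV[R]_d) : Prop :=
  [/\ dotv v v = 1,
      (forall x y, t x -> t y -> dotv v (iota x - iota y) = 0),
      (exists m (l : 'I_m -> R) (x y : 'I_m -> X),
          (forall i, s (x i) /\ s (y i)) /\
          v = \sum_(i < m) l i *: (iota (x i) - iota (y i))) &
      (exists x y, s x /\ t y /\ 0 < dotv v (iota x - iota y))].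

Definition nvec (s t : set X) : 'rV[R]_d := xget 0 (is_normal s t).

Definition minkowski (P : set (set X)) (W : set X) (k : nat) (c : set X -> R) : Prop :=
  forall k', k = k'.+1 -> forall t, restr P W k' t ->
    \sum_(s \in [set s | restr P W k s /\ is_face t s]) (c s *: nvec s t) = 0.

Definition pulls (P : set (set X)) (k : nat) (c : set X -> R) (s' : set X) (r : R) : Prop :=
  (exists s, P s /\ pdim s k /\ s' `<=` s /\ r = c s) \/
  ((~ exists s, P s /\ pdim s k /\ s' `<=` s) /\ r = 0).

(* (P1,c1) and (P2,c2) represent the same k-dimensional Minkowski cycle on W *)
Definition cyc_eq (P0 : set (set X)) (W : set X) (k : nat)
    (P1 : set (set X)) (c1 : set X -> R) (P2 : set (set X)) (c2 : set X -> R) : Prop :=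
  exists P3, admissible P0 P3 /\ subdivides P3 P1 /\ subdivides P3 P2 /\
    forall s, restr P3 W k s -> exists r, pulls P1 k c1 s r /\ pulls P2 k c2 s r.

Definition pos_cycle (P0 : set (set X)) (W : set X) (k : nat)
    (P : set (set X)) (c : set X -> R) : Prop :=
  exists P' c', admissible P0 P' /\ minkowski P' W k c' /\
    (forall s, restr P' W k s -> 0 <= c' s) /\ cyc_eq P0 W k P c P' c'.

Definition pa_on (P : set (set X)) (W : set X) (g : X -> R) : Prop :=
  forall s, P s -> s `&` W !=set0 ->
    exists a : 'rV[R]_d, forall x, s x -> W x -> g x = dotv a (iota x).

Definition slope (W : set X) (g : X -> R) (s : set X) : 'rV[R]_d :=
  xget 0 [set a | forall x, s x -> W x -> g x = dotv a (iota x)].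

Definition gdot (P : set (set X)) (W : set X) (k : nat) (g : X -> R)
    (c : set X -> R) : set X -> R :=
  fun t => - \sum_(s \in [set s | restr P W k s /\ is_face t s])
               (c s * dotv (slope W g s) (nvec s t)).

Definition pa_concave (P0 : set (set X)) (U : set X) (g : X -> R) : Prop :=
  (exists P, admissible P0 P /\ pa_on P U g) /\
  forall W, open W -> W `<=` U -> forall k P c,
    admissible P0 P -> minkowski P W k.+1 c -> pos_cycle P0 W k.+1 P c ->
    pa_on P W g -> pos_cycle P0 W k P (gdot P W k.+1 g c).

Fixpoint gmul (P : set (set X)) (W : set X) (n : nat) (gs : seq (X -> R))
    (c : set X -> R) : set X -> R :=
  match gs with
  | [::] => c
  | g :: gs' => gdot P W (n - size gs') g (gmul P W n gs' c)
  end.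

Definition balancing (P0 : set (set X)) (U : set X) (n : nat)
    (Pb : set (set X)) (b : set X -> R) : Prop :=
  admissible P0 Pb /\ minkowski Pb U n b /\ (forall s, restr Pb U n s -> 0 < b s).

Definition beta_pos (P0 : set (set X)) (U : set X) (n : nat)
    (Pb : set (set X)) (b : set X -> R) (k : nat) (P : set (set X)) (c : set X -> R) : Prop :=
  (k <= n)%N /\ minkowski P U k c /\
  exists (J : nat) (alpha : 'I_J -> R) (g : 'I_J -> 'I_(n - k) -> X -> R)
         (P' : set (set X)) (b' : set X -> R),
    [/\ (0 < J)%N /\ admissible P0 P', (forall j, 0 < alpha j),
        (forall j i, pa_concave P0 U (g j i) /\ pa_on P' U (g j i)),
        minkowski P' U n b' /\ cyc_eq P0 U n Pb b P' b' &
        cyc_eq P0 U k P c P'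
          (fun s => \sum_(j < J) alpha j * gmul P' U n (map (g j) (enum 'I_(n - k))) b' s)].

Definition aff_span (S : set X) : set 'rV[R]_d :=
  [set p | exists m (l : 'I_m -> R) (y : 'I_m -> X),
     (forall i, S (y i)) /\ \sum_(i < m) l i = 1 /\ p = \sum_(i < m) l i *: iota (y i)].

Definition dist_aff (x : X) (S : set X) : R :=
  inf [set r | exists p, aff_span S p /\ r = enorm (iota x - p)].

Definition convex_comb (U : set X) (x : X) (m : nat) (xs : 'I_m -> X) (nu : 'I_m -> R) : Prop :=
  [/\ U x, (forall i, U (xs i)), (forall i, 0 <= nu i), \sum_(i < m) nu i = 1 &
      \sum_(i < m) nu i *: iota (xs i) = iota x].

Definition balanced_cc (P0 : set (set X)) (U : set X) (n : nat)
    (Pb : set (set X)) (b : set X -> R)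
    (x : X) (m : nat) (xs : 'I_m -> X) (nu : 'I_m -> R) : Prop :=
  exists (P : set (set X)) (t : set X) (k' : nat) (sg : 'I_m -> set X) (c : set X -> R),
    [/\ admissible P0 P, P t, t x & pdim t k'] /\
    (forall i, [/\ P (sg i), is_face t (sg i), sg i `<=` U, sg i (xs i) & pdim (sg i) k'.+1]) /\
    injective sg /\
    (forall s, P s -> pdim s k'.+1 -> is_face t s -> exists i, sg i = s) /\
    beta_pos P0 U n Pb b k'.+1 P c /\
    (forall i, nu i * dist_aff (xs i) t = c (sg i)).

Definition weakly_concave (P0 : set (set X)) (U : set X) (n : nat)
    (Pb : set (set X)) (b : set X -> R) (f : X -> R) : Prop :=
  forall x m (xs : 'I_m -> X) (nu : 'I_m -> R),
    convex_comb U x xs nu -> balanced_cc P0 U n Pb b x xs nu ->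
    \sum_(i < m) nu i * f (xs i) <= f x.

Definition euclidean_poly (P0 : set (set X)) : Prop :=
  (exists a : 'rV[R]_d, forall x, dotv a (iota x) = 1) /\ is_complex P0.

Definition pure_dim (P0 : set (set X)) (n : nat) : Prop :=
  forall s, P0 s -> (forall s', P0 s' -> s `<=` s' -> s' = s) -> pdim s n.

End Polyhedral.

(* Main.v *)
(* The cells lie in an affine hyperplane off the origin, so affine functions are
   restrictions of linear forms, the faces of a cell are the zero sets of the
   forms that are nonpositive on it, and dim s + 1 is the rank of the span of s.

   Complexes can be cut along hyperplanes, and the balancing weight pulls back to
   every subdivision.  Cutting a maximal cell across a segment and using the
   n-dimensional weight shows that f is concave on every small closed maximal
   cell S; hence f is bounded below on S and f y >= f x - O(|y - x|) on S.

   For the upper bound, cut until x becomes a vertex.  The functions min(0, a)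
   with a linear are concave, and multiplying the balancing weight by n - 1 of
   them gives a positive balanced one-dimensional weight that is nonzero on a
   ray from x to a point q of the relative interior of S.  In the resulting
   convex combination of x let the point on this ray tend to x and keep the
   other points fixed: f (x + t (q - x)) <= f x + K t.  For y in S close to x,
   x + e (q - x) = (1 - e) y + e w with w in S, and concavity on S turns the
   bound along the ray into f y <= f x + O(|y - x|). *)

(* Concavity on each maximal cell is not enough: the value of a concave function at a boundary point
   of a polytope may lie strictly below its limits from inside. Balancing across x excludes such a
   drop. Let w be the one-dimensional weight, E the distinguished ray, mu t the distance from x to
   the point y on E, and e0 the distance to the fixed points x_s on the other rays s. The
   coefficients of the combination are then proportional to w_E / (mu t) and w_s / e0, and weak
   concavity reads w_E / (mu t) * (f y - f x) <= sum over s <> E of w_s / e0 * (f x - f x_s). The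
   right side does not depend on t, whence the linear rate K t. Dividing by w_E is the reason why
   the weight has to be strictly positive on E.

   Weak concavity only admits weights obtained from the balancing cycle by concave piecewise affine
   factors. The functions min(0, a) suit this: a cut along a = 0 makes them affine on cells, each
   has a linear form above it that touches it at a given point, and their zero sets on a cell where
   a <= 0 are its faces. *)
Require Import Defs.
From mathcomp Require Import zify ring lra.
Import Order.TTheory GRing.Theory Num.Theory numFieldNormedType.Exports.
Set Implicit Arguments.
Unset Strict Implicit.
Unset Printing Implicit Defensive.
Local Open Scope classical_set_scope.
Local Open Scope ring_scope.

(** * Linear algebra *)

Section DotProduct.
Context {R : realType} {d : nat}.
Implicit Types u v w h : 'rV[R]_d.

Lemma dotvE u v : dotv u v = \sum_i u 0 i * v 0 i.
Proof. by rewrite /dotv mxE; apply: eq_bigr => i _; rewrite mxE. Qed.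

Lemma dotvC u v : dotv u v = dotv v u.
Proof. by rewrite !dotvE; apply: eq_bigr => i _; rewrite mulrC. Qed.

Lemma dotvDl u v w : dotv (u + v) w = dotv u w + dotv v w.
Proof. by rewrite /dotv mulmxDl mxE. Qed.

Lemma dotvDr u v w : dotv u (v + w) = dotv u v + dotv u w.
Proof. by rewrite dotvC dotvDl !(dotvC _ u). Qed.

Lemma dotvZl (a : R) u v : dotv (a *: u) v = a * dotv u v.
Proof. by rewrite /dotv -scalemxAl mxE. Qed.

Lemma dotvZr (a : R) u v : dotv u (a *: v) = a * dotv u v.
Proof. by rewrite dotvC dotvZl dotvC. Qed.

Lemma dotvNl u v : dotv (- u) v = - dotv u v.
Proof. by rewrite -scaleN1r dotvZl mulN1r. Qed.

Lemma dotvNr u v : dotv u (- v) = - dotv u v.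
Proof. by rewrite dotvC dotvNl dotvC. Qed.

Lemma dotvBl u v w : dotv (u - v) w = dotv u w - dotv v w.
Proof. by rewrite dotvDl dotvNl. Qed.

Lemma dotvBr u v w : dotv u (v - w) = dotv u v - dotv u w.
Proof. by rewrite dotvDr dotvNr. Qed.

Lemma dot0v v : dotv 0 v = 0.
Proof. by rewrite -(scale0r v) dotvZl mul0r. Qed.

Lemma dotv0 v : dotv v 0 = 0.
Proof. by rewrite dotvC dot0v. Qed.

Lemma dotv_suml (I : Type) (r : seq I) (P : pred I) (F : I -> 'rV[R]_d) v :
  dotv (\sum_(i <- r | P i) F i) v = \sum_(i <- r | P i) dotv (F i) v.
Proof.
elim/big_rec2: _ => [|i y x _ <-]; first by rewrite dot0v.
by rewrite dotvDl.
Qed.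

Lemma dotv_sumr (I : Type) (r : seq I) (P : pred I) (F : I -> 'rV[R]_d) v :
  dotv v (\sum_(i <- r | P i) F i) = \sum_(i <- r | P i) dotv v (F i).
Proof. by rewrite dotvC dotv_suml; apply: eq_bigr => i _; rewrite dotvC. Qed.

Definition dotv_linE :=
  (dotvDl, dotvDr, dotvBl, dotvBr, dotvZl, dotvZr, dotvNl, dotvNr, dot0v, dotv0).

Lemma dotv_ge0 v : 0 <= dotv v v.
Proof. by rewrite dotvE sumr_ge0 // => i _; rewrite -expr2 sqr_ge0. Qed.

Lemma dotv_eq0 v : dotv v v = 0 -> v = 0.
Proof.
rewrite dotvE => /eqP; rewrite psumr_eq0; last first.
  by move=> i _; rewrite -expr2 sqr_ge0.
move=> /allP H; apply/rowP => i; rewrite mxE.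
have := H i (mem_index_enum _); by rewrite -expr2 sqrf_eq0 => /eqP.
Qed.

Lemma dotv_gt0 v : v != 0 -> 0 < dotv v v.
Proof.
move=> v0; rewrite lt_neqAle dotv_ge0 andbT eq_sym.
by apply: contra_neq v0 => /dotv_eq0.
Qed.

Lemma sub_annP m (M : 'M[R]_(m, d)) w :
  (w <= M)%MS <->
  (forall h, (forall i, dotv h (row i M) = 0) -> dotv h w = 0).
Proof.
split=> [/submxP[D ->] h H|H].
  rewrite mulmx_sum_row dotv_sumr big1 // => i _.
  by rewrite dotvZr H mulr0.
rewrite submxE; apply/eqP/rowP => j; rewrite mxE [RHS]mxE.
pose h : 'rV[R]_d := (col j (cokermx M))^T.
have E (z : 'rV[R]_d) : dotv h z = (z *m cokermx M) 0 j.
  by rewrite dotvC dotvE mxE; apply: eq_bigr => i _; rewrite !mxE.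
have := H h; rewrite E mxE; apply=> i.
by rewrite E -row_mul mulmx_coker row0 mxE.
Qed.

(** Orthogonal projection. The Gram matrix of a basis [B] is invertible, because [x *m G = 0] makes
    the squared norm of [x *m B] zero. *)
Lemma orth_decomp m (M : 'M[R]_(m, d)) u :
  exists2 u1, (u1 <= M)%MS & forall w, (w <= M)%MS -> dotv w (u - u1) = 0.
Proof.
have [B [EB Bfree]] : exists B : 'M[R]_(\rank M, d), (B :=: M)%MS /\ row_free B.
  by exists (row_base M); split; [exact: eq_row_base | exact: row_base_free].
pose G := B *m B^T.
have Gfree : G \in unitmx.
  rewrite -row_free_unit -kermx_eq0; apply/eqP/row_matrixP => i.
  rewrite row0; set x := row i _.
  have xG : x *m G = 0 by rewrite /x -row_mul mulmx_ker row0.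
  have : dotv (x *m B) (x *m B) = 0.
    by rewrite /dotv trmx_mul -mulmxA (mulmxA B) mulmxA xG mul0mx mxE.
  move/dotv_eq0 => xB.
  by apply: (row_free_inj Bfree); rewrite xB mul0mx.
exists (u *m B^T *m invmx G *m B).
  by rewrite -EB submxMl.
move=> w; rewrite -EB => /submxP[D ->].
have GT : G^T = G by rewrite /G trmx_mul trmxK.
have -> : dotv (D *m B) (u - u *m B^T *m invmx G *m B) =
    (D *m B *m u^T - D *m (G *m invmx G) *m (B *m u^T)) 0 0.
  rewrite /dotv linearB /= mulmxBr !trmx_mul trmx_inv trmxK GT.
  by rewrite /G !mulmxA.
by rewrite mulmxV // mulmx1 mulmxA subrr mxE.
Qed.

End DotProduct.

(** * Linear spans and ranks of subsets *)

Section Span.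
Context {R : realType} {d : nat} {X : topologicalType} (iota : X -> 'rV[R]_d).
Implicit Types (S T : set X) (x y : X).

(** Chosen by its universal property, as [S] may be infinite; only the row space of the chosen
    matrix matters. *)
Definition spn S : 'M[R]_d :=
  xget 0 [set M : 'M[R]_d | (forall x, S x -> (iota x <= M)%MS) /\
    forall M' : 'M[R]_d, (forall x, S x -> (iota x <= M')%MS) -> (M <= M')%MS].

Definition rk S := \rank (spn S).

Lemma rkE S : rk S = \rank (spn S). Proof. by []. Qed.

Definition pts_mx m (v : 'I_m -> X) : 'M[R]_(m, d) :=
  \matrix_(i < m, j < d) iota (v i) 0 j.

Lemma row_pts_mx m (v : 'I_m -> X) i : row i (pts_mx v) = iota (v i).
Proof. by apply/rowP => j; rewrite !mxE. Qed.

Lemma pts_mx_sub m (v : 'I_m -> X) m' (M : 'M[R]_(m', d)) :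
  (forall i, (iota (v i) <= M)%MS) -> (pts_mx v <= M)%MS.
Proof. by move=> H; apply/row_subP => i; rewrite row_pts_mx. Qed.

Lemma indep_extend S m (v : 'I_m -> X) x :
  (forall i, S (v i)) -> row_free (pts_mx v) -> S x ->
  ~~ (iota x <= pts_mx v)%MS ->
  exists v' : 'I_m.+1 -> X, [/\ (forall i, S (v' i)), row_free (pts_mx v'),
    v' ord0 = x & forall i, v' (lift ord0 i) = v i].
Proof.
move=> Sv vfree Sx xnv.
pose v' (i : 'I_m.+1) := if unlift ord0 i is Some j then v j else x.
have v'0 : v' ord0 = x by rewrite /v' unlift_none.
have v'l i : v' (lift ord0 i) = v i by rewrite /v' liftK.
exists v'; split=> //.
  by move=> i; rewrite /v'; case: unlift.
have sub : (iota x + pts_mx v <= pts_mx v')%MS.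
  rewrite addsmx_sub; apply/andP; split.
    by rewrite -v'0 -row_pts_mx row_sub.
  by apply: pts_mx_sub => i; rewrite -v'l -row_pts_mx row_sub.
rewrite /row_free eqn_leq rank_leq_row /=.
apply: leq_trans (mxrankS sub).
rewrite -{1}(eqP vfree); apply: rank_ltmx.
rewrite ltmxE addsmxSr /=; apply: contra xnv; apply: submx_trans.
exact: addsmxSl.
Qed.

(** An independent family either spans or can be extended, and extension must stop before [d.+1]
    members. *)
Lemma spn_ex S : exists m (v : 'I_m -> X), [/\ (forall i, S (v i)),
  row_free (pts_mx v) & forall x, S x -> (iota x <= pts_mx v)%MS].
Proof.
suff H k : (exists m (v : 'I_m -> X), [/\ (forall i, S (v i)),
  row_free (pts_mx v) & forall x, S x -> (iota x <= pts_mx v)%MS]) \/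
  (exists v : 'I_k -> X, (forall i, S (v i)) /\ row_free (pts_mx v)).
  have [//|[v [_ vfree]]] := H d.+1.
  by have := rank_leq_col (pts_mx v); rewrite (eqP vfree) ltnn.
elim: k => [|k [H|[v [Sv vfree]]]].
- right; unshelve eexists; first by case.
  split; first by case.
  by rewrite /row_free -leqn0 rank_leq_row.
- by left.
have [H|] := pselect (forall x, S x -> (iota x <= pts_mx v)%MS).
  by left; exists k, v.
move=> /existsNP[x /not_implyP[Sx /negP xnv]]; right.
have [v' [Sv' v'free _ _]] := indep_extend Sv vfree Sx xnv.
by exists v'.
Qed.

Lemma spnP S : (forall x, S x -> (iota x <= spn S)%MS) /\
  forall M' : 'M[R]_d, (forall x, S x -> (iota x <= M')%MS) -> (spn S <= M')%MS.
Proof.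
have [m [v [Sv vfree H]]] := spn_ex S.
suff /(xgetPex 0) : exists M : 'M[R]_d, (forall x, S x -> (iota x <= M)%MS) /\
    forall M' : 'M[R]_d, (forall x, S x -> (iota x <= M')%MS) -> (M <= M')%MS.
  exact.
exists <<pts_mx v>>%MS; split=> [x Sx|M' HM].
  by rewrite genmxE H.
by rewrite genmxE; apply: pts_mx_sub => i; apply: HM.
Qed.

Lemma spn_in S x : S x -> (iota x <= spn S)%MS.
Proof. exact: (spnP S).1. Qed.

Lemma spn_min S m (M : 'M[R]_(m, d)) :
  (forall x, S x -> (iota x <= M)%MS) -> (spn S <= M)%MS.
Proof.
move=> H; suff : (spn S <= << M >>)%MS by rewrite genmxE.
by apply: (spnP S).2 => x Sx; rewrite genmxE H.
Qed.

Lemma spn_mono S T : S `<=` T -> (spn S <= spn T)%MS.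
Proof. by move=> ST; apply: spn_min => x /ST; exact: spn_in. Qed.

Lemma rk_mono S T : S `<=` T -> (rk S <= rk T)%N.
Proof. by move=> ST; apply/mxrankS/spn_mono. Qed.

Lemma spn_ann S w :
  (w <= spn S)%MS <->
  (forall h, (forall x, S x -> dotv h (iota x) = 0) -> dotv h w = 0).
Proof.
have [m [v [Sv _ H]]] := spn_ex S.
have E : (spn S :=: pts_mx v)%MS.
  apply/eqmxP; rewrite spn_min // pts_mx_sub //.
  by move=> i; apply: spn_in.
rewrite E; split=> [/sub_annP K h Hh|K].
  by apply: K => i; rewrite row_pts_mx; apply: Hh.
apply/sub_annP => h Hh; apply: K => x /H.
by move/sub_annP; apply.
Qed.

Lemma spn_ann0 S w h :
  (w <= spn S)%MS -> (forall x, S x -> dotv h (iota x) = 0) -> dotv h w = 0.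
Proof. by move=> /spn_ann; apply. Qed.

Lemma indep_rk S m (v : 'I_m -> X) :
  (forall i, S (v i)) -> row_free (pts_mx v) -> (m <= rk S)%N.
Proof.
move=> Sv /eqP <-; apply: mxrankS; apply: pts_mx_sub => i.
exact: spn_in.
Qed.

Lemma indep_complete S m (v : 'I_m -> X) :
  (forall i, S (v i)) -> row_free (pts_mx v) -> (m < rk S)%N ->
  exists2 x, S x & ~~ (iota x <= pts_mx v)%MS.
Proof.
move=> Sv vfree mS; apply: contrapT => H.
suff : (spn S <= pts_mx v)%MS.
  by move/mxrankS; rewrite (eqP vfree) leqNgt mS.
apply: spn_min => x Sx; apply: contrapT => xv.
by apply: H; exists x => //; apply/negP.
Qed.

Lemma indep_ptsP S m :
  indep_pts iota S m <-> (m <= rk S)%N.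
Proof.
split=> [[v [Sv vf]]|]; first exact: indep_rk vf.
elim: m => [_|m IH mS].
  unshelve eexists; first by case.
  split; first by case.
  by rewrite /row_free -leqn0 rank_leq_row.
have [v [Sv vf]] := IH (ltnW mS).
have [x Sx xv] := indep_complete Sv vf mS.
have [v' [Sv' v'f _ _]] := indep_extend Sv vf Sx xv.
by exists v'.
Qed.

Lemma pdimP S k : pdim iota S k <-> rk S = k.+1.
Proof.
rewrite /pdim !indep_ptsP; split=> [[H1 /negP H2]|->].
  by apply/eqP; rewrite eqn_leq H1 andbT leqNgt.
by split=> //; apply/negP; rewrite -ltnNge.
Qed.

Lemma spn_eq_rk S T : S `<=` T -> (rk T <= rk S)%N -> (spn T <= spn S)%MS.
Proof.
move=> ST TS; have := spn_mono ST.
by move=> /mxrank_leqif_sup/geq_leqif <-.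
Qed.

Lemma rk_lt S T y : S `<=` T -> T y -> ~~ (iota y <= spn S)%MS -> (rk S < rk T)%N.
Proof.
move=> ST Ty yS; apply: rank_ltmx; rewrite ltmxE spn_mono //=.
by apply: contra yS; apply: submx_trans; apply: spn_in.
Qed.

Lemma spn_line m n' (M : 'M[R]_(m, d)) (N : 'M[R]_(n', d)) (y w : 'rV[R]_d) :
  (M <= N)%MS -> \rank N = (\rank M).+1 -> (y <= N)%MS -> ~~ (y <= M)%MS ->
  (w <= N)%MS -> exists (u : 'rV[R]_d) (l : R), (u <= M)%MS /\ w = u + l *: y.
Proof.
move=> MN rN yN yM wN.
have MyN : (M + y <= N)%MS by rewrite addsmx_sub MN.
have lt : (\rank M < \rank (M + y)%MS)%N.
  apply: rank_ltmx; rewrite ltmxE addsmxSl /=; apply: contra yM.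
  by apply: submx_trans; apply: addsmxSr.
have NMy : (N <= M + y)%MS.
  by have /geq_leqif <- := mxrank_leqif_sup MyN; rewrite rN.
have /sub_addsmxP[[u1 u2] /= ->] := submx_trans wN NMy.
exists (u1 *m M), (u2 0 0); split; first exact: submxMl.
by congr (_ + _); rewrite {1}[u2]mx11_scalar mul_scalar_mx.
Qed.

End Span.

(** * Estimates and the ratio test *)

Section Aux.
Context {R : realType} {d : nat}.
Implicit Types u v w h : 'rV[R]_d.

Definition near_vec (r : R) u v := forall j, `|u 0 j - v 0 j| <= r.

Lemma small_all (T : eqType) (sq : seq T) (Q : T -> R -> Prop) :
  (forall x, x \in sq -> exists2 e0, 0 < e0 & forall e, 0 <= e <= e0 -> Q x e) ->
  exists2 e0, 0 < e0 & forall e, 0 <= e <= e0 -> forall x, x \in sq -> Q x e.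
Proof.
elim: sq => [_|x sq IH H]; first by exists 1.
have [e1 e10 H1] := H x (mem_head _ _).
have [|e2 e20 H2] := IH; first by move=> y ys; apply: H; rewrite inE ys orbT.
exists (Num.min e1 e2); first by rewrite lt_min e10.
move=> e /andP[e0]; rewrite le_min => /andP[ee1 ee2] y.
rewrite inE => /orP[/eqP ->|ys]; first by apply: H1; rewrite e0.
by apply: H2 => //; rewrite e0.
Qed.

Lemma small_allI m (Q : 'I_m -> R -> Prop) :
  (forall x, exists2 e0, 0 < e0 & forall e, 0 <= e <= e0 -> Q x e) ->
  exists2 e0, 0 < e0 & forall e, 0 <= e <= e0 -> forall x, Q x e.
Proof.
move=> H; have [|e0 e00 K] := @small_all _ (enum 'I_m) Q; first by move=> x _.
by exists e0 => // e /K Ke x; apply: Ke; rewrite mem_enum.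
Qed.


Lemma dotv_bound h : exists2 c, 0 < c & forall u (r : R), 0 <= r ->
  (forall j, `|u 0 j| <= r) -> `|dotv h u| <= c * r.
Proof.
(* The summand 1 keeps the constant positive for [h = 0], so that it can be divided by. *)
exists (1 + \sum_j `|h 0 j|); first by rewrite ltr_pwDl // sumr_ge0.
move=> u r r0 ur; rewrite dotvE (le_trans (ler_norm_sum _ _ _)) //.
rewrite mulrDl mul1r mulr_suml ler_wpDl // ler_sum // => j _.
by rewrite normrM ler_wpM2l.
Qed.

(** The ratio test of the simplex method: among the constraints that grow along [w], the one with
    the least [F] becomes tight first. *)
Lemma first_exit m (A : 'I_m -> 'rV[R]_d) (I : pred 'I_m) y w :
  (forall i, I i -> dotv (A i) y <= 0) -> (exists2 i, I i & 0 < dotv (A i) w) ->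
  exists t i0, [/\ 0 <= t, I i0, 0 < dotv (A i0) w,
    dotv (A i0) (y + t *: w) = 0 &
    forall i, I i -> dotv (A i) (y + t *: w) <= 0].
Proof.
move=> Ay [i1 Ii1 wi1].
pose P i := I i && (0 < dotv (A i) w).
pose F i := - dotv (A i) y / dotv (A i) w.
have Pi1 : P i1 by rewrite /P Ii1.
case: (@arg_minP _ _ _ i1 P F Pi1) => i0 /andP[Ii0 wi0] Fmin.
exists (F i0), i0; have F0 : 0 <= F i0.
  by rewrite divr_ge0 ?(ltW wi0) // oppr_ge0 Ay.
split=> //; first by rewrite !dotv_linE /F mulfVK ?gt_eqF // subrr.
move=> i Ii; rewrite !dotv_linE; have [wi|wi] := ltP 0 (dotv (A i) w).
  have : F i0 <= F i by apply: Fmin; rewrite /P Ii.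
  by rewrite [X in _ <= X]/F ler_pdivlMr //; lra.
by rewrite -[X in _ <= X](addr0 0) lerD ?Ay // mulr_ge0_le0.
Qed.

End Aux.

(** * Polyhedral cells *)

Section Cells.
Context {R : realType} {d : nat} {X : topologicalType} (iota : X -> 'rV[R]_d).
Context {chi : 'rV[R]_d} (chi1 : forall x, dotv chi (iota x) = 1).
Implicit Types (s S T : set X) (x y z p q : X) (h u v w : 'rV[R]_d).

Notation cell := (ipolyhedron iota).

Lemma cell_rep s : cell s -> exists m (A : 'I_m -> 'rV[R]_d),
  (forall x, s x -> forall i, dotv (A i) (iota x) <= 0) /\
  (forall v, dotv chi v = 1 -> (forall i, dotv (A i) v <= 0) ->
     exists2 x, s x & iota x = v).
Proof.
move=> [_ _ [m [A [b E]]] _ _].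
exists m, (fun i => A i - b i *: chi); split.
  move=> x sx i; rewrite !dotv_linE chi1 mulr1 subr_le0.
  have : (iota @` s) (iota x) by exists x.
  by rewrite E; apply.
move=> v v1 H; suff : (iota @` s) v by [].
by rewrite E => i; have := H i; rewrite !dotv_linE v1 mulr1 subr_le0.
Qed.

Lemma cell_inj s x y : cell s -> s x -> s y -> iota x = iota y -> x = y.
Proof. by case=> _ H *; apply: H. Qed.

Definition cvx S := forall x y (t : R), S x -> S y -> 0 <= t <= 1 ->
  exists2 z, S z & iota z = iota x + t *: (iota y - iota x).

Lemma cell_cvx s : cell s -> cvx s.
Proof.
move=> /cell_rep[m [A [sA As]]] x y t sx sy /andP[t0 t1].
apply: As => [|i]; first by rewrite !dotv_linE !chi1 subrr mulr0 addr0.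
have := sA _ sx i; have := sA _ sy i; rewrite !dotv_linE; nra.
Qed.

(** Constraints that are slack at [p] survive a short step, so only the tight ones restrict the
    direction. *)
Lemma rep_step s m (A : 'I_m -> 'rV[R]_d) p w :
  (forall x, s x -> forall i, dotv (A i) (iota x) <= 0) ->
  (forall v, dotv chi v = 1 -> (forall i, dotv (A i) v <= 0) ->
     exists2 x, s x & iota x = v) ->
  s p -> dotv chi w = 0 -> (forall i, dotv (A i) (iota p) = 0 -> dotv (A i) w <= 0) ->
  exists2 e0, 0 < e0 & forall e, 0 <= e <= e0 ->
    exists2 z, s z & iota z = iota p + e *: w.
Proof.
move=> sA As sp w0 H.
pose Q i (e : R) := dotv (A i) (iota p + e *: w) <= 0.
have [i|e0 e00 K] := @small_allI _ m Q; last first.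
  exists e0 => // e /K Ke; apply: As => [|i]; last exact: Ke.
  by rewrite !dotv_linE chi1 w0 mulr0 addr0.
rewrite /Q; have [Ai0|Ai0] := eqVneq (dotv (A i) (iota p)) 0.
  exists 1 => // e /andP[e0 _]; rewrite !dotv_linE Ai0 add0r.
  by rewrite mulr_ge0_le0 // H.
have Alt : dotv (A i) (iota p) < 0 by rewrite lt_neqAle Ai0 sA.
have [Aw|Aw] := leP (dotv (A i) w) 0.
  exists 1 => // e /andP[e0 _]; rewrite !dotv_linE; nra.
exists (- dotv (A i) (iota p) / dotv (A i) w).
  by rewrite divr_gt0 // oppr_gt0.
move=> e /andP[e0]; rewrite ler_pdivlMr // !dotv_linE; lra.
Qed.

Lemma cell_step s p w : cell s -> s p -> dotv chi w = 0 ->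
  (forall h, (forall x, s x -> dotv h (iota x) <= 0) -> dotv h (iota p) = 0 ->
     dotv h w <= 0) ->
  exists2 e0, 0 < e0 & forall e, 0 <= e <= e0 ->
    exists2 z, s z & iota z = iota p + e *: w.
Proof.
move=> /cell_rep[m [A [sA As]]] sp w0 H.
by apply: (rep_step sA As) => // i; apply: H => x /sA.
Qed.

(** The relative interior, described by supporting forms instead of a topology on the affine span:
    [p] lies on no proper exposed face. *)
Definition relint S p := S p /\ forall h,
  (forall x, S x -> dotv h (iota x) <= 0) -> dotv h (iota p) = 0 ->
  forall x, S x -> dotv h (iota x) = 0.

(** Midpoints with the members of a finite spanning family are taken in turn: a form that is
    nonpositive on [S] and vanishes at a midpoint vanishes at both ends. *)
Lemma relint_ex S x0 : cvx S -> S x0 -> exists p, relint S p.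
Proof.
move=> Scvx Sx0.
have [m [v [Sv _ Hv]]] := spn_ex iota S.
suff [p [Sp Hp]] : exists p, S p /\ forall h,
    (forall x, S x -> dotv h (iota x) <= 0) -> dotv h (iota p) = 0 ->
    forall i, i \in enum 'I_m -> dotv h (iota (v i)) = 0.
  exists p; split=> // h hS hp x /Hv /sub_annP; apply=> i.
  by rewrite row_pts_mx; apply: Hp => //; rewrite mem_enum.
elim: (enum 'I_m) => [|i sq [p [Sp Hp]]]; first by exists x0.
have half : 0 <= (2^-1 : R) <= 1 by lra.
have [z Sz Ez] := Scvx (v i) p 2^-1 (Sv i) Sp half.
exists z; split=> // h hS; rewrite Ez !dotv_linE => hz.
have hvi := hS _ (Sv i); have hp := hS _ Sp.
move=> j; rewrite inE => /orP[/eqP ->|]; first by lra.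
by apply: Hp => //; lra.
Qed.

Lemma relint_seg S p x z (t : R) : relint S p -> S x -> S z -> 0 <= t < 1 ->
  iota z = iota p + t *: (iota x - iota p) -> relint S z.
Proof.
move=> [Sp Hp] Sx Sz /andP[t0 t1] Ez; split=> // h hS.
rewrite Ez !dotv_linE => hz; apply: Hp => //.
have := hS _ Sp; have := hS _ Sx; nra.
Qed.

Lemma relint_spn S p h w : relint S p ->
  (forall x, S x -> dotv h (iota x) <= 0) -> dotv h (iota p) = 0 ->
  (w <= spn iota S)%MS -> dotv h w = 0.
Proof. by move=> [_ Hp] hS hp /spn_ann0; apply; apply: Hp. Qed.

(** Constraints tight at [q] vanish on the whole span, so only slack ones limit [u]. *)
Lemma relint_ball s q : cell s -> relint s q -> exists2 r, 0 < r &
  forall u, (u <= spn iota s)%MS -> dotv chi u = 0 ->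
    (forall j, `|u 0 j| <= r) -> exists2 z, s z & iota z = iota q + u.
Proof.
move=> /cell_rep[m [A [sA As]]] [sq Hq].
pose Q i (e : R) := forall u, (u <= spn iota s)%MS ->
    (forall j, `|u 0 j| <= e) -> dotv (A i) (iota q + u) <= 0.
have [i|e0 e00 K] := @small_allI _ m Q; last first.
  exists e0 => // u us u0 ue; apply: As => [|i]; last first.
    by apply: (K e0) => //; rewrite lexx (ltW e00).
  by rewrite !dotv_linE chi1 u0 addr0.
rewrite /Q; have [Ai0|Ai0] := eqVneq (dotv (A i) (iota q)) 0.
  exists 1 => // e _ u us _; rewrite !dotv_linE Ai0 add0r.
  by rewrite (spn_ann0 us) // => x sx; apply: Hq => // y /sA.
have Alt : dotv (A i) (iota q) < 0 by rewrite lt_neqAle Ai0 sA.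
have [c c0 Hc] := dotv_bound (A i).
exists (- dotv (A i) (iota q) / c); first by rewrite divr_gt0 // oppr_gt0.
move=> e /andP[e0]; rewrite ler_pdivlMr // => ec u _ ue; rewrite !dotv_linE.
have := Hc u e e0 ue; have := ler_norm (dotv (A i) u); lra.
Qed.

(** Near [x0] the cell agrees with its tangent cone: constraints tight at [x0] are invariant under
    dilation from [x0], and the slack ones tolerate a displacement of size [r]. *)
Lemma cell_dilate s x0 : cell s -> s x0 -> exists2 r, 0 < r &
  forall y (e : R), s y -> 0 < e -> near_vec (r * e) (iota y) (iota x0) ->
    exists2 z, s z & iota y = iota x0 + e *: (iota z - iota x0).
Proof.
move=> /cell_rep[m [A [sA As]]] sx0.
pose Q i (r : R) := forall y (e : R), s y -> 0 < e ->
  near_vec (r * e) (iota y) (iota x0) ->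
  dotv (A i) (iota x0 + e^-1 *: (iota y - iota x0)) <= 0.
have [i|r r0 K] := @small_allI _ m Q; last first.
  exists r => // y e sy e0 yx.
  have [||z sz Ez] := As (iota x0 + e^-1 *: (iota y - iota x0)).
  - by rewrite !dotv_linE !chi1 subrr mulr0 addr0.
  - by move=> i; apply: (K r _ i y e) => //; rewrite lexx ltW.
  exists z => //; rewrite Ez [X in e *: X]addrC addKr scalerA mulfV ?gt_eqF //.
  by rewrite scale1r addrC subrK.
rewrite /Q; have [Ai0|Ai0] := eqVneq (dotv (A i) (iota x0)) 0.
  exists 1 => // r _ y e sy e0 _; rewrite !dotv_linE Ai0 add0r subr0.
  by rewrite mulr_ge0_le0 ?invr_ge0 ?(ltW e0) // sA.
have Alt : dotv (A i) (iota x0) < 0 by rewrite lt_neqAle Ai0 sA.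
have [c c0 Hc] := dotv_bound (A i).
exists (- dotv (A i) (iota x0) / c); first by rewrite divr_gt0 // oppr_gt0.
move=> r /andP[r0]; rewrite ler_pdivlMr // => rc y e sy e0 yx.
have {}yx j : `|(iota y - iota x0) 0 j| <= r * e by rewrite !mxE; apply: yx.
have := Hc _ _ (mulr_ge0 r0 (ltW e0)) yx.
have := ler_norm (dotv (A i) (iota y - iota x0)).
rewrite [X in _ -> _ -> X <= 0]dotvDr dotvZr.
set D := dotv (A i) (iota y - iota x0) => D1 D2.
have : e^-1 * D <= c * r.
  by rewrite mulrC ler_pdivrMr //; lra.
lra.
Qed.

Definition concave_on S (f : X -> R) := forall x y z (t : R), S x -> S y -> S z ->
  0 <= t <= 1 -> iota z = iota x + t *: (iota y - iota x) ->
  (1 - t) * f x + t * f y <= f z.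

Definition bounded_on S := exists B : R, forall x, S x -> forall j, `|iota x 0 j| <= B.

(* Induction on the number of constraints not assumed tight: inside the face cut
   out by I, a line through y leaves the cell on both sides at points with one
   more tight constraint, and f y is at least the smaller of the two values. *)
Lemma concave_lower_bound s f : cell s -> bounded_on s -> concave_on s f ->
  exists C, forall x, s x -> C <= f x.
Proof.
move=> cs [B sB] fs; have [m [A [sA As]]] := cell_rep cs.
suff H k (I : {set 'I_m}) : #|~: I| = k ->
    exists C, forall x, s x -> (forall i, i \in I -> dotv (A i) (iota x) = 0) -> C <= f x.
  have [C HC] := H _ finset.set0 erefl; exists C => x sx; apply: HC => // i.
  by rewrite inE.
elim/ltn_ind: k I => k IH I Ik.
have [[a [b [sa sb Ia Ib ab]]]|nab] := pselect (exists a b, [/\ s a, s b,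
    (forall i, i \in I -> dotv (A i) (iota a) = 0),
    (forall i, i \in I -> dotv (A i) (iota b) = 0) & iota a <> iota b]); last first.
  have [[x [sx Ix]]|nx] := pselect (exists x, s x /\
      forall i, i \in I -> dotv (A i) (iota x) = 0); last first.
    by exists 0 => x sx Ix; case: nx; exists x.
  exists (f x) => y sy Iy; suff -> : y = x by [].
  apply: (cell_inj cs sy sx); apply: contrapT => yx; apply: nab.
  by exists y, x.
have HC i : exists C, i \notin I -> forall x, s x ->
    (forall j, j \in (i |: I)%SET -> dotv (A j) (iota x) = 0) -> C <= f x.
  have [iI|iI] := boolP (i \in I); first by exists 0.
  have [|C HC] := IH _ _ (i |: I)%SET erefl; last by exists C.
  rewrite -Ik; apply: proper_card; apply/properP; split.
    by apply/fintype.subsetP => j; rewrite !inE negb_or => /andP[].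
  by exists i; rewrite !inE ?eqxx.
have {HC}[C HC] := choice HC.
(* A common lower bound of all the [C i]; those with [i] in [I] are dummies. *)
exists (- \sum_i `|C i|) => y sy Iy.
have bound i x : i \notin I -> s x ->
    (forall j, j \in (i |: I)%SET -> dotv (A j) (iota x) = 0) ->
    - \sum_i `|C i| <= f x.
  move=> iI sx Ix; apply: le_trans (HC i iI x sx Ix).
  rewrite lerNl (bigD1 i) //= ler_wpDr ?sumr_ge0 //.
  by rewrite -normrN ler_norm.
have exit w : w != 0 -> dotv chi w = 0 ->
    (forall i, i \in I -> dotv (A i) w = 0) ->
    exists t z, [/\ 0 <= t, s z, iota z = iota y + t *: w &
       - \sum_i `|C i| <= f z].
  move=> w0 chiw Iw.
  have [i _||t [i [t0 _ wi zi zI]]] := @first_exit _ _ m A xpredT (iota y) w.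
  - by rewrite sA.
  - apply: contrapT => nw; move/negP: w0; apply; apply/eqP/rowP => j.
    rewrite mxE; apply: contrapT => /eqP wj.
    have B0 : 0 <= B by apply: le_trans (sB _ sy j).
    (* If no constraint grew along [w], the whole ray would stay in [s]; this length moves
       coordinate [j] by more than the diameter [B + B]. *)
    pose t := (1 + B + B) / `|w 0 j|.
    have t0 : 0 <= t by rewrite divr_ge0 // addr_ge0 // addr_ge0.
    have [||z sz Ez] := As (iota y + t *: w).
    + by rewrite !dotv_linE chiw chi1 mulr0 addr0.
    + move=> i; have : dotv (A i) w <= 0.
        by rewrite leNgt; apply/negP => wi; apply: nw; exists i.
      have := sA _ sy i; rewrite !dotv_linE; nra.
    have := sB _ sz j; rewrite Ez !mxE => zB.
    have : `|t * w 0 j| <= B + B.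
      have -> : t * w 0 j = (iota y 0 j + t * w 0 j) - iota y 0 j by ring.
      by apply: le_trans (ler_normB _ _) _; apply: lerD => //; apply: sB.
    rewrite normrM (ger0_norm t0) /t mulfVK ?normr_eq0 //; lra.
  have [||z sz Ez] := As (iota y + t *: w).
  - by rewrite !dotv_linE chiw chi1 mulr0 addr0.
  - by move=> j; apply: zI.
  exists t, z; split=> //; apply: (bound i) => //.
    by apply/negP => /Iw wi0; move: wi; rewrite wi0 ltxx.
  move=> j; rewrite in_setU1 Ez => /orP[/eqP -> //|jI].
  by rewrite !dotv_linE Iy // Iw // mulr0 addr0.
have ab0 : iota b - iota a != 0.
  by apply/eqP => /eqP; rewrite subr_eq0 => /eqP; apply: nesym.
have [||t1 [z1 [t10 sz1 Ez1 fz1]]] := exit _ ab0.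
- by rewrite dotvBr !chi1 subrr.
- by move=> i iI; rewrite dotvBr Ia // Ib // subrr.
have [|||t2 [z2 [t20 sz2 Ez2 fz2]]] := exit (- (iota b - iota a)).
- by rewrite oppr_eq0.
- by rewrite dotvNr dotvBr !chi1 subrr oppr0.
- by move=> i iI; rewrite dotvNr dotvBr Ia // Ib // subrr oppr0.
(* The position of [y] between [z1] and [z2]. If [t1 + t2 = 0], the quotient is 0 by convention and
   [z1] has the image of [y]. *)
have t01 : 0 <= t1 / (t1 + t2) <= 1.
  rewrite divr_ge0 ?addr_ge0 //=; have [->|n0] := eqVneq (t1 + t2) 0.
    by rewrite invr0 mulr0.
  rewrite ler_pdivrMr ?mul1r ?lerDl // lt_neqAle eq_sym n0; lra.
have : (1 - t1 / (t1 + t2)) * f z1 + t1 / (t1 + t2) * f z2 <= f y.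
  apply: fs => //; rewrite Ez1 Ez2; set D := iota b - _.
  have -> : iota y + t2 *: - D - (iota y + t1 *: D) = - (t1 + t2) *: D.
    by rewrite scalerN opprD addrACA subrr add0r -opprD -scalerDl scaleNr addrC.
  rewrite scalerA mulrN; have [n0|n0] := eqVneq (t1 + t2) 0.
    have -> : t1 = 0 by lra.
    by rewrite mul0r mul0r oppr0 !scale0r !addr0.
  by rewrite mulfVK // scaleNr addrK.
case/andP: t01; nra.
Qed.

(** This uses that [iota] is open onto the image of a cell; [cell_cont] is the converse half.
    Together they exchange neighbourhoods in a cell for coordinate boxes. *)
Lemma cell_nbhs s x (O : set X) : cell s -> s x -> open O -> O x ->
  exists2 r, 0 < r & forall y, s y -> near_vec r (iota y) (iota x) -> O y.
Proof.
move=> cs sx oO Ox; have [_ _ _ _ /(_ _ oO)] := cs => -[V [oV E]].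
have Vx : V (iota x).
  have : (iota @` (s `&` O)) (iota x) by exists x.
  by rewrite E => -[].
have : nbhs (iota x) V by exact: open_nbhs_nbhs.
case/nbhs_ballP => e /= e0 He; exists (e / 2); first by rewrite divr_gt0.
move=> y sy yx; have : (iota @` s `&` V) (iota y).
  split; first by exists y.
  apply: He; split=> // i j; rewrite !ord1 /ball /= distrC.
  by apply: le_lt_trans (yx j) _; lra.
rewrite -E => -[z [sz Oz] zy].
by rewrite -(cell_inj cs sz sy zy).
Qed.

Lemma cell_cont s x (r : R) : cell s -> s x -> 0 < r ->
  exists O : set X, [/\ open O, O x &
    forall y, s y -> O y -> near_vec r (iota y) (iota x)].
Proof.
move=> cs sx r0; have [_ _ _ + _] := cs.
move=> /subspace_continuousP /(_ _ sx) H.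
have /H : nbhs (iota x) (ball (iota x) r) by exact: nbhsx_ballx.
rewrite /fmap /= /within /= nbhsE => -[N [Nopen Nx] HN].
exists N; split=> // y sy Ny j.
by rewrite distrC ltW //; have [_ /(_ 0 j)] := HN y Ny sy.
Qed.

Lemma cell_shrink s x y (O : set X) : cell s -> s x -> s y -> open O -> O x ->
  exists z (e : R), [/\ 0 < e <= 1, s z, O z & iota z = iota x + e *: (iota y - iota x)].
Proof.
move=> cs sx sy Oopen Ox; have [r r0 Hr] := cell_nbhs cs sx Oopen Ox.
pose B := \sum_j `|(iota y - iota x) 0 j|.
have B0 : 0 <= B by rewrite sumr_ge0.
pose e := Num.min 1 (r / (1 + B)).
have e01 : 0 < e <= 1 by rewrite lt_min ltr01 /= ge_min lexx /= divr_gt0 // ltr_pwDl.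
have [|z sz Ez] := cell_cvx cs (t := e) sx sy.
  by case/andP: e01 => /ltW -> ->.
exists z, e; split=> //; apply: Hr => // j; rewrite Ez.
have -> : (iota x + e *: (iota y - iota x)) 0 j - iota x 0 j
    = e * (iota y - iota x) 0 j by rewrite !mxE; ring.
case/andP: e01 => e0 _; rewrite normrM (gtr0_norm e0).
apply: (@le_trans _ _ (e * (1 + B))).
  rewrite ler_pM2l // /B (bigD1 j) //= addrCA lerDl addr_ge0 //.
  by rewrite sumr_ge0.
rewrite -ler_pdivlMr; last by rewrite ltr_pwDl.
by rewrite ge_min lexx orbT.
Qed.

(** An open piece of a cell spans as much as the cell, since every point can be moved towards [x]
    into [O]. *)
Lemma open_spn s x h w (O : set X) : cell s -> s x -> open O -> O x ->
  (forall z, s z -> O z -> dotv h (iota z) = 0) -> (w <= spn iota s)%MS ->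
  dotv h w = 0.
Proof.
move=> cs sx Oopen Ox hz /spn_ann0; apply=> y sy.
have [z [e [/andP[e0 _] sz Oz Ez]]] := cell_shrink cs sx sy Oopen Ox.
by have := hz z sz Oz; have := hz x sx Ox; rewrite Ez !dotv_linE; nra.
Qed.

Lemma relint_open s x (O : set X) : cell s -> s x -> open O -> O x ->
  exists2 p, relint s p & O p.
Proof.
move=> cs sx Oopen Ox; have [q rq] := relint_ex (cell_cvx cs) sx.
have [z [e [/andP[e0 e1] sz Oz Ez]]] := cell_shrink cs sx rq.1 Oopen Ox.
exists z => //; apply: (relint_seg (t := 1 - e) rq sx sz); first lra.
by rewrite Ez; apply/rowP => j; rewrite !mxE; ring.
Qed.

End Cells.

(** * Complexes, subdivisions and hyperplane cuts *)

Section Complexes.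
Context {R : realType} {d : nat} {X : topologicalType} (iota : X -> 'rV[R]_d).
Context {chi : 'rV[R]_d} (chi1 : forall x, dotv chi (iota x) = 1).
Implicit Types (s t S T F : set X) (P Q : set (set X)) (x y z p q : X).
Implicit Types (a h u v w : 'rV[R]_d).

Notation cell := (ipolyhedron iota).
Notation is_face := (is_face iota).
Notation is_complex := (is_complex iota).
Notation relint := (relint iota).
Notation rk := (rk iota).

Lemma faceP t s : is_face t s <-> exists h,
  (forall x, s x -> dotv h (iota x) <= 0) /\
  t = [set x | s x /\ dotv h (iota x) = 0].
Proof.
split=> [[_ [a [b [H ->]]]]|[h [H ->]]].
  exists (a - b *: chi); split=> [x /H|].
    by rewrite !dotv_linE chi1; lra.
  apply/seteqP; split=> x /= [sx E]; split=> //; move: E;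
    rewrite !dotv_linE chi1; lra.
by split=> [x []//|]; exists h, 0.
Qed.

Lemma cx_cell P s : is_complex P -> P s -> cell s.
Proof. by case=> _ _ H _ _; apply: H. Qed.

Lemma cx_cvx P s : is_complex P -> P s -> cvx iota s.
Proof. by move=> cP Ps; apply: (cell_cvx chi1); apply: cx_cell Ps. Qed.

Lemma cx_face P s h : is_complex P -> P s ->
  (forall x, s x -> dotv h (iota x) <= 0) ->
  P [set x | s x /\ dotv h (iota x) = 0].
Proof.
case=> _ _ _ H _ Ps hs; apply: (H s) => //; apply/faceP.
by exists h.
Qed.

Lemma cx_sub_face P s t : is_complex P -> P s -> P t -> t `<=` s -> is_face t s.
Proof.
case=> _ _ _ _ H Ps Pt ts; have [+ _] := H s t Ps Pt.
by rewrite (_ : s `&` t = t) //; apply/setIidr.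
Qed.

(** The common face contains a relative interior point of [s], hence is all of [s]. *)
Lemma relint_sub P s s' p : is_complex P -> P s -> P s' ->
  relint s p -> s' p -> s `<=` s'.
Proof.
case=> _ _ _ _ H Ps Ps' [sp Hp] s'p x sx.
have [/faceP[h [hs E]] _] := H s s' Ps Ps'.
have hp : dotv h (iota p) = 0.
  have : (s `&` s') p by [].
  by rewrite E => -[].
suff : (s `&` s') x by case.
by rewrite E; split=> //; apply: Hp.
Qed.

(** The form that cuts out the face [s] vanishes on its span, which is the span of [s']. *)
Lemma cell_eq_rk P s s' : is_complex P -> P s -> P s' -> s `<=` s' ->
  (rk s' <= rk s)%N -> s = s'.
Proof.
move=> cP Ps Ps' ss' rs; apply/seteqP; split=> // x s'x.
have /faceP[h [hs E]] := cx_sub_face cP Ps' Ps ss'.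
have := submx_trans (spn_in iota s'x) (spn_eq_rk ss' rs).
move=> /spn_ann0 => /(_ h) hx.
rewrite E; split=> //; apply: hx => y; rewrite E.
by case.
Qed.

Lemma cx_uniq P S S' s : is_complex P -> P S -> P S' -> s `<=` S -> s `<=` S' ->
  (rk S <= rk s)%N -> (rk S' <= rk s)%N -> S = S'.
Proof.
move=> cP PS PS' sS sS' rS rS'.
have key T T' : P T -> P T' -> s `<=` T -> s `<=` T' -> (rk T <= rk s)%N -> T `<=` T'.
  move=> PT PT' sT sT' rT; have [_ _ _ _ /(_ _ _ PT PT')] := cP.
  move=> -[/faceP[h [hs E]] _] y Ty; suff : (T `&` T') y by case.
  rewrite E; split=> //.
  apply: (spn_ann0 (submx_trans (spn_in iota Ty) (spn_eq_rk sT rT))) => z sz.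
  have : (T `&` T') z by split; [apply: sT | apply: sT'].
  by rewrite E => -[].
by apply/seteqP; split; apply: key.
Qed.

Lemma cx_star P x : is_complex P ->
  exists sq : seq (set X), uniq sq /\ forall s, (s \in sq) = `[< P s /\ s x >].
Proof.
case=> _ /(_ x)[N [Nx fin]] _ _ _.
have : finite_set [set s | P s /\ s x].
  apply: sub_finite_set fin => s [Ps sx]; split=> //; exists x; split=> //.
  exact: nbhs_singleton.
move=> /finite_seqP[sq E]; exists (undup sq); rewrite undup_uniq; split=> // s.
rewrite mem_undup; apply/idP/asboolP => [ssq|].
  have : [set` sq] s by [].
  by rewrite -E.
by move=> H; have : [set s | P s /\ s x] s by []; rewrite E.
Qed.

(** From a neighbourhood that meets finitely many cells, remove those that miss [x]; they are
    closed. *)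
Lemma cx_loc P x : is_complex P -> exists N : set X, [/\ open N, N x &
  forall s, P s -> (s `&` N !=set0) -> s x].
Proof.
move=> cP; have [_ /(_ x)[N [Nx fin]] _ _ _] := cP.
have /finite_seqP[sq E] := fin.
suff [N' [oN' N'x H]] : exists N' : set X, [/\ open N', N' x &
    forall s, s \in sq -> P s -> (s `&` N' !=set0) -> s x].
  have := Nx; rewrite nbhsE => -[V [Vopen Vx] VN].
  exists (V `&` N'); split=> //; first exact: openI.
  move=> s Ps [y [sy [Vy N'y]]]; apply: H => //; last by exists y.
  have : [set` sq] s; last by [].
  by rewrite -E; split=> //; exists y; split=> //; apply: VN.
elim: (sq) => [|s sq' [N' [oN' N'x H]]]; first by exists setT; split=> //; exact: openT.
have [[Ps nsx]|nPs] := pselect (P s /\ ~ s x).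
  exists (N' `&` ~` s); split.
  - by apply: openI => //; apply: closed_openC; have [] := cx_cell cP Ps.
  - by split.
  - move=> s'; rewrite inE => /orP[/eqP -> _ [y [sy []]] //|].
    by move=> s'q Ps' [y [s'y [N'y _]]]; apply: H => //; exists y.
exists N'; split=> // s'; rewrite inE => /orP[/eqP ->|]; last exact: H.
by move=> Ps _; apply: contrapT => nsx; apply: nPs.
Qed.

(** A cell of least rank through [x]: a form that vanishes at [x] but not on the cell would cut out
    a smaller one. *)
Lemma carrier P x : is_complex P -> exists F, P F /\ relint F x.
Proof.
move=> cP; have [/(_ x)[s0 [Ps0 s0x]] _ _ _ _] := cP.
pose Pn n := `[< exists s, [/\ P s, s x & rk s = n] >].
have exn : exists n, Pn n by exists (rk s0); apply/asboolP; exists s0.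
case: (ex_minnP exn) => n /asboolP[F [PF Fx Fn]] nmin.
exists F; split=> //; split=> // h hF hx y Fy.
have PG := cx_face cP PF hF; set G := [set x | _] in PG.
have GF : G `<=` F by move=> z [].
have : (rk F <= rk G)%N.
  by rewrite Fn; apply: nmin; apply/asboolP; exists G.
move=> /(cell_eq_rk cP PG PF GF) E; have : G y by rewrite E.
by case.
Qed.

Lemma rk_gt0 S x : S x -> (0 < rk S)%N.
Proof.
move=> Sx; rewrite rkE lt0n mxrank_eq0; apply/eqP => E.
have := spn_in iota Sx; rewrite E submx0 => /eqP ix.
by have := chi1 x; rewrite ix dotv0 => /eqP; rewrite eq_sym oner_eq0.
Qed.

Section Subdivision.
Variables (P Q : set (set X)).
Hypotheses (cP : is_complex P) (cQ : is_complex Q) (QP : subdivides Q P).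

(** A point of the segment close to [p] lies in a cell of [Q] through [p], inside some [S'] of [P].
    The form that cuts the common face with [S] out of [S'] cuts out of this cell a face inside
    [S]. *)
Lemma sub_germ S p y : P S -> S p -> S y -> exists s, [/\ Q s, s `<=` S, s p &
  exists z (e : R), [/\ 0 < e <= 1, s z & iota z = iota p + e *: (iota y - iota p)]].
Proof.
move=> PS Sp Sy; have [N [Nopen Np HN]] := cx_loc p cQ.
have [z [e [e01 Sz Nz Ez]]] := cell_shrink chi1 (cx_cell cP PS) Sp Sy Nopen Np.
have [/(_ z)[s [Qs sz]] _ _ _ _] := cQ.
have sp : s p by apply: HN => //; exists z.
have [S' [PS' sS']] := QP Qs.
have [_ _ _ _ /(_ _ _ PS' PS)[/faceP[h [hS' E]] _]] := cP.
have hs x : s x -> dotv h (iota x) <= 0 by move=> /sS'; apply: hS'.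
have inS x : s x -> S x -> dotv h (iota x) = 0.
  move=> sx Sx; have : (S' `&` S) x by split=> //; apply: sS'.
  by rewrite E => -[].
exists [set x | s x /\ dotv h (iota x) = 0]; split.
- exact: cx_face.
- move=> x [sx hx]; suff : (S' `&` S) x by case.
  by rewrite E; split=> //; apply: sS'.
- by split=> //; apply: inS.
- by exists z, e; split=> //; split=> //; apply: inS.
Qed.

(* A cell s of Q through x, inside S and of largest rank: if y in S were outside
   spn s, the germ at a relative interior point of s of the segment towards y
   would lie in a cell that contains s and has larger rank. *)
Lemma sub_rk S x : P S -> S x -> exists s, [/\ Q s, s `<=` S, s x & rk s = rk S].
Proof.
move=> PS Sx.
pose Pn n := `[< exists s, [/\ Q s, s `<=` S, s x & rk s = n] >].
have [s0 [Qs0 s0S s0x _]] := sub_germ PS Sx Sx.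
have exn : exists n, Pn n by exists (rk s0); apply/asboolP; exists s0.
have bn n : Pn n -> (n <= rk S)%N.
  by move=> /asboolP[s [_ sS _ <-]]; apply: rk_mono.
case: (ex_maxnP exn bn) => n /asboolP[s [Qs sS sx sn]] nmax.
exists s; split=> //; apply/eqP; rewrite eqn_leq rk_mono //=.
rewrite leqNgt; apply/negP => lt.
have [y Sy ys] : exists2 y, S y & ~~ (iota y <= spn iota s)%MS.
  apply: contrapT => H; move: lt; rewrite ltnNge => /negP; apply.
  apply/mxrankS/spn_min => y Sy; apply: contrapT => ys; apply: H.
  by exists y => //; apply/negP.
have [p rp] := relint_ex (cx_cvx cQ Qs) sx.
have [s' [Qs' s'S s'p [z [e [/andP[e0 _] s'z Ez]]]]] := sub_germ PS (sS _ rp.1) Sy.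
have ss' := relint_sub cQ Qs Qs' rp s'p.
have : (rk s' <= n)%N by apply: nmax; apply/asboolP; exists s'; split=> //; apply: ss'.
rewrite -sn leqNgt => /negP; apply; apply: (rk_lt ss' s'z).
apply: contra ys => zs.
have -> : iota y = iota p + e^-1 *: (iota z - iota p).
  by rewrite Ez [X in X - _]addrC addrK scalerA mulVf ?gt_eqF // scale1r addrC subrK.
have ps := spn_in iota rp.1.
by rewrite addmx_sub ?scalemx_sub ?addmx_sub ?eqmx_opp.
Qed.

End Subdivision.

Lemma subdivides_refl P : subdivides P P.
Proof. by move=> s Ps; exists s; split=> // x. Qed.

Lemma subdivides_trans P Q P' : subdivides P Q -> subdivides Q P' -> subdivides P P'.
Proof.
move=> PQ QT s /PQ[s' [/QT[s'' [Ts'' s's'']] ss']].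
by exists s''; split=> //; apply: subset_trans s's''.
Qed.

End Complexes.

(** * Cutting a complex along hyperplanes *)

Section Cuts.
Context {R : realType} {d : nat} {X : topologicalType} (iota : X -> 'rV[R]_d).
Context {chi : 'rV[R]_d} (chi1 : forall x, dotv chi (iota x) = 1).
Implicit Types (s t S F : set X) (P Q : set (set X)) (x y z p q : X).
Implicit Types (a h u v w : 'rV[R]_d).

Notation cell := (ipolyhedron iota).
Notation is_face := (is_face iota).
Notation is_complex := (is_complex iota).
Notation relint := (relint iota).
Notation rk := (rk iota).

Lemma cell_half s a : cell s -> cell (s `&` [set x | dotv a (iota x) <= 0]).
Proof.
move=> cs; have [cl inj [m [A [b E]]] ct hom] := cs.
have sub : s `&` [set x | dotv a (iota x) <= 0] `<=` s by move=> x [].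
split.
- move=> x clx.
  have sx : s x by apply: cl => B /clx[y [[sy _] By]]; exists y.
  split=> //=; rewrite leNgt; apply/negP => ax.
  have [c c0 Hc] := dotv_bound a.
  have r0 : 0 < dotv a (iota x) / (2 * c) by rewrite divr_gt0 // mulr_gt0.
  have [N [Nopen Nx HN]] := cell_cont cs sx r0.
  have [y [[sy /= ay] Ny]] := clx N (open_nbhs_nbhs (conj Nopen Nx)).
  have yx j : `|(iota y - iota x) 0 j| <= dotv a (iota x) / (2 * c).
    by rewrite !mxE; apply: HN.
  have := Hc _ _ (ltW r0) yx.
  have -> : c * (dotv a (iota x) / (2 * c)) = dotv a (iota x) / 2.
    by field; rewrite gt_eqF.
  by rewrite dotvBr ler_norml; lra.
- by move=> x y [sx _] [sy _]; apply: inj.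
- exists m.+1, (fun i => if unlift ord0 i is Some j then A j else a),
    (fun i => if unlift ord0 i is Some j then b j else 0).
  apply/seteqP; split=> v.
    move=> [x [sx ax] <-] i; case: unliftP => [j _|_] //.
    have : (iota @` s) (iota x) by exists x.
    by rewrite E; apply.
  move=> /= H; have : (iota @` s) v.
    by rewrite E => j; have := H (lift ord0 j); rewrite liftK.
  move=> [x sx xv]; exists x => //; split=> //=; rewrite xv.
  by have := H ord0; rewrite unlift_none.
- exact: continuous_subspaceW sub ct.
- move=> V Vopen; have [V' [V'open EV]] := hom V Vopen.
  exists V'; split=> //; apply/seteqP; split=> v.
    move=> [x [[sx ax] Vx] <-]; split; first by exists x.
    have : (iota @` (s `&` V)) (iota x) by exists x.
    by rewrite EV => -[].
  move=> [[x [sx ax] <-] V'x]; have : (iota @` s `&` V') (iota x).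
    by split=> //; exists x.
  rewrite -EV => -[y [sy Vy] yx].
  by exists x => //; split=> //; rewrite -(inj _ _ sy sx yx).
Qed.

(** The hyperplane itself is a third option, because the pieces on its two sides meet in it and a
    complex must contain common faces. *)
Definition hs (j : option bool) a : set X := [set x |
  match j with
  | Some true => 0 <= dotv a (iota x)
  | Some false => dotv a (iota x) <= 0
  | None => dotv a (iota x) = 0
  end].

Lemma cell_hs s j a : cell s -> cell (s `&` hs j a).
Proof.
move=> cs; case: j => [[]|]; last 1 first.
- have := cell_half (- a) (cell_half a cs).
  congr (ipolyhedron iota _); apply/seteqP; split=> x /=.
    move=> [[sx a1]]; rewrite dotvNl => a2; split=> //; rewrite /hs /=; lra.
  by move=> [sx]; rewrite /hs /= dotvNl => ->; rewrite oppr0.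
- have := cell_half (- a) cs.
  by congr (ipolyhedron iota _); apply/seteqP; split=> x;
    rewrite /hs /= dotvNl oppr_le0.
- exact: cell_half.
Qed.

Lemma hs_face j j' a : exists e, forall x, hs j a x ->
  dotv e (iota x) <= 0 /\ (dotv e (iota x) = 0 <-> hs j' a x).
Proof.
case: j => [[]|].
- exists (if j' is Some true then 0 else - a) => x; rewrite /hs /= => ax.
  case: j' => [[]|]; rewrite ?dot0v ?dotvNl ?oppr_le0 //; split=> //; split; lra.
- exists (if j' is Some false then 0 else a) => x; rewrite /hs /= => ax.
  case: j' => [[]|]; rewrite ?dot0v //; split=> //; split; lra.
- exists 0 => x; rewrite /hs /= dot0v => ax.
  by split=> //; split=> // _; case: j' => [[]|]; rewrite ax.
Qed.

Definition cut P a : set (set X) :=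
  [set s' | exists s j, P s /\ s' = s `&` hs j a].

(** A sum of two nonpositive forms vanishes exactly where both do; [hs_face] supplies the second
    one. *)
Lemma cut_faceI P a s j s' j' : is_complex P -> P s -> P s' ->
  is_face ((s `&` hs j a) `&` (s' `&` hs j' a)) (s `&` hs j a).
Proof.
move=> cP Ps Ps'; have [_ _ _ _ /(_ _ _ Ps Ps')[/(faceP chi1)[h [Hh E]] _]] := cP.
have [e He] := hs_face j j' a.
apply/(faceP chi1); exists (h + e); split=> [x [sx hx]|].
  by rewrite dotvDl; have [] := He x hx; have := Hh x sx; lra.
apply/seteqP; split=> x /=.
  move=> [[sx hx] [s'x h'x]]; split=> //; rewrite dotvDl.
  have [_ [_ ->//]] := He x hx; rewrite addr0.
  have : (s `&` s') x by [].
  by rewrite E => -[].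
move=> [[sx hx]]; rewrite dotvDl => E0.
have [e0 e1] := He x hx; have h0 := Hh x sx.
split=> //; split; last by apply/e1; lra.
have : (s `&` s') x by rewrite E; split=> //; lra.
by case.
Qed.

(* A nonempty face t of s `&` hs j a is the trace on hs j a, or on a = 0, of the
   smallest cell F of P through a relative interior point z of t. *)
Lemma cut_face P a s j t : is_complex P -> P s -> is_face t (s `&` hs j a) ->
  cut P a t.
Proof.
move=> cP Ps /(faceP chi1)[h [Hh E]].
have csj : cell (s `&` hs j a) by apply: cell_hs; apply: cx_cell Ps.
have [[x0 tx0]|nt] := pselect (t !=set0); last first.
  exists set0, None; split; last first.
    rewrite set0I; apply/seteqP; split=> x // tx.
    by case: nt; exists x.
  (* The form [- chi] is constantly -1, so it cuts out the empty face. *)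
  have := cx_face chi1 (h := - chi) cP Ps; set G := [set x | _].
  have -> : G = set0.
    by apply/seteqP; split=> x //= -[_]; rewrite dotvNl chi1; lra.
  by apply=> x _; rewrite dotvNl chi1; lra.
have tcvx : cvx iota t.
  have -> : t = (s `&` hs j a) `&` [set x | dotv (- h) (iota x) <= 0].
    rewrite E; apply/seteqP; split=> x /= [sx hx]; split=> //.
      by rewrite dotvNl hx oppr0.
    by have := Hh x sx; move: hx; rewrite dotvNl; lra.
  by apply: (cell_cvx chi1); apply: cell_half.
have [z rz] := relint_ex tcvx tx0.
have tsub x : t x -> [/\ s x, hs j a x & dotv h (iota x) = 0].
  by rewrite E => -[[]].
have [sz jz hz] := tsub _ rz.1.
have [F [PF rF]] := carrier chi1 z cP.
have Fs := relint_sub chi1 cP PF Ps rF sz.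
pose j' := if dotv a (iota z) == 0 then None else j.
exists F, j'; split=> //; apply/seteqP; split=> x.
  move=> tx; have [sx jx hx] := tsub _ tx; split.
    have /(faceP chi1)[g [Hg Eg]] := cx_sub_face cP Ps PF Fs.
    rewrite Eg; split=> //; apply: rz.2 => // [y /tsub[sy _ _]|]; first exact: Hg.
    by have := rF.1; rewrite {1}Eg => -[].
  rewrite /j'; case: eqP => [az|//]; rewrite /hs /=.
  move: jz jx; rewrite /hs; case: (j) tsub => [[]|] //= tsub' _ _.
    have := rz.2 (- a); rewrite !dotvNl az oppr0 => /(_ _ erefl x tx).
    by rewrite dotvNl => H; suff : - dotv a (iota x) = 0 by [lra]; apply: H
        => y /tsub'[_ + _]; rewrite dotvNl oppr_le0.
  by apply: rz.2 => // y /tsub'[].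
move=> [Fx jx].
have jx' : hs j a x.
  move: jx; rewrite /j'; case: eqP => // _; rewrite /hs /= => ->.
  by case: (j) => [[]|].
have [||e0 e00 He] := @cell_step _ _ _ _ _ chi1 F z (iota z - iota x) (cx_cell cP PF) rF.1.
- by rewrite dotvBr !chi1 subrr.
- by move=> g Hg gz; rewrite dotvBr gz rF.2 // subrr.
(* Short enough that [y], which lies beyond [z] as seen from [x], stays on the side [j]. Then [z] is
   strictly between [x] and [y], and [h] vanishing at [z] forces it to vanish at [x]. *)
pose e1 := if dotv a (iota z) == 0 then e0 else
   Num.min e0 (`|dotv a (iota z)| / (1 + `|dotv a (iota x)|)).
have e10 : 0 < e1 /\ e1 <= e0.
  rewrite /e1; case: eqP => [//|/eqP az]; rewrite lt_min e00 ge_min lexx /=.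
  by rewrite divr_gt0 ?normr_gt0 // ltr_pwDl.
have [|y Fy Ey] := He e1; first by rewrite ltW; case: e10.
have jy : hs j a y.
  move: jx jz jx' e10; rewrite /hs /= Ey /j' /e1 !dotv_linE.
  case: eqP => [-> /= -> _ _|/eqP az]; first by rewrite subrr mulr0 addr0; case: (j) => [[]|].
  move: (dotv a (iota z)) (dotv a (iota x)) az => Z Y Z0.
  have n0 : 0 < 1 + `|Y| by rewrite ltr_pwDl.
  set e := Num.min _ _.
  have ee : e * (1 + `|Y|) <= `|Z|.
    by rewrite -ler_pdivlMr // /e ge_min lexx orbT.
  case: j {Hh csj E tsub tcvx j'} => [[]|] /= Y0 Z1 _ [e_0 _].
  - move: ee; rewrite !ger0_norm //; nra.
  - move: ee; rewrite !ler0_norm //; nra.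
  - by move: Z0; rewrite Z1 eqxx.
rewrite E /=; split; first by split=> //; apply: Fs.
have := Hh y (conj (Fs _ Fy) jy); have := Hh x (conj (Fs _ Fx) jx').
rewrite Ey !dotv_linE hz; case: e10 => + _; move: (dotv h (iota x)) => H e_0.
rewrite add0r sub0r mulrN oppr_le0 => H0; rewrite pmulr_rge0 //; lra.
Qed.

Lemma cut_complex P a : is_complex P -> is_complex (cut P a).
Proof.
move=> cP; have [cov fin _ _ _] := cP; split.
- move=> x; have [s [Ps sx]] := cov x.
  have [ax|ax] := leP (dotv a (iota x)) 0.
    by exists (s `&` hs (Some false) a); split=> //; exists s, (Some false).
  exists (s `&` hs (Some true) a); split; first by exists s, (Some true).
  by split=> //; apply: ltW.
- move=> x; have [N [Nx /finite_seqP[sq E]]] := fin x; exists N; split=> //.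
  apply: (@sub_finite_set _ _ [set` flatten [seq [:: s `&` hs None a;
     s `&` hs (Some true) a; s `&` hs (Some false) a] | s <- sq]]); last first.
    exact: finite_seq.
  move=> _ [[s [j [Ps ->]]] [y [[sy jy] Ny]]] /=; apply/flattenP.
  have ssq : s \in sq.
    have : [set` sq] s; last by [].
    by rewrite -E; split=> //; exists y.
  exists [:: s `&` hs None a; s `&` hs (Some true) a; s `&` hs (Some false) a].
    by apply/mapP; exists s.
  by rewrite !inE; case: (j) => [[]|]; rewrite eqxx ?orbT.
- by move=> _ [s [j [Ps ->]]]; apply: cell_hs; apply: cx_cell Ps.
- by move=> _ t [s [j [Ps ->]]]; apply: cut_face.
- move=> _ _ [s [j [Ps ->]]] [s' [j' [Ps' ->]]]; split.
    exact: (@cut_faceI P a s j s' j' cP Ps Ps').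
  by rewrite setIC; exact: (@cut_faceI P a s' j' s j cP Ps' Ps).
Qed.

Lemma cut_subdivides P a : subdivides (cut P a) P.
Proof. by move=> _ [s [j [Ps ->]]]; exists s; split=> // x []. Qed.

Lemma cut_mono P Q a : subdivides P Q -> subdivides (cut P a) (cut Q a).
Proof.
move=> PQ _ [s [j [/PQ[s' [Qs' ss']] ->]]].
exists (s' `&` hs j a); split; first by exists s', j.
by move=> x [/ss' s'x jx].
Qed.

Definition cuts P (l : seq 'rV[R]_d) := foldr (fun a Q => cut Q a) P l.

Lemma cuts_complex P l : is_complex P -> is_complex (cuts P l).
Proof. by move=> cP; elim: l => //= a l; apply: cut_complex. Qed.

Lemma cuts_subdivides P l : subdivides (cuts P l) P.
Proof.
elim: l => [|a l IH] /=; first exact: subdivides_refl.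
exact: subdivides_trans (@cut_subdivides _ _) IH.
Qed.

Lemma cuts_mono P Q l : subdivides P Q -> subdivides (cuts P l) (cuts Q l).
Proof. by move=> PQ; elim: l => //= a l; apply: cut_mono. Qed.

Lemma cuts_sign P l a s : cuts P l s -> a \in l ->
  (forall x, s x -> 0 <= dotv a (iota x)) \/ (forall x, s x -> dotv a (iota x) <= 0).
Proof.
elim: l s => [//|a' l IH] s /= [s1 [j [s1P ->]]]; rewrite inE => /orP[/eqP ->|].
  case: j => [[]|]; [left|right|left] => x []; rewrite /hs //=.
  by move=> _ ->.
by move=> /(IH _ s1P)[] H; [left|right] => x [/H].
Qed.

Lemma cuts_mem P s (l : seq ('rV[R]_d * option bool)) : P s ->
  cuts P (map fst l) [set x | s x /\ forall c, c \in l -> hs c.2 c.1 x].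
Proof.
move=> Ps; elim: l => [|c l IH] /=.
  by rewrite (_ : [set x | _] = s) //; apply/seteqP; split=> [x []|x].
eexists _, _; split; first exact: IH.
apply/seteqP; split=> x /=.
  move=> [sx H]; split; last by apply: (H c); rewrite mem_head.
  by split=> // c' c'l; apply: H; rewrite inE c'l orbT.
move=> [[sx H] Hc]; split=> // c'; rewrite inE => /orP[/eqP ->//|]; exact: H.
Qed.

(** The same cuts applied to a common subdivision give a common subdivision. *)
Lemma admissible_cuts P0 P l : admissible iota P0 P -> admissible iota P0 (cuts P l).
Proof.
move=> [cP [Q [cQ [QP QP0]]]]; split; first exact: cuts_complex.
exists (cuts Q l); split; first exact: cuts_complex.
split; first exact: cuts_mono.
exact: subdivides_trans (@cuts_subdivides _ _) QP0.
Qed.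

End Cuts.

(** * Unit normals *)

Section Normals.
Context {R : realType} {d : nat} {X : topologicalType} (iota : X -> 'rV[R]_d).
Context {chi : 'rV[R]_d} (chi1 : forall x, dotv chi (iota x) = 1).
Implicit Types (s t S F : set X) (P Q : set (set X)) (x y z p q : X).
Implicit Types (a h u v w : 'rV[R]_d).

Notation cell := (ipolyhedron iota).
Notation is_face := (is_face iota).
Notation relint := (relint iota).
Notation rk := (rk iota).
Notation spn := (spn iota).
Notation is_normal := (is_normal iota).
Notation nvec := (nvec iota).

(** As [chi] is 1 on points and 0 at [w], the coefficients of [w] add up to 0, so any base point [z]
    may be subtracted. *)
Lemma dir_comb S w z : (w <= spn S)%MS -> dotv chi w = 0 ->
  exists m (l : 'I_m -> R) (y : 'I_m -> X), (forall i, S (y i)) /\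
    w = \sum_(i < m) l i *: (iota (y i) - iota z).
Proof.
move=> wS w0; have [m [y [Sy _ Hy]]] := spn_ex iota S.
have SM : (spn S <= pts_mx iota y)%MS by apply: spn_min.
have /submxP[D E] := submx_trans wS SM.
exists m, (D 0), y; split=> //.
have Ew : w = \sum_(i < m) D 0 i *: iota (y i).
  rewrite E mulmx_sum_row; apply: eq_bigr => i _.
  by rewrite row_pts_mx.
have l0 : \sum_(i < m) D 0 i = 0.
  move: w0; rewrite Ew dotv_sumr; apply: etrans; apply: eq_bigr => i _.
  by rewrite dotvZr chi1 mulr1.
under eq_bigr do rewrite scalerBr.
by rewrite sumrB -scaler_suml l0 scale0r subr0.
Qed.

Lemma sub_diff S x y : S x -> S y -> (iota x - iota y <= spn S)%MS.
Proof. by move=> Sx Sy; rewrite addmx_sub ?eqmx_opp ?spn_in. Qed.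

Lemma chi_diff x y : dotv chi (iota x - iota y) = 0.
Proof. by rewrite dotvBr !chi1 subrr. Qed.

(** The directions of an affine span are the vectors of the linear span killed by [chi]; this turns
    the definition into conditions on subspaces. *)
Lemma is_normalP s t v : t `<=` s -> t !=set0 ->
  is_normal s t v <->
  [/\ dotv v v = 1,
      forall w, (w <= spn t)%MS -> dotv chi w = 0 -> dotv v w = 0,
      (v <= spn s)%MS /\ dotv chi v = 0 &
      exists x y, s x /\ t y /\ 0 < dotv v (iota x - iota y)].
Proof.
move=> ts [z tz]; split=> -[v1 vt vs pos]; split=> //.
- move=> w wt w0; have [m [l [y [ty ->]]]] := dir_comb z wt w0.
  by rewrite dotv_sumr big1 // => i _; rewrite dotvZr vt // mulr0.
- have [m [l [x [y [sxy ->]]]]] := vs; split.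
    by apply: summx_sub => i _; rewrite scalemx_sub // sub_diff //; case: (sxy i).
  by rewrite dotv_sumr big1 // => i _; rewrite dotvZr chi_diff mulr0.
- by move=> x y tx ty; apply: vt; rewrite ?sub_diff ?chi_diff.
- have [m [l [y [sy E]]]] := dir_comb z vs.1 vs.2.
  by exists m, l, y, (fun=> z); split=> // i; split=> //; apply: ts.
Qed.

(** No face relation: [t] may run through the interior of [s], as a cell of a subdivision does in a
    cell of the coarser complex. *)
Definition codim1 t s := [/\ t `<=` s, t !=set0 & rk s = (rk t).+1].

Definition facet t s := codim1 t s /\ is_face t s.

Section Codim1.
Variables (t s : set X).
Hypothesis ft : codim1 t s.

Let ts : t `<=` s. Proof. by case: ft. Qed.
Let t0 : t !=set0. Proof. by case: ft. Qed.

Lemma normal_decomp v w : is_normal s t v -> (w <= spn s)%MS -> dotv chi w = 0 ->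
  (w - dotv v w *: v <= spn t)%MS /\ dotv chi (w - dotv v w *: v) = 0.
Proof.
move=> /(is_normalP _ ts t0)[v1 vt [vs v0] _] ws w0.
split; last by rewrite dotvBr dotvZr v0 w0 mulr0 subrr.
have vnt : ~~ (v <= spn t)%MS.
  by apply/negP => /vt /(_ v0); rewrite v1 => /eqP; rewrite oner_eq0.
have rs : \rank (spn s) = (\rank (spn t)).+1 by case: ft.
have [u [l [ut E]]] := spn_line (spn_mono iota ts) rs vs vnt ws.
have u0 : dotv chi u = 0.
  by move: w0; rewrite E dotvDr dotvZr v0 mulr0 addr0.
suff -> : dotv v w = l by rewrite E addrK.
by rewrite E dotvDr dotvZr v1 mulr1 vt // add0r.
Qed.

Lemma normal_ge0 v h : is_normal s t v ->
  (forall x, s x -> dotv h (iota x) <= 0) -> (forall x, t x -> dotv h (iota x) = 0) ->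
  dotv h v <= 0.
Proof.
move=> nv hs ht; have [v1 vt [vs v0] [x [y [sx [ty pos]]]]] := (is_normalP _ ts t0).1 nv.
have [E _] := normal_decomp nv (sub_diff sx (ts ty)) (chi_diff x y).
have := spn_ann0 E ht; have := hs x sx; have := ht y ty.
rewrite !dotv_linE in pos *; nra.
Qed.

(** From a direction leading out of [t], subtract its orthogonal projection onto the directions of
    [t], and normalise. *)
Lemma normal_ex : exists v, is_normal s t v.
Proof.
have [z tz] := t0; have [_ _ rs] := ft.
have [y sy yt] : exists2 y, s y & ~~ (iota y <= spn t)%MS.
  apply: contrapT => H; have : (rk s <= rk t)%N; last by rewrite rs ltnn.
  apply/mxrankS/spn_min => y sy; apply: contrapT => yt; apply: H.
  by exists y => //; apply/negP.
pose M := (spn t :&: kermx chi^T)%MS.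
have MP w : (w <= M)%MS <-> (w <= spn t)%MS /\ dotv chi w = 0.
  rewrite sub_capmx; split=> [/andP[wt /sub_kermxP w0]|[wt w0]].
    by split=> //; rewrite dotvC /dotv w0 mxE.
  apply/andP; split=> //; apply/sub_kermxP/rowP => i.
  by rewrite ord1 [RHS]mxE -w0 dotvC.
have [u1 /MP[u1t u10] Hu] := orth_decomp M (iota y - iota z).
set v := iota y - iota z - u1 in Hu.
have vt w : (w <= spn t)%MS -> dotv chi w = 0 -> dotv v w = 0.
  by move=> wt w0; rewrite dotvC; apply/Hu/MP.
have vs : (v <= spn s)%MS.
  rewrite addmx_sub ?eqmx_opp ?sub_diff //; first exact: ts.
  exact: submx_trans u1t (spn_mono iota ts).
have v0 : dotv chi v = 0 by rewrite dotvBr chi_diff u10 subrr.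
have vn0 : v != 0.
  apply: contra yt => /eqP E; have -> : iota y = iota z + u1.
    by apply/eqP; rewrite -subr_eq0 opprD addrA -/v E.
  by rewrite addmx_sub // spn_in.
have vv := dotv_gt0 vn0.
exists ((enorm v)^-1 *: v); apply/(is_normalP _ ts t0).
have n0 : 0 < enorm v by rewrite sqrtr_gt0.
have nn : enorm v * enorm v = dotv v v by rewrite -expr2 sqr_sqrtr // ltW.
split.
- by rewrite dotvZl dotvZr -nn; field; rewrite gt_eqF.
- by move=> w wt w0; rewrite dotvZl vt // mulr0.
- by rewrite scalemx_sub // dotvZr v0 mulr0.
- exists y, z; split=> //; split=> //; rewrite dotvZl mulr_gt0 ?invr_gt0 //.
  have -> : iota y - iota z = v + u1 by rewrite /v subrK.
  by rewrite dotvDr (vt u1) // addr0.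
Qed.

Lemma normal_path p v : cell s -> relint t p -> is_normal s t v ->
  exists2 e0, 0 < e0 & forall e, 0 < e <= e0 ->
    exists z, iota z = iota p + e *: v /\ relint s z.
Proof.
move=> cs rp nv; have [v1 vt [vs v0] _] := (is_normalP _ ts t0).1 nv.
have htP h : (forall x, s x -> dotv h (iota x) <= 0) -> dotv h (iota p) = 0 ->
    forall x, t x -> dotv h (iota x) = 0.
  by move=> hs hp; apply: rp.2 => // x /ts; apply: hs.
have [|e0 e00 He] := cell_step chi1 cs (ts rp.1) v0.
  by move=> h hs hp; apply: normal_ge0 => //; apply: htP.
(* Halving leaves the point [z'] at parameter [e0] beyond [z], so a supporting form that vanishes at
   [z] vanishes at [p] and on [v]. *)
exists (e0 / 2); first by rewrite divr_gt0.
move=> e /andP[e_0 ee]; have [|z sz Ez] := He e; first by lra.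
have [|z' sz' Ez'] := He e0; first by lra.
exists z; split=> //; split=> // h hs; rewrite Ez dotvDr dotvZr => hz.
have hp := hs p (ts rp.1); have := hs z' sz'; rewrite Ez' dotvDr dotvZr => hz'.
have hp0 : dotv h (iota p) = 0 by nra.
have hv0 : dotv h v = 0 by nra.
move=> x sx.
have [E _] := normal_decomp nv (sub_diff sx (ts rp.1)) (chi_diff x p).
have := spn_ann0 E (htP h hs hp0); rewrite !dotv_linE hv0 hp0; lra.
Qed.

(** The sign stays open here, because [s] may have points on both sides of [t]; [normal_uniq] fixes
    it for facets. *)
Lemma normal_pm v v' : is_normal s t v -> is_normal s t v' -> v' = v \/ v' = - v.
Proof.
move=> nv nv'; have [v1 vt [vs v0] _] := (is_normalP _ ts t0).1 nv.
have [v'1 v't [v's v'0] _] := (is_normalP _ ts t0).1 nv'.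
have [wt w0] := normal_decomp nv v's v'0.
move: wt w0; set l := dotv v v'; set w := v' - l *: v => wt w0.
have ww : dotv w w = 0.
  by rewrite {1}/w dotvBl dotvZl (vt w) // (v't w) // mulr0 subrr.
have /eqP : w = 0 by apply: dotv_eq0.
rewrite subr_eq0 => /eqP E.
have : dotv v' v' = l ^+ 2 by rewrite E !dotv_linE v1; ring.
rewrite v'1 => /esym/eqP; rewrite sqrf_eq1 => /orP[] /eqP l1; [left|right].
  by rewrite E l1 scale1r.
by rewrite E l1 scaleN1r.
Qed.

End Codim1.

Section Facet.
Variables (t s : set X).
Hypothesis ft : facet t s.

Let ct : codim1 t s. Proof. by case: ft. Qed.
Let ts : t `<=` s. Proof. by case: ct. Qed.
Let t0 : t !=set0. Proof. by case: ct. Qed.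

(** On the directions of [s], the form that cuts out [t] is a negative multiple of the product with
    [v]. *)
Lemma normal_sign v x z : is_normal s t v -> s x -> t z ->
  0 <= dotv v (iota x - iota z) /\ (~ t x -> 0 < dotv v (iota x - iota z)).
Proof.
move=> nv sx tz; have [[_ _ rs] /(faceP chi1)[h [hs Et]]] := ft.
have ht y : t y -> dotv h (iota y) = 0 by rewrite Et => -[].
have hv : dotv h v < 0.
  rewrite lt_neqAle (normal_ge0 ct nv) // andbT; apply/negP => /eqP hv.
  have : (rk s <= rk t)%N; last by rewrite rs ltnn.
  apply: rk_mono => y sy; rewrite Et; split=> //.
  have [E _] := normal_decomp ct nv (sub_diff sy (ts tz)) (chi_diff y z).
  by have := spn_ann0 E ht; rewrite !dotv_linE hv (ht z tz); lra.
have [E _] := normal_decomp ct nv (sub_diff sx (ts tz)) (chi_diff x z).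
have := spn_ann0 E ht; set mu := dotv v _; have := hs x sx.
rewrite !dotv_linE (ht z tz) => hx Ex; split; first by nra.
move=> ntx; have : dotv h (iota x) < 0.
  rewrite lt_neqAle hx andbT; apply/negP => /eqP hx0; apply: ntx.
  by rewrite Et.
by nra.
Qed.

Lemma normal_uniq v v' : is_normal s t v -> is_normal s t v' -> v = v'.
Proof.
move=> nv nv'; have [//|E] := normal_pm ct nv nv'.
have [_ _ _ [x [y [sx [ty pos]]]]] := (is_normalP _ ts t0).1 nv'.
by have [+ _] := normal_sign nv sx ty; move: pos; rewrite {nv'}E dotvNl oppr_gt0 ltNge => /negP.
Qed.

Lemma nvecP : is_normal s t (nvec s t).
Proof. exact: (xgetPex 0 (normal_ex ct)). Qed.

Lemma nvec_eq v : is_normal s t v -> nvec s t = v.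
Proof. exact/normal_uniq/nvecP. Qed.

Lemma enorm_ge v u : dotv v v = 1 -> dotv v u <= enorm u.
Proof.
move=> v1; apply: (le_trans (ler_norm _)).
rewrite -sqrtr_sqr ler_wsqrtr // -subr_ge0.
have -> : dotv u u - dotv v u ^+ 2 = dotv (u - dotv v u *: v) (u - dotv v u *: v).
  by rewrite !dotv_linE v1 (dotvC u v); ring.
exact: dotv_ge0.
Qed.

Lemma dist_aff_normal v x z : is_normal s t v -> s x -> t z ->
  dist_aff iota x t = dotv v (iota x - iota z).
Proof.
move=> nv sx tz; have [v1 vt [vs v0] _] := (is_normalP _ ts t0).1 nv.
have [mu0 _] := normal_sign nv sx tz.
have [] := normal_decomp ct nv (sub_diff sx (ts tz)) (chi_diff x z).
move: mu0; set mu := dotv v _ => mu0; set w := _ - _ => wt w0.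
rewrite /dist_aff; set A := (X in inf X); have Amu : A mu.
  have [m [l [y [ty Ew]]]] := dir_comb z wt w0.
  (* The foot of the perpendicular from [iota x] attains the infimum. *)
  exists (iota z + w); split; last first.
    have -> : iota x - (iota z + w) = mu *: v.
      by rewrite opprD addrA /w opprD addNKr opprK.
    by rewrite /enorm dotvZl dotvZr v1 mulr1 -expr2 sqrtr_sqr ger0_norm.
  exists m.+1, (fun i => if unlift ord0 i is Some j then l j else 1 - \sum_(j < m) l j),
    (fun i => if unlift ord0 i is Some j then y j else z).
  split; first by move=> i; case: unliftP.
  split; rewrite big_ord_recl /= unlift_none.
    rewrite [X in _ + X = _](eq_bigr l) => [|i _]; last by rewrite liftK.
    by rewrite subrK.
  rewrite [X in _ = _ + X](eq_bigr (fun i => l i *: iota (y i))) => [|i _]; last first.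
    by rewrite liftK.
  rewrite Ew (eq_bigr (fun i => l i *: iota (y i) - l i *: iota z)) => [|i _].
    by rewrite sumrB -scaler_suml scalerBl scale1r addrA addrAC.
  by rewrite scalerBr.
have lbA : lbound A mu.
  move=> _ [q [[m [l [y [ty [l1 ->]]]]] ->]].
  suff -> : mu = dotv v (iota x - \sum_(i < m) l i *: iota (y i)) by apply: enorm_ge.
  rewrite /mu !dotvBr; congr (_ - _); rewrite dotv_sumr.
  rewrite -[LHS]mul1r -{1}l1 mulr_suml; apply: eq_bigr => i _.
  rewrite dotvZr; congr (_ * _); apply/eqP; rewrite -subr_eq0 -dotvBr.
  by rewrite vt ?sub_diff ?chi_diff.
apply/eqP; rewrite eq_le; apply/andP; split.
  by apply: ge_inf => //; exists mu.
by apply: lb_le_inf => //; exists mu.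
Qed.

End Facet.

Lemma normal_mono t s S v : s `<=` S -> is_normal s t v -> is_normal S t v.
Proof.
move=> sS [v1 vt [m [l [x [y [sxy E]]]]] [x' [y' [sx' [ty' pos]]]]]; split=> //.
  exists m, l, x, y; split=> // i; have [sx sy] := sxy i.
  by split; apply: sS.
by exists x', y'; split=> //; apply: sS.
Qed.

End Normals.

(** * Products of concave functions with weights *)

Section Diamond.
Context {R : realType} {d : nat} {X : topologicalType} (iota : X -> 'rV[R]_d).
Context {chi : 'rV[R]_d} (chi1 : forall x, dotv chi (iota x) = 1).
Implicit Types (s t S F : set X) (P Q : set (set X)) (x y z p q : X).
Implicit Types (a h u v w : 'rV[R]_d).

Notation cell := (ipolyhedron iota).
Notation is_face := (is_face iota).
Notation is_complex := (is_complex iota).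
Notation relint := (relint iota).
Notation rk := (rk iota).
Notation spn := (spn iota).
Notation is_normal := (is_normal iota).
Notation nvec := (nvec iota).
Notation facet := (facet iota).

Lemma cx_facet P s t : is_complex P -> P s -> P t -> t `<=` s -> t !=set0 ->
  rk s = (rk t).+1 -> facet t s.
Proof. by move=> cP Ps Pt ts t0 rs; split; [split | apply: (cx_sub_face cP)]. Qed.

(** The common face of [t] and [t'] contains [r] and [y], so it has the rank of both. *)
Lemma mid_face_eq P r s t t' y : is_complex P -> P r -> P s -> P t -> P t' ->
  r `<=` t -> r `<=` t' -> t `<=` s -> t' `<=` s ->
  rk t = (rk r).+1 -> rk t' = (rk r).+1 -> t y -> t' y -> ~ r y -> t = t'.
Proof.
move=> cP Pr Ps Pt Pt' rt rt' ts t's rkt rkt' ty t'y nry.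
have /(faceP chi1)[k [ks Ek]] := cx_sub_face cP Ps Pt ts.
have /(faceP chi1)[h [hs Er]] := cx_sub_face cP Ps Pr (subset_trans rt ts).
have kt' x : t' x -> dotv k (iota x) <= 0 by move=> /t's; apply: ks.
have PF := cx_face chi1 cP Pt' kt'; set F := [set x | _] in PF.
have Ft : F `<=` t by move=> x [t'x kx]; rewrite Ek; split=> //; apply: t's.
have Ft' : F `<=` t' by move=> x [].
have tF x : t x -> t' x -> F x by rewrite {1}Ek => -[_ kx] t'x; split.
have : (rk r < rk F)%N.
  apply: (@rk_lt _ _ _ _ _ _ y) => [x xr||].
  - by apply: tF; [apply: rt | apply: rt'].
  - exact: tF.
  - apply/negP => /(spn_ann0 (h := h)) hy; apply: nry; rewrite Er.
    by split; [exact: ts | apply: hy => x; rewrite Er => -[]].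
move=> rF; rewrite -(cell_eq_rk chi1 cP PF Pt Ft) ?rkt //.
by rewrite -(cell_eq_rk chi1 cP PF Pt' Ft') ?rkt'.
Qed.

(* The ray e - p + l w leaves the tangent cone of s at p for some l > 0; the
   constraint g that it meets there cuts out the face t. *)
Lemma edge P r s p h e w : is_complex P -> P r -> P s -> r `<=` s -> relint r p ->
  rk s = (rk r).+2 ->
  (forall x, s x -> dotv h (iota x) <= 0) -> r = [set x | s x /\ dotv h (iota x) = 0] ->
  relint s e -> (w <= spn s)%MS -> dotv chi w = 0 -> dotv h w = 0 ->
  ~~ (w <= spn r)%MS ->
  exists t z (l eps : R) g, let T := [set x | s x /\ dotv g (iota x) = 0] in
    [/\ t = T, P t, r `<=` t, rk t = (rk r).+1 &
     [/\ 0 < l, 0 < eps, t z, iota z = iota p + eps *: ((iota e - iota p) + l *: w) &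
     [/\ forall x, s x -> dotv g (iota x) <= 0, dotv g (iota p) = 0, 0 < dotv g w &
         dotv g (iota e - iota p + l *: w) = 0]]].
Proof.
move=> cP Pr Ps rs rp rks hs Er re ws w0 hw wr.
have [m [A [sA As]]] := cell_rep chi1 (cx_cell cP Ps).
pose I i := dotv (A i) (iota p) == 0.
have rx x : s x -> dotv h (iota x) = 0 -> r x by move=> sx hx; rewrite Er.
have hr x : r x -> dotv h (iota x) = 0 by rewrite Er => -[].
have sp := rs _ rp.1.
have wrx z (eps : R) : 0 < eps -> r z -> iota z <> iota p + eps *: w.
  move=> eps0 rz Ez; move/negP: wr; apply.
  have -> : w = eps^-1 *: (iota z - iota p).
    by rewrite Ez addrC addKr scalerA mulVf ?gt_eqF // scale1r.
  by rewrite scalemx_sub // sub_diff //; apply: rp.1.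
have er : dotv h (iota e) < 0.
  rewrite lt_neqAle (hs _ re.1) andbT; apply/negP => /eqP he.
  have : (rk s <= rk r)%N; last by rewrite rks ltnNge leqnSn.
  by apply: rk_mono => x sx; rewrite Er; split=> //; apply: re.2.
have [i /eqP Ii||l [i0 [l0 /eqP Ii0 wi0 gi0 gI]]] :=
    @first_exit _ _ m A I (iota e - iota p) w.
- by rewrite dotvBr Ii subr0 sA //; apply: re.1.
- apply: contrapT => nw.
  have [|e0 e00 He] := rep_step chi1 sA As sp w0.
    move=> i Ii; rewrite leNgt; apply/negP => wi; apply: nw; exists i => //.
    by rewrite /I Ii.
  have [|z sz Ez] := He e0; first by rewrite lexx ltW.
  by apply: (wrx z _ e00 _ Ez); apply: rx => //; rewrite Ez !dotv_linE hw (hr _ rp.1) mulr0 addr0.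
have gs x : s x -> dotv (A i0) (iota x) <= 0 by move=> /sA.
have ge : dotv (A i0) (iota e) < 0.
  rewrite lt_neqAle (gs _ re.1) andbT; apply/negP => /eqP g0.
  by have := relint_spn re gs g0 ws => gw; move: wi0; rewrite gw ltxx.
have l_gt0 : 0 < l.
  rewrite lt_neqAle l0 andbT; apply/negP => /eqP l00.
  by move: gi0 ge; rewrite -l00 scale0r addr0 dotvBr Ii0; lra.
have [||e0 e00 He] := rep_step (w := iota e - iota p + l *: w) chi1 sA As sp.
- by rewrite !dotv_linE !chi1 w0 mulr0 subrr addr0.
- by move=> i Ii; apply: gI; rewrite /I Ii.
have [|z sz Ez] := He e0; first by rewrite lexx ltW.
have Pt := cx_face chi1 cP Ps gs.
set t := [set x | s x /\ dotv (A i0) (iota x) = 0] in Pt.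
have tz : t z by split=> //; rewrite Ez dotvDr dotvZr gi0 Ii0 mulr0 addr0.
have rt : r `<=` t.
  move=> x xr; split; first exact: rs.
  by apply: rp.2 => // y /rs; apply: gs.
exists t, z, l, e0, (A i0); split=> //.
apply/eqP; rewrite eqn_leq; apply/andP; split.
  rewrite -ltnS -rks; apply: (@rk_lt _ _ _ _ _ _ e) => [x []||] //; first exact: re.1.
  apply/negP => /(spn_ann0 (h := A i0)) H.
  by move: ge; rewrite H ?ltxx // => x [].
apply: (rk_lt rt tz); apply/negP => /(spn_ann0 (h := h)) /(_ hr).
rewrite Ez !dotv_linE hw (hr p rp.1); nra.
Qed.

(** In a plane: [l e + mu w] lies strictly between the rays [e + l1 w] and [e - l2 w]. A form [k]
    that is nonpositive on both rays and zero at it vanishes on the plane. *)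
Lemma edge_arith (mu l l1 l2 kw ke : R) : 0 < l -> mu * kw + l * ke = 0 ->
  ke + l1 * kw <= 0 -> ke - l2 * kw <= 0 -> - (l * l2) < mu -> mu < l * l1 -> kw = 0.
Proof.
move=> l0 E k1 k2 m2 m1.
have K1 := mulr_ge0_le0 (ltW l0) k1; have K2 := mulr_ge0_le0 (ltW l0) k2.
have [kw0|kw0|//] := ltgtP kw 0; exfalso.
  have : (mu + l * l2) * kw < 0 by rewrite pmulr_rlt0 //; lra.
  by lra.
have : 0 < (l * l1 - mu) * kw by rewrite pmulr_rgt0 //; lra.
by lra.
Qed.

(** Modulo the span of [r], the tangent cone of [s] is a planar cone with two boundary rays; [edge]
    finds them in the directions [w] and [- w]. *)
Lemma diamond P r s : is_complex P -> P r -> P s -> r `<=` s -> r !=set0 ->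
  rk s = (rk r).+2 ->
  exists t1 t2, t1 <> t2 /\ forall t,
    [/\ P t, r `<=` t, t `<=` s & rk t = (rk r).+1] <-> t = t1 \/ t = t2.
Proof.
move=> cP Pr Ps rs [x0 rx0] rks.
have [p rp] := relint_ex (cx_cvx chi1 cP Pr) rx0.
have [e re] := relint_ex (cx_cvx chi1 cP Ps) (rs _ rx0).
have /(faceP chi1)[h [hs Er]] := cx_sub_face cP Ps Pr rs.
have hr x : r x -> dotv h (iota x) = 0 by rewrite Er => -[].
have rx x : s x -> ~ r x -> dotv h (iota x) < 0.
  move=> sx nrx; rewrite lt_neqAle hs // andbT; apply/negP => /eqP hx.
  by apply: nrx; rewrite Er.
have hp := hr p rp.1; have sp := rs p rp.1; have se := re.1.
(* By a rank count, the kernel of [h] on the span of [s] is larger than the span of [r]. *)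
have [w [ws w0 hw wr]] : exists w, [/\ (w <= spn s)%MS, dotv chi w = 0,
    dotv h w = 0 & ~~ (w <= spn r)%MS].
  suff [w' [ws hw wr]] : exists w', [/\ (w' <= spn s)%MS, dotv h w' = 0 &
      ~~ (w' <= spn r)%MS].
    exists (w' - dotv chi w' *: iota p); split.
    - by rewrite addmx_sub // eqmx_opp scalemx_sub // spn_in.
    - by rewrite !dotv_linE chi1 mulr1 subrr.
    - by rewrite !dotv_linE hw hp mulr0 subrr.
    - apply: contra wr => H; rewrite -(subrK (dotv chi w' *: iota p) w').
      by rewrite addmx_sub // scalemx_sub // spn_in //; apply: rp.1.
  pose M := (spn s :&: kermx h^T)%MS.
  have : ~~ (M <= spn r)%MS.
    apply/negP => /mxrankS Mr; have := mxrank_mul_ker (spn s) h^T.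
    have := rank_leq_col (spn s *m h^T); rewrite -/M.
    move: rks Mr; rewrite !rkE.
    move: (\rank (spn s)) (\rank (spn r)) (\rank M) (\rank (spn s *m h^T)) => ????.
    lia.
  move=> /row_subPn[i Mi]; exists (row i M).
  have : (row i M <= M)%MS by apply: row_sub.
  rewrite sub_capmx => /andP[? /sub_kermxP w0]; split=> //.
  by rewrite dotvC /dotv w0 mxE.
have [t1 [z1 [l1 [e1 [g1 [E1 Pt1 rt1 rk1 [l10 e10 tz1 Ez1 [gs1 gp1 gw1 ge1]]]]]]]] :=
  edge cP Pr Ps rs rp rks hs Er re ws w0 hw wr.
have [||||t2 [z2 [l2 [e2 [g2 [E2 Pt2 rt2 rk2 [l20 e20 tz2 Ez2 [gs2 gp2 gw2 ge2]]]]]]]] :=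
  @edge P r s p h e (- w) cP Pr Ps rs rp rks hs Er re.
- by rewrite eqmx_opp.
- by rewrite dotvNr w0 oppr0.
- by rewrite dotvNr hw oppr0.
- by rewrite eqmx_opp.
have t1s : t1 `<=` s by rewrite E1 => x [].
have t2s : t2 `<=` s by rewrite E2 => x [].
move: gw2 ge2 ge1; rewrite !dotv_linE gp1 gp2 !subr0 => gw2 ge2 ge1.
have he := rx e se; have ner : ~ r e.
  move=> /hr /(relint_spn re hs) H; have : (rk s <= rk r)%N; last by rewrite rks ltnNge leqnSn.
  by apply: rk_mono => x sx; rewrite Er; split=> //; apply: H; apply: spn_in.
have {}he := he ner.
have sz1 := t1s _ tz1; have sz2 := t2s _ tz2.
exists t1, t2; split.
  move=> E; have : t1 z2 by rewrite E.
  rewrite E1 => -[_]; rewrite Ez2 !dotv_linE gp1.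
  have -> : dotv g1 (iota e) = - (l1 * dotv g1 w) by lra.
  have : 0 < e2 * ((l1 + l2) * dotv g1 w) by rewrite !mulr_gt0 // addr_gt0.
  lra.
move=> t; split=> [[Pt rt ts rkt]|[]->]; try by split.
have [y ty nry] : exists2 y, t y & ~ r y.
  apply: contrapT => H; have : (rk t <= rk r)%N; last by rewrite rkt ltnn.
  apply: rk_mono => y ty; apply: contrapT => nry; apply: H.
  by exists y.
have sy := ts _ ty; have hy := rx y sy nry.
pose M := (spn r + w)%MS.
have rkM : (\rank M <= (rk r).+1)%N.
  apply: leq_trans (mxrank_adds_leqif _ _) _.
  by rewrite -[X in (_ <= X)%N]addn1 leq_add2l rank_leq_row.
have rwM : (\rank M = (rk r).+1)%N.
  apply/eqP; rewrite eqn_leq rkM /=; apply: rank_ltmx; rewrite ltmxE addsmxSl /=.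
  by apply: contra wr; apply: submx_trans; apply: addsmxSr.
have Ms : (M <= spn s)%MS by rewrite addsmx_sub ws spn_mono.
have Mh u : (u <= M)%MS -> dotv h u = 0.
  move=> /sub_addsmxP[[D D'] /= ->]; rewrite dotvDr.
  rewrite (spn_ann0 (submxMl D (spn r)) hr) add0r.
  by rewrite [D']mx11_scalar mul_scalar_mx dotvZr hw mulr0.
have rsM : \rank (spn s) = (\rank M).+1 by rewrite rwM; apply: rks.
have [||u [l [uM Ey]]] := spn_line Ms rsM _ _ (sub_diff iota sy sp) (y := iota e - iota p).
- exact: sub_diff.
- by apply/negP => /Mh; rewrite dotvBr hp; lra.
move: (uM) => /sub_addsmxP[[D D'] /= Eu].
move: Eu; rewrite [D']mx11_scalar mul_scalar_mx.
set v := D *m _; set mu := D' 0 0 => Eu.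
have vr : (v <= spn r)%MS by apply: submxMl.
have Eyy : iota y = iota p + v + mu *: w + l *: (iota e - iota p).
  by rewrite -[LHS](subrK (iota p)) Ey Eu addrC !addrA.
have l0 : 0 < l.
  have := hy; rewrite Eyy !dotv_linE hp hw (spn_ann0 vr hr); nra.
have valy g : (forall x, s x -> dotv g (iota x) <= 0) -> dotv g (iota p) = 0 ->
    dotv g (iota y) = mu * dotv g w + l * dotv g (iota e).
  move=> gs gp; rewrite Eyy !dotv_linE gp.
  have gr x : r x -> dotv g (iota x) = 0.
    by move=> xr; apply: rp.2 => // x' /rs; apply: gs.
  by rewrite (spn_ann0 vr gr); ring.
have y1 := valy g1 gs1 gp1; have y2 := valy g2 gs2 gp2.
have := gs1 _ sy; have := gs2 _ sy; rewrite y1 y2 => y2' y1'.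
have [m1|m1] := eqVneq mu (l * l1).
  left; apply: (mid_face_eq (y := y) cP Pr Ps) => //; rewrite E1; split=> //.
  by rewrite y1 m1; nra.
have [m2|m2] := eqVneq mu (- (l * l2)).
  right; apply: (mid_face_eq (y := y) cP Pr Ps) => //; rewrite E2; split=> //.
  by rewrite y2 m2; nra.
have /(faceP chi1)[k [ks Ek]] := cx_sub_face cP Ps Pt ts.
have kp : dotv k (iota p) = 0.
  by have := rt _ rp.1; rewrite Ek => -[].
have ky : dotv k (iota y) = 0 by have := ty; rewrite Ek => -[].
move: (ky); rewrite (valy k ks kp) => kyE.
have := ks _ sz1; have := ks _ sz2; rewrite Ez1 Ez2 !dotv_linE kp => k2 k1.
have m1' : mu < l * l1.
  rewrite lt_neqAle m1 /=.
  have : (mu - l * l1) * dotv g1 w <= 0 by nra.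
  by rewrite pmulr_lle0 // subr_le0.
have m2' : - (l * l2) < mu.
  rewrite lt_neqAle eq_sym m2 /=.
  have : (mu + l * l2) * dotv g2 w <= 0 by nra.
  by rewrite nmulr_lle0; lra.
have k1' : dotv k (iota e) + l1 * dotv k w <= 0.
  by rewrite -(pmulr_rle0 _ e10); lra.
have k2' : dotv k (iota e) - l2 * dotv k w <= 0.
  by rewrite -(pmulr_rle0 _ e20); lra.
have kw : dotv k w = 0 by apply: (edge_arith l0 kyE k1' k2' m2' m1').
have ke : dotv k (iota e) = 0.
  move: kyE; rewrite kw mulr0 add0r => /eqP; rewrite mulf_eq0 gt_eqF //=.
  by move/eqP.
(* A face through the relative interior point [e] would be all of [s]. *)
exfalso; have : (rk s <= rk t)%N; last by rewrite rks rkt ltnn.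
by apply: rk_mono => x sx; rewrite Ek; split=> //; apply: re.2.
Qed.

End Diamond.

Section Diamond.
Context {R : realType} {d : nat} {X : topologicalType} (iota : X -> 'rV[R]_d).
Context {chi : 'rV[R]_d} (chi1 : forall x, dotv chi (iota x) = 1).
Implicit Types (s t S F : set X) (P Q : set (set X)) (x y z p q : X).
Implicit Types (a h u v w : 'rV[R]_d).

Notation cell := (ipolyhedron iota).
Notation is_face := (is_face iota).
Notation is_complex := (is_complex iota).
Notation relint := (relint iota).
Notation rk := (rk iota).
Notation spn := (spn iota).
Notation is_normal := (is_normal iota).
Notation nvec := (nvec iota).
Notation facet := (facet iota).

(* With u_i = nvec t_i r and v_i = nvec s t_i, both (u_1, v_1) and (u_2, v_2) are
   orthonormal bases of the same plane, and v_1, v_2 are (u_2 - c u_1) / s0 and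
   (u_1 - c u_2) / s0. *)
Lemma diamond_sum P r s t1 t2 a : is_complex P -> P r -> P s -> P t1 -> P t2 ->
  r !=set0 -> r `<=` t1 -> r `<=` t2 -> t1 `<=` s -> t2 `<=` s ->
  rk s = (rk r).+2 -> rk t1 = (rk r).+1 -> rk t2 = (rk r).+1 -> t1 <> t2 ->
  dotv a (nvec s t1) *: nvec t1 r + dotv a (nvec s t2) *: nvec t2 r =
  dotv a (nvec t1 r) *: nvec s t1 + dotv a (nvec t2 r) *: nvec s t2.
Proof.
move=> cP Pr Ps Pt1 Pt2 r0 rt1 rt2 t1s t2s rks rk1 rk2 nt12.
have rs : r `<=` s := subset_trans rt1 t1s.
have [x0 rx0] := r0; have [p rp] := relint_ex (cx_cvx chi1 cP Pr) rx0.
have aux t t' : P t -> P t' -> r `<=` t -> r `<=` t' -> t `<=` s -> t' `<=` s ->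
    rk t = (rk r).+1 -> rk t' = (rk r).+1 -> t <> t' ->
    [/\ dotv (nvec s t) (nvec s t) = 1, dotv (nvec t r) (nvec t r) = 1,
        dotv (nvec s t) (nvec t r) = 0, 0 < dotv (nvec s t) (nvec t' r) &
        nvec t' r = dotv (nvec s t) (nvec t' r) *: nvec s t
                    + dotv (nvec t r) (nvec t' r) *: nvec t r].
  move=> Pt Pt' rt rt' ts t's rkt rkt' ntt'.
  have t0 : t !=set0 by exists x0; apply: rt.
  have frt : facet r t by apply: (cx_facet cP).
  have frt' : facet r t' by apply: (cx_facet cP).
  have fts : facet t s by apply: (cx_facet cP) => //; rewrite rks rkt.
  have nu := nvecP chi1 frt; have nu' := nvecP chi1 frt'; have nv := nvecP chi1 fts.
  set u := nvec t r in nu *; set u' := nvec t' r in nu' *; set v := nvec s t in nv *.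
  have [u1 ur [ut u0] _] := (is_normalP chi1 u rt r0).1 nu.
  have [u'1 u'r [u't' u'0] _] := (is_normalP chi1 u' rt' r0).1 nu'.
  have [v1 vt [vs v0] _] := (is_normalP chi1 v ts t0).1 nv.
  have vu : dotv v u = 0 by apply: vt.
  have u's : (u' <= spn s)%MS by apply: submx_trans u't' (spn_mono iota t's).
  have [wt wt0] := normal_decomp chi1 fts.1 nv u's u'0.
  have [zr z0] := normal_decomp chi1 frt.1 nu wt wt0.
  set w := u' - _ in wt wt0 zr z0; set z := w - _ in zr z0.
  have vr w' : (w' <= spn r)%MS -> dotv chi w' = 0 -> dotv v w' = 0.
    by move=> wr w'0; apply: vt => //; apply: submx_trans wr (spn_mono iota rt).
  have zz : dotv z z = 0.
    by rewrite {1}/z /w !(dotvBl, dotvZl) (u'r z) // (vr z) // (ur z) // !mulr0 !subr0.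
  have uw : dotv u w = dotv u u' by rewrite dotvBr dotvZr (dotvC u v) vu mulr0 subr0.
  have Eu' : u' = dotv v u' *: v + dotv u u' *: u.
    have := dotv_eq0 zz; rewrite /z uw /w => /eqP.
    by rewrite -addrA -opprD subr_eq0 => /eqP.
  split=> //.
  have [e0 e00 He] := normal_path chi1 frt'.1 (cx_cell cP Pt') rp nu'.
  have [|y [Ey [t'y _]]] := He e0; first by rewrite e00 lexx.
  have nry : ~ r y.
    move=> yr; have : (u' <= spn r)%MS.
      have -> : u' = e0^-1 *: (iota y - iota p).
        by rewrite Ey addrC addKr scalerA mulVf ?gt_eqF // scale1r.
      by rewrite scalemx_sub // sub_diff //; apply: rp.1.
    by move=> /u'r /(_ u'0); rewrite u'1 => /eqP; rewrite oner_eq0.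
  have nty : ~ t y.
    by move=> ty; apply: ntt'; apply: (mid_face_eq chi1 (y := y) cP Pr Ps).
  have [_ /(_ nty)] := normal_sign chi1 fts nv (t's _ t'y) (rt _ rp.1).
  by rewrite Ey addrC addKr dotvZr pmulr_rgt0.
have [v11 u11 v1u1 s12 E2] := aux t1 t2 Pt1 Pt2 rt1 rt2 t1s t2s rk1 rk2 nt12.
have [v21 u21 v2u2 s21 E1] := aux t2 t1 Pt2 Pt1 rt2 rt1 t2s t1s rk2 rk1 (nesym nt12).
move: (nvec s t1) (nvec s t2) (nvec t1 r) (nvec t2 r) v11 u11 v1u1 s12 E2 v21 u21 v2u2 s21 E1
  => v1 v2 u1 u2 v11 u11 v1u1 s12 E2 v21 u21 v2u2 s21 E1.
set c := dotv u1 u2 in E2; have cE : dotv u2 u1 = c by rewrite dotvC.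
rewrite cE in E1.
have q1 : dotv v1 u2 ^+ 2 + c ^+ 2 = 1.
  by rewrite -u21 [X in _ = dotv _ X]E2 dotvDr !dotvZr (dotvC u2 v1) cE; ring.
have q2 : dotv v2 u1 ^+ 2 + c ^+ 2 = 1.
  by rewrite -u11 [X in _ = dotv _ X]E1 dotvDr !dotvZr (dotvC u1 v2) -/c; ring.
(* Both are the positive square root of [1 - c ^+ 2]. *)
have ss : dotv v2 u1 = dotv v1 u2 by nra.
rewrite ss in E1.
move: (dotv v1 u2) s12 E1 E2 => s0 s12 E1 E2.
have V1 : v1 = s0^-1 *: (u2 - c *: u1).
  by rewrite {1}E2 addrK scalerA mulVf ?gt_eqF // scale1r.
have V2 : v2 = s0^-1 *: (u1 - c *: u2).
  by rewrite {1}E1 addrK scalerA mulVf ?gt_eqF // scale1r.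
by rewrite V1 V2; apply/rowP => j; rewrite !dotv_linE !mxE; ring.
Qed.

End Diamond.

(** * Products of weights with piecewise affine functions *)

Section Weights.
Context {R : realType} {d : nat} {X : topologicalType} (iota : X -> 'rV[R]_d).
Context {chi : 'rV[R]_d} (chi1 : forall x, dotv chi (iota x) = 1).
Implicit Types (s t S F W : set X) (P Q : set (set X)) (x y z p q : X).
Implicit Types (a h u v w : 'rV[R]_d) (c : set X -> R) (g : X -> R).

Notation is_face := (is_face iota).
Notation is_complex := (is_complex iota).
Notation relint := (relint iota).
Notation rk := (rk iota).
Notation spn := (spn iota).
Notation nvec := (nvec iota).
Notation slope := (slope iota).

Lemma restrP P W k s :
  restr iota P W k s <-> [/\ P s, s `&` W !=set0 & rk s = k.+1].
Proof.
by rewrite /restr /=; split=> [[Ps [sW /pdimP]]|[Ps sW /pdimP]].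
Qed.

(** Cells having [t] as a face contain [x], so they lie in its finite star and meet [W]. Fixing one
    star for all faces through [x] allows sums to be exchanged. *)
Lemma star_sum (V : zmodType) (F : set X -> V) P W k t x (sq : seq (set X)) :
  is_complex P -> P t -> t x -> W x -> uniq sq ->
  (forall s, (s \in sq) = `[< P s /\ s x >]) ->
  \sum_(s \in [set s | restr iota P W k s /\ is_face t s]) F s =
  \sum_(s <- sq | `[< t `<=` s /\ rk s = k.+1 >]) F s.
Proof.
move=> cP Pt tx Wx usq Hsq.
suff -> : [set s | restr iota P W k s /\ is_face t s] =
    [set` [seq s <- sq | `[< t `<=` s /\ rk s = k.+1 >]]].
  by rewrite -fsbig_seq ?filter_uniq // big_filter.
apply/seteqP; split=> s /=; rewrite mem_filter Hsq.
  move=> [/restrP[Ps _ rs] ts]; apply/andP; have ts' : t `<=` s by case: ts.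
  by split; apply/asboolP; split=> //; apply: ts'.
move=> /andP[/asboolP[ts rs] /asboolP[Ps sx]]; split; last exact: (cx_sub_face cP Ps Pt ts).
by apply/restrP; split=> //; exists x.
Qed.

Lemma slopeP P W g s x : pa_on iota P W g -> P s -> s x -> W x ->
  g x = dotv (slope W g s) (iota x).
Proof.
move=> pg Ps sx Wx; have /(xgetPex 0) H : exists a : 'rV[R]_d,
    forall x, s x -> W x -> g x = dotv a (iota x).
  by apply: pg => //; exists x.
exact: H.
Qed.

(** A slope is a choice, determined by [g] only on the span of its cell; on the smaller span both
    choices are forced to agree. *)
Lemma slope_face P W g s t x w : is_complex P -> open W -> pa_on iota P W g ->
  P s -> P t -> t `<=` s -> t x -> W x -> (w <= spn t)%MS ->
  dotv (slope W g s) w = dotv (slope W g t) w.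
Proof.
move=> cP oW pg Ps Pt ts tx Wx wt; apply/eqP; rewrite -subr_eq0 -dotvBl; apply/eqP.
apply: (open_spn chi1 (cx_cell cP Pt) tx oW Wx) wt => z tz Wz.
by rewrite dotvBl -(slopeP pg Ps) ?(slopeP pg Pt) ?subrr //; apply: ts.
Qed.

(* [diamond_sum] exchanges the two kinds of normals in the double sum over
   r < t < s, after which the inner sums vanish because c is balanced at t. *)
Lemma gdot_minkowski P W k g c : is_complex P -> open W ->
  minkowski iota P W k.+1 c -> pa_on iota P W g ->
  minkowski iota P W k (gdot iota P W k.+1 g c).
Proof.
move=> cP oW mc pg k' E; subst k => r /restrP[Pr [x [rx Wx]] rkr].
have [sq [usq Hsq]] := cx_star x cP.
have inP s : s \in sq -> P s /\ s x by rewrite Hsq => /asboolP.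
pose A t := `[< r `<=` t /\ rk t = k'.+2 >].
pose B t s := `[< t `<=` s /\ rk s = k'.+3 >].
pose C s := `[< r `<=` s /\ rk s = k'.+3 >].
rewrite (star_sum _ _ cP Pr rx Wx usq Hsq) -/A.
have AB t s : A t -> B t s -> C s.
  move=> /asboolP[rt _] /asboolP[ts rs]; apply/asboolP; split=> //.
  exact: subset_trans ts.
pose D s t := dotv (slope W g s) (nvec s t).
pose E t := dotv (slope W g t) (nvec t r).
have S1 : \sum_(t <- sq | A t) gdot iota P W k'.+2 g c t *: nvec t r =
    - \sum_(t <- sq | A t) \sum_(s <- sq | B t s) (c s * D s t) *: nvec t r.
  rewrite -sumrN big_seq_cond [RHS]big_seq_cond; apply: eq_bigr => t /andP[tsq _].
  have [Pt tx] := inP t tsq.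
  by rewrite /gdot (star_sum _ _ cP Pt tx Wx usq Hsq) scaleNr scaler_suml.
rewrite S1 (exchange_big_dep C) //=.
have per s : s \in sq -> C s ->
    \sum_(t <- sq | A t && B t s) (c s * D s t) *: nvec t r =
    \sum_(t <- sq | A t && B t s) (c s * E t) *: nvec s t.
  move=> ssq /asboolP[rs rks]; have [Ps sx] := inP s ssq.
  have [|t1 [t2 [nt12 Ht]]] := diamond chi1 cP Pr Ps rs (ex_intro _ x rx).
    by rewrite rks rkr.
  have [Pt1 rt1 t1s rk1] := (Ht t1).2 (or_introl erefl).
  have [Pt2 rt2 t2s rk2] := (Ht t2).2 (or_intror erefl).
  have two (G : set X -> 'rV[R]_d) :
      \sum_(t <- sq | A t && B t s) G t = G t1 + G t2.
    rewrite -big_filter (perm_big [:: t1; t2]); last first.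
      apply: uniq_perm; first exact: filter_uniq.
        by rewrite /= inE andbT; apply/eqP.
      move=> t; rewrite mem_filter !inE Hsq; apply/idP/idP.
        case/andP => /andP[/asboolP[rt rkt] /asboolP[ts _]] /asboolP[Pt tx].
        have [->|->] : t = t1 \/ t = t2 by apply/Ht; split=> //; rewrite rkr.
          by rewrite eqxx.
        by rewrite eqxx orbT.
      move=> H; have [Pt rt ts rkt] : [/\ P t, r `<=` t, t `<=` s & rk t = (rk r).+1].
        by apply/Ht; case/orP: H => /eqP ->; [left|right].
      rewrite -andbA; apply/and3P; split; apply/asboolP; split=> //.
        by rewrite rkt rkr.
      exact: rt.
    by rewrite big_cons big_seq1.
  have rks' : rk s = (rk r).+2 by rewrite rks rkr.
  rewrite !two -!scalerA -!scalerDr; congr (_ *: _).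
  rewrite (diamond_sum chi1 _ cP Pr Ps Pt1 Pt2) //; last by exists x.
  have slo t : P t -> r `<=` t -> t `<=` s -> rk t = (rk r).+1 ->
      dotv (slope W g s) (nvec t r) = E t.
    move=> Pt rt ts rkt; apply: (slope_face cP oW pg Ps Pt ts (rt _ rx) Wx).
    have frt : facet iota r t by apply: (cx_facet cP) => //; exists x.
    by have [_ _ [] ] := (is_normalP chi1 _ rt (ex_intro _ x rx)).1 (nvecP chi1 frt).
  by rewrite !slo.
rewrite [X in - X]big_seq_cond.
under eq_bigr => s /andP[ssq Cs] do rewrite (per s ssq Cs).
rewrite -big_seq_cond -(exchange_big_dep C) //=.
rewrite big_seq_cond big1 ?oppr0 // => t /andP[tsq /asboolP[_ rkt]].
have [Pt tx] := inP t tsq.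
have := mc k'.+1 erefl t; rewrite (star_sum _ _ cP Pt tx Wx usq Hsq) => H.
under eq_bigr do rewrite mulrC -scalerA.
rewrite -scaler_sumr H ?scaler0 //.
by apply/restrP; split=> //; exists x.
Qed.

(* Since c is balanced at t, the linear form b may be subtracted from g. *)
Lemma gdot_ge P W k g c t p b : is_complex P -> open W ->
  minkowski iota P W k.+1 c -> (forall s, restr iota P W k.+1 s -> 0 <= c s) ->
  pa_on iota P W g -> P t -> rk t = k.+1 -> relint t p -> W p ->
  g p = dotv b (iota p) -> (forall x, g x <= dotv b (iota x)) ->
  0 <= gdot iota P W k.+1 g c t /\
  forall s, P s -> t `<=` s -> rk s = k.+2 ->
    c s * dotv (b - slope W g s) (nvec s t) <= gdot iota P W k.+1 g c t.
Proof.
move=> cP oW mc c0 pg Pt rkt rp Wp gp gb; have tp := rp.1.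
have [sq [usq Hsq]] := cx_star p cP.
have inP s : s \in sq -> P s /\ s p by rewrite Hsq => /asboolP.
pose B s := `[< t `<=` s /\ rk s = k.+2 >].
have E : gdot iota P W k.+1 g c t =
    \sum_(s <- sq | B s) c s * dotv (b - slope W g s) (nvec s t).
  rewrite /gdot (star_sum _ _ cP Pt tp Wp usq Hsq) -/B.
  under [RHS]eq_bigr do rewrite dotvBl mulrBr.
  rewrite sumrB; suff -> : \sum_(s <- sq | B s) c s * dotv b (nvec s t) = 0.
    by rewrite sub0r.
  under eq_bigr do rewrite -dotvZr.
  rewrite -dotv_sumr -(dotv0 b); congr dotv.
  have := mc k erefl t; rewrite (star_sum _ _ cP Pt tp Wp usq Hsq); apply.
  by apply/restrP; split=> //; exists p.
have ge0 s : s \in sq -> B s -> 0 <= c s * dotv (b - slope W g s) (nvec s t).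
  move=> ssq /asboolP[ts rks]; have [Ps sp] := inP s ssq.
  rewrite mulr_ge0 //.
    by apply: c0; apply/restrP; split=> //; exists p.
  have fts : facet iota t s.
    by apply: (cx_facet cP) => //; [exists p | rewrite rks rkt].
  have nv := nvecP chi1 fts.
  (* A short step from [p] along the normal: there [g] is at most [b], with equality at [p], so
     [b - g] has nonnegative slope. *)
  have [e0 e00 He] := normal_path chi1 fts.1 (cx_cell cP Ps) rp nv.
  have [|z [Ez [sz _]]] := He e0; first by rewrite e00 lexx.
  have [y [e [/andP[e_0 _] sy Wy Ey]]] := cell_shrink chi1 (cx_cell cP Ps) sp sz oW Wp.
  have := gb y; rewrite (slopeP pg Ps sy Wy).
  have := slopeP pg Ps sp Wp; rewrite gp Ey Ez.
  rewrite (addrC (iota p) (e0 *: _)) addrK scalerA !dotv_linE => -> .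
  by rewrite lerD2l ler_pM2l ?mulr_gt0 // subr_ge0.
split; first by rewrite E big_seq_cond sumr_ge0 // => s /andP[]; exact: ge0.
move=> s Ps ts rks; rewrite E.
have ssq : s \in sq by rewrite Hsq; apply/asboolP; split=> //; apply: ts.
have Bs : B s by apply/asboolP.
rewrite -big_filter (bigD1_seq s) ?filter_uniq ?mem_filter ?Bs //=.
rewrite lerDl big_seq_cond sumr_ge0 // => s' /andP[+ _].
by rewrite mem_filter => /andP[Bs' s'q]; apply: ge0.
Qed.

(** Positivity is witnessed on some other complex. In the common subdivision, [s] contains a cell of
    its own rank, where both weights pull back to the same value. *)
Lemma pos_cycle_ge0 P0 W k P c s : is_complex P ->
  pos_cycle iota P0 W k P c -> restr iota P W k s -> 0 <= c s.
Proof.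
move=> cP [P' [c' [_ [_ [c'0 [P3 [[cP3 _] [P3P [P3P' H]]]]]]]]].
move=> /restrP[Ps [x [sx Wx]] rks].
have [s3 [P3s3 s3s s3x rk3]] := sub_rk chi1 cP cP3 P3P Ps sx.
have rs3 : restr iota P3 W k s3 by apply/restrP; split=> //; [exists x | rewrite rk3].
have [r [pr pr']] := H s3 rs3.
have -> : c s = r.
  case: pr => [[s1 [Ps1 [/pdimP rk1 [s3s1 ->]]]]|[nex _]]; last first.
    by case: nex; exists s; split=> //; split=> //; apply/pdimP.
  congr (c _).
  by apply: (cx_uniq chi1 cP Ps Ps1 s3s s3s1); rewrite rk3 ?rk1 ?rks.
case: pr' => [[s1 [Ps1 [/pdimP rk1 [s3s1 ->]]]]|[_ ->//]].
by apply: c'0; apply/restrP; split=> //; exists x; split=> //; apply: s3s1.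
Qed.

Lemma cyc_eq_refl P0 W k P c c' : admissible iota P0 P ->
  (forall s, restr iota P W k s -> c s = c' s) -> cyc_eq iota P0 W k P c P c'.
Proof.
move=> aP cc'; exists P; split=> //; split; first exact: subdivides_refl.
split; first exact: subdivides_refl.
move=> s rs; exists (c s); have [Ps [_ pd]] := rs.
by split; left; exists s; do 2!split=> //; split=> //; rewrite cc'.
Qed.

Definition minform a x : R := Num.min 0 (dotv a (iota x)).

Lemma minformE a x : minform a x = Num.min 0 (dotv a (iota x)).
Proof. by []. Qed.

(** A supergradient at [p]: the branch that attains the minimum there. *)
Lemma minform_sup a p : exists b, minform a p = dotv b (iota p) /\
  forall x, minform a x <= dotv b (iota x).
Proof.
rewrite /minform; have [ap|ap] := ltP (dotv a (iota p)) 0.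
  by exists a; split=> // x; rewrite ge_min lexx orbT.
exists 0; split=> [|x]; first by rewrite dot0v.
by rewrite dot0v ge_min lexx.
Qed.

Lemma minform_pa P W a :
  (forall s, P s -> (forall x, s x -> 0 <= dotv a (iota x)) \/
     (forall x, s x -> dotv a (iota x) <= 0)) -> pa_on iota P W (minform a).
Proof.
move=> H s Ps _; case: (H s Ps) => sa; [exists 0|exists a] => x sx _.
  by rewrite dot0v /minform min_l // sa.
by rewrite /minform min_r // sa.
Qed.

Lemma minform_concave P0 U a :
  (exists P, admissible iota P0 P /\ pa_on iota P U (minform a)) ->
  pa_concave iota P0 U (minform a).
Proof.
move=> ex; split=> // W oW _ k P c aP mc pc pg.
have cP : is_complex P by case: aP.
exists P, (gdot iota P W k.+1 (minform a) c); split=> //; split.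
  exact: gdot_minkowski.
split; last by apply: cyc_eq_refl.
move=> t /restrP[Pt [x [tx Wx]] rkt].
have [p rp Wp] := relint_open chi1 (cx_cell cP Pt) tx oW Wx.
have [b [bp bx]] := minform_sup a p.
by have [] := gdot_ge cP oW mc (fun s => pos_cycle_ge0 cP pc) pg Pt rkt rp Wp bp bx.
Qed.

End Weights.

(** * Pulling a top-dimensional weight back to a subdivision *)

Section Pullback.
Context {R : realType} {d : nat} {X : topologicalType} (iota : X -> 'rV[R]_d).
Context {chi : 'rV[R]_d} (chi1 : forall x, dotv chi (iota x) = 1).
Implicit Types (s t S F W : set X) (P Q : set (set X)) (x y z p q : X).
Implicit Types (a h u v w : 'rV[R]_d) (c b : set X -> R) (g : X -> R).

Notation is_face := (is_face iota).
Notation is_complex := (is_complex iota).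
Notation relint := (relint iota).
Notation rk := (rk iota).
Notation spn := (spn iota).
Notation nvec := (nvec iota).
Notation is_normal := (is_normal iota).

Lemma normal_spn s t v : codim1 iota t s -> is_normal s t v ->
  (v <= spn s)%MS /\ ~~ (v <= spn t)%MS.
Proof.
move=> [ts t0 _] /(is_normalP chi1 v ts t0)[v1 vt [vs v0] _]; split=> //.
by apply/negP => /vt /(_ v0); rewrite v1 => /eqP; rewrite oner_eq0.
Qed.

Section Fixed.
Variables (P Q : set (set X)) (n : nat).
Hypotheses (cP : is_complex P) (cQ : is_complex Q) (QP : subdivides Q P).
Hypothesis (Ple : forall s, P s -> (rk s <= n.+1)%N).

Lemma sub_rk_le s : Q s -> (rk s <= n.+1)%N.
Proof.
by move=> /QP[S [PS sS]]; apply: leq_trans (rk_mono iota sS) (Ple PS).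
Qed.

(** For [s] of full rank the choice is forced, by [cx_uniq]. *)
Definition big_cell s : set X :=
  xget set0 [set S | [/\ P S, s `<=` S & rk S = n.+1]].

Lemma big_cellP s : Q s -> rk s = n.+1 ->
  [/\ P (big_cell s), s `<=` big_cell s & rk (big_cell s) = n.+1].
Proof.
move=> Qs rs; have [S [PS sS]] := QP Qs.
suff /(xgetPex set0) : exists S, [/\ P S, s `<=` S & rk S = n.+1] by [].
exists S; split=> //; apply/eqP; rewrite eqn_leq Ple //= -rs.
exact: rk_mono.
Qed.

Lemma big_cell_eq s S : Q s -> rk s = n.+1 -> P S -> s `<=` S -> big_cell s = S.
Proof.
move=> Qs rs PS sS; have [Pc sc rc] := big_cellP Qs rs.
by apply: (cx_uniq chi1 cP Pc PS sc sS); rewrite rs ?rc // Ple.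
Qed.

(** The cell of [Q] that contains the germ at [p] of the ray along [v]; it contains [t] because [p]
    is in the relative interior of [t]. *)
Lemma side_ex S t v p : P S -> Q t -> codim1 iota t S -> relint t p ->
  is_normal S t v ->
  exists s, [/\ Q s, s `<=` S, t `<=` s, rk s = rk S & is_normal s t v].
Proof.
move=> PS Qt ct rp nv; have [tS t0 rS] := ct.
have [e0 e00 He] := normal_path chi1 ct (cx_cell cP PS) rp nv.
have [|y [Ey [Sy _]]] := He e0; first by rewrite e00 lexx.
have [s [Qs sS sp [z [e [/andP[e_0 _] sz Ez]]]]] := sub_germ chi1 cP cQ QP PS (tS _ rp.1) Sy.
have ts := relint_sub chi1 cQ Qt Qs rp sp.
have ee : 0 < e * e0 by rewrite mulr_gt0.
have Ez' : iota z = iota p + (e * e0) *: v.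
  by rewrite Ez Ey (addrC (iota p) (e0 *: v)) addrK scalerA.
have Ev : v = (e * e0)^-1 *: (iota z - iota p).
  by rewrite Ez' addrC addKr scalerA mulVf ?gt_eqF // scale1r.
have [vS vt] := normal_spn ct nv.
have vs : (v <= spn s)%MS by rewrite Ev scalemx_sub // sub_diff.
have rs : rk s = rk S.
  apply/eqP; rewrite eqn_leq rk_mono // rS; apply: (rk_lt ts sz).
  apply: contra vt => zt; rewrite Ev scalemx_sub // addmx_sub // eqmx_opp.
  by apply: spn_in; apply: rp.1.
exists s; split=> //; apply/(is_normalP chi1 v ts t0).
have [v1 vt' [_ v0] _] := (is_normalP chi1 v tS t0).1 nv; split=> //.
exists z, p; split=> //; split; first exact: rp.1.
by rewrite Ez' addrC addKr dotvZr v1 mulr1.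
Qed.

(** A short step from [p] along [v] ends in both relative interiors; injectivity of [iota] on [S]
    identifies the two end points. *)
Lemma side_uniq S s s' t v p : P S -> Q s -> Q s' -> s `<=` S -> s' `<=` S ->
  codim1 iota t s -> codim1 iota t s' -> relint t p ->
  is_normal s t v -> is_normal s' t v -> s = s'.
Proof.
move=> PS Qs Qs' sS s'S ct ct' rp nv nv'.
have [e0 e00 He] := normal_path chi1 ct (cx_cell cQ Qs) rp nv.
have [e0' e00' He'] := normal_path chi1 ct' (cx_cell cQ Qs') rp nv'.
pose e := Num.min e0 e0'.
have [|y [Ey ry]] := He e; first by rewrite lt_min e00 e00' ge_min lexx.
have [|y' [Ey' ry']] := He' e; first by rewrite lt_min e00 e00' ge_min lexx orbT.
have E : y = y'.
  by apply: (cell_inj (cx_cell cP PS)); rewrite ?Ey //; [apply/sS/ry.1|apply/s'S/ry'.1].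
rewrite -E in ry'; apply/seteqP; split.
  exact: (relint_sub chi1 cQ Qs Qs' ry ry'.1).
exact: (relint_sub chi1 cQ Qs' Qs ry' ry.1).
Qed.

(* The relative interior of t lies in that of a cell S0 of P: either S0 is
   maximal and t has two neighbours with opposite normals, or S0 has the
   dimension of t and the neighbours of t and of S0 correspond. *)
Lemma pull_minkowski U b : minkowski iota P U n b ->
  minkowski iota Q U n (b \o big_cell).
Proof.
move=> mb k' E t /restrP[Qt [x [tx Ux]] rkt].
have [sq [usq Hsq]] := cx_star x cQ.
rewrite (star_sum _ _ cQ Qt tx Ux usq Hsq).
have inQ s : s \in sq -> Q s /\ s x by rewrite Hsq => /asboolP.
have [p rp] := relint_ex (cx_cvx chi1 cQ Qt) tx.
have [S0 [PS0 rS0]] := carrier chi1 p cP.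
have S0P S : P S -> t `<=` S -> S0 `<=` S.
  by move=> PS tS; apply: (relint_sub chi1 cP PS0 PS rS0); apply/tS/rp.1.
have tS0 : t `<=` S0.
  have [S [PS tS]] := QP Qt.
  have /(faceP chi1)[h [hS Eh]] := cx_sub_face cP PS PS0 (S0P S PS tS).
  move=> y ty; rewrite Eh; split; first exact: tS.
  apply: rp.2 => // [z /tS|]; first exact: hS.
  by have := rS0.1; rewrite Eh => -[].
have t0 : t !=set0 by exists x.
have ctP S : S0 `<=` S -> rk S = n.+1 -> codim1 iota t S.
  by move=> S0S rS; split=> //; [apply: subset_trans tS0 S0S | rewrite rS rkt E].
have ctQ s : t `<=` s -> rk s = n.+1 -> codim1 iota t s.
  by move=> ts rs; split=> //; rewrite rs rkt E.
have ftQ s : Q s -> t `<=` s -> rk s = n.+1 -> facet iota t s.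
  by move=> Qs ts rs; split; [apply: ctQ | apply: (cx_sub_face cQ)].
have : (n <= rk S0)%N by rewrite E -rkt; apply: rk_mono.
have := Ple PS0; rewrite leq_eqVlt ltnS => /orP[/eqP rS0n _|rS0n nrS0].
  have bS s : Q s -> t `<=` s -> rk s = n.+1 -> big_cell s = S0.
    move=> Qs ts rs; have [Pc sc rc] := big_cellP Qs rs.
    apply/esym/(cell_eq_rk chi1 cP PS0 Pc); last by rewrite rc rS0n.
    by apply: S0P => //; apply: subset_trans sc.
  have ct : codim1 iota t S0 by apply: ctP.
  have [v nv] := normal_ex chi1 ct.
  (* As [p] is in the relative interior of [S0], the cell extends to both sides of [t]. *)
  have nNv : is_normal S0 t (- v).
    have [v1 vt [vs v0] _] := (is_normalP chi1 v tS0 t0).1 nv.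
    apply/(is_normalP chi1 _ tS0 t0); split.
    - by rewrite !dotv_linE v1 opprK.
    - by move=> w wt w0; rewrite dotvNl vt // oppr0.
    - by rewrite eqmx_opp dotvNr v0 oppr0.
    - have [r r0 Hr] := relint_ball chi1 (cx_cell cP PS0) rS0.
      have [c c0 Hc] : exists2 c, 0 < c & forall j, `|(- c *: v) 0 j| <= r.
        have K0 : 0 < 1 + \sum_j `|v 0 j| by rewrite ltr_pwDl // sumr_ge0.
        have c0 : 0 < r / (1 + \sum_j `|v 0 j|) by rewrite divr_gt0.
        exists (r / (1 + \sum_j `|v 0 j|)) => // j.
        rewrite mxE normrM normrN (gtr0_norm c0) mulrAC ler_pdivrMr //.
        by rewrite ler_pM2l // (bigD1 j) //= addrCA lerDl addr_ge0 // sumr_ge0.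
      have [||z S0z Ez] := Hr (- c *: v) _ _ Hc.
      + by rewrite scalemx_sub.
      + by rewrite dotvZr v0 mulr0.
      exists z, p; split=> //; split; first exact: rp.1.
      by rewrite Ez addrC addKr dotvNl dotvZr v1 mulr1 opprK.
  have [s1 [Qs1 s1S ts1 rs1 nv1]] := side_ex PS0 Qt ct rp nv.
  have [s2 [Qs2 s2S ts2 rs2 nv2]] := side_ex PS0 Qt ct rp nNv.
  rewrite rS0n in rs1 rs2.
  have n12 : s1 <> s2.
    move=> E12; rewrite E12 in nv1.
    have [v1 _ _ _] := (is_normalP chi1 v tS0 t0).1 nv.
    have := normal_uniq chi1 (ftQ _ Qs2 ts2 rs2) nv1 nv2.
    move=> /(congr1 (dotv v)); rewrite dotvNr v1; lra.
  rewrite -big_filter (perm_big [:: s1; s2]); last first.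
    apply: uniq_perm; first exact: filter_uniq.
      by rewrite /= inE andbT; apply/eqP.
    move=> s; rewrite mem_filter !inE Hsq; apply/idP/idP.
      move=> /andP[/asboolP[ts rs] /asboolP[Qs sx]].
      have sS : s `<=` S0 by rewrite -(bS s) //; have [] := big_cellP Qs rs.
      have ns := nvecP chi1 (ftQ s Qs ts rs).
      have [Es|Es] := normal_pm chi1 ct nv (normal_mono sS ns); rewrite Es in ns.
        by rewrite (side_uniq PS0 Qs Qs1 sS s1S _ _ rp ns nv1) ?eqxx //; apply: ctQ.
      by rewrite (side_uniq PS0 Qs Qs2 sS s2S _ _ rp ns nv2) ?eqxx ?orbT //; apply: ctQ.
    by move=> /orP[] /eqP ->; apply/andP; split; apply/asboolP; split=> //;
      [apply: ts1 | apply: ts2].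
  rewrite big_cons big_seq1 /= !bS //.
  rewrite (nvec_eq chi1 (ftQ _ Qs1 ts1 rs1) nv1) (nvec_eq chi1 (ftQ _ Qs2 ts2 rs2) nv2).
  by rewrite scalerN subrr.
have rk0 : rk S0 = n by apply/eqP; rewrite eqn_leq nrS0 rS0n.
have S0x : S0 x by apply: tS0.
have ft0 S : P S -> S0 `<=` S -> rk S = n.+1 -> facet iota S0 S.
  move=> PS S0S rS; split; last exact: (cx_sub_face cP).
  by split=> //; [exists x | rewrite rS rk0].
(* Having equal spans, [t] and [S0] have the same normals in every cell around [S0]. *)
have spn0 w : (w <= spn S0)%MS -> (w <= spn t)%MS.
  by move=> wS0; apply: submx_trans wS0 (spn_eq_rk tS0 _); rewrite rk0 rkt E.
have n0t S v : P S -> S0 `<=` S -> rk S = n.+1 -> is_normal S S0 v -> is_normal S t v.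
  move=> PS S0S rS [v1 vS0 vs [y [z [Sy [S0z pos]]]]]; split=> //.
    by move=> y' z' ty' tz'; apply: vS0; apply: tS0.
  exists y, p; split=> //; split; first exact: rp.1.
  rewrite -(subrKA (iota z)) dotvDr (vS0 z p) // ?addr0 //.
  by apply/tS0/rp.1.
have nt0 S v : P S -> S0 `<=` S -> rk S = n.+1 -> is_normal S t v -> is_normal S S0 v.
  move=> PS S0S rS nv; have tS := subset_trans tS0 S0S.
  have [v1 vt vs [y [z [Sy [tz pos]]]]] := (is_normalP chi1 v tS t0).1 nv.
  apply/(is_normalP chi1 v S0S); first by exists x.
  split=> //; first by move=> w /spn0; apply: vt.
  by exists y, z; split=> //; split=> //; apply: tS0.
have [sp [usp Hsp]] := cx_star x cP.
have nS s : Q s -> t `<=` s -> rk s = n.+1 ->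
    [/\ P (big_cell s), S0 `<=` big_cell s, s `<=` big_cell s, rk (big_cell s) = n.+1 &
      nvec (big_cell s) S0 = nvec s t].
  move=> Qs ts rs; have [Pc sc rc] := big_cellP Qs rs.
  have S0c : S0 `<=` big_cell s by apply: S0P => //; apply: subset_trans sc.
  split=> //; apply: (nvec_eq chi1 (ft0 _ Pc S0c rc)); apply: nt0 => //.
  by apply: normal_mono sc _; apply: (nvecP chi1 (ftQ s Qs ts rs)).
have := mb k' E S0; rewrite (star_sum _ _ cP PS0 S0x Ux usp Hsp) => H.
rewrite -[RHS]H; last by apply/restrP; split=> //; [exists x | rewrite rk0].
rewrite -big_filter -[RHS]big_filter.
set LQ := [seq s <- sq | _]; set LP := [seq s <- sp | _].
have inLQ s : s \in LQ = `[< [/\ Q s, t `<=` s & rk s = n.+1] >].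
  rewrite mem_filter Hsq; apply/andP/asboolP.
    by move=> [/asboolP[ts rs] /asboolP[Qs _]].
  by move=> [Qs ts rs]; split; apply/asboolP; split=> //; apply: ts.
have inLP S : S \in LP = `[< [/\ P S, S0 `<=` S & rk S = n.+1] >].
  rewrite mem_filter Hsp; apply/andP/asboolP.
    by move=> [/asboolP[ts rs] /asboolP[Qs _]].
  by move=> [Qs ts rs]; split; apply/asboolP; split=> //; apply: ts.
have perm : perm_eq LP (map big_cell LQ).
  apply: uniq_perm; first exact: filter_uniq.
    rewrite map_inj_in_uniq ?filter_uniq // => s s'.
    rewrite !inLQ => /asboolP[Qs ts rs] /asboolP[Qs' ts' rs'] Ess'.
    have [Pc S0c sc rc Ns] := nS s Qs ts rs; have [_ _ sc' _ Ns'] := nS s' Qs' ts' rs'.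
    have Nss' : nvec s t = nvec s' t by rewrite -Ns -Ns' Ess'.
    rewrite -Ess' in sc'.
    have nv' := nvecP chi1 (ftQ s' Qs' ts' rs'); rewrite -Nss' in nv'.
    exact: (side_uniq Pc Qs Qs' sc sc' (ctQ s ts rs) (ctQ s' ts' rs') rp
      (nvecP chi1 (ftQ s Qs ts rs)) nv').
  move=> S; rewrite inLP; apply/asboolP/mapP.
    move=> [PS S0S rS].
    have nv := n0t S _ PS S0S rS (nvecP chi1 (ft0 S PS S0S rS)).
    have [s [Qs sS ts rs _]] := side_ex PS Qt (ctP S S0S rS) rp nv.
    rewrite rS in rs; exists s; first by rewrite inLQ; apply/asboolP.
    by rewrite (big_cell_eq Qs rs PS sS).
  by move=> [s]; rewrite inLQ => /asboolP[Qs ts rs] ->; have [] := nS s Qs ts rs.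
rewrite [RHS](perm_big _ perm) big_map /= big_seq [RHS]big_seq.
apply: eq_bigr => s; rewrite inLQ => /asboolP[Qs ts rs].
by have [_ _ _ _ ->] := nS s Qs ts rs.
Qed.

End Fixed.
End Pullback.

(** * Positivity of iterated products *)

Section Products.
Context {R : realType} {d : nat} {X : topologicalType} (iota : X -> 'rV[R]_d).
Context {chi : 'rV[R]_d} (chi1 : forall x, dotv chi (iota x) = 1).
Implicit Types (s t S E U W : set X) (P Q : set (set X)) (x y z p q : X).
Implicit Types (a h u v w : 'rV[R]_d) (c b : set X -> R) (g : X -> R).
Implicit Types (l : seq 'rV[R]_d).

Notation is_complex := (is_complex iota).
Notation relint := (relint iota).
Notation rk := (rk iota).
Notation spn := (spn iota).
Notation nvec := (nvec iota).
Notation minform := (minform iota).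
Notation minkowski := (minkowski iota).
Notation restr := (restr iota).

Lemma minkowski_scale P W k c (r : R) : is_complex P -> minkowski P W k c ->
  minkowski P W k (fun s => r * c s).
Proof.
move=> cP mc k' E t rt; have := mc k' E t rt.
have /restrP[Pt [x [tx Wx]] _] := rt.
have [sq [usq Hsq]] := cx_star x cP.
rewrite !(star_sum _ _ cP Pt tx Wx usq Hsq) => H.
under eq_bigr do rewrite -scalerA.
by rewrite -scaler_sumr H scaler0.
Qed.

Section Gmul.
Variables (Q : set (set X)) (U : set X) (n : nat) (b : set X -> R).
Hypotheses (cQ : is_complex Q) (oU : open U).
Hypotheses (mb : minkowski Q U n b) (b0 : forall s, restr Q U n s -> 0 <= b s).

Definition signed l := forall a, a \in l -> forall s, Q s ->
  (forall x, s x -> 0 <= dotv a (iota x)) \/ (forall x, s x -> dotv a (iota x) <= 0).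

Lemma gmul_minkowski l k : signed l -> (k + size l)%N = n ->
  minkowski Q U k (gmul iota Q U n (map minform l) b) /\
  forall s, restr Q U k s -> 0 <= gmul iota Q U n (map minform l) b s.
Proof.
elim: l k => [|a l IH] k /= sl; first by rewrite addn0 => ->.
rewrite addnS -addSn => kn; have [|mc c0] := IH k.+1 _ kn.
  by move=> a' a'l; apply: sl; rewrite inE a'l orbT.
have -> : (n - size (map minform l))%N = k.+1 by rewrite size_map -kn addnK.
have pg : pa_on iota Q U (minform a).
  by apply: minform_pa; apply: sl; rewrite mem_head.
split; first exact: (gdot_minkowski chi1 cQ oU mc pg).
move=> t /restrP[Qt [x [tx Ux]] rkt].
have [p rp Up] := relint_open chi1 (cx_cell cQ Qt) tx oU Ux.
have [h [hp hx]] := minform_sup iota a p.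
by have [] := gdot_ge chi1 cQ oU mc c0 pg Qt rkt rp Up hp hx.
Qed.

(* E arises from S by imposing the equations a = 0, a in l, one at a time (the
   last one first), each of them defining a proper face of the current cell; on
   such faces the product of the weight with the min(0, a) stays positive. *)
Fixpoint flag S l E : Prop :=
  if l is a :: l' then exists E', [/\ flag S l' E', Q E, E `<=` E',
    (forall x, E x -> dotv a (iota x) = 0) &
    (forall x, E' x -> dotv a (iota x) <= 0) /\ exists2 y, E' y & dotv a (iota y) < 0]
  else E = S.

Lemma flag_lt E E' a y : E `<=` E' -> (forall x, E x -> dotv a (iota x) = 0) ->
  E' y -> dotv a (iota y) < 0 -> (rk E < rk E')%N.
Proof.
move=> EE' Ea E'y ay; apply: (rk_lt EE' E'y); apply/negP => /(spn_ann0 (h := a)) H.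
by move: ay; rewrite H ?ltxx.
Qed.

Lemma flag_rk S l E : flag S l E -> (rk E + size l <= rk S)%N.
Proof.
elim: l E => [|a l IH] E /=; first by move=> ->; rewrite addn0.
move=> [E' [/IH H _ EE' Ea [_ [y E'y ay]]]].
have := flag_lt EE' Ea E'y ay; move: H; lia.
Qed.

Lemma flag_mem S l E : Q S -> flag S l E -> Q E.
Proof. by case: l => [|a l] QS /= => [->|[E' []]]. Qed.

Lemma flag_sub S l E : flag S l E -> E `<=` S.
Proof.
elim: l E => [|a l IH] E /=; first by move=> ->.
by move=> [E' [/IH E'S _ EE' _ _]]; apply: subset_trans E'S.
Qed.

(** The rank hypothesis and [flag_rk] make the rank drop by exactly one at each step. As [a]
    vanishes on [E], the form 0 supports [minform a] there, so by [gdot_ge] the product is at least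
    the term of [E']; that term is positive because [a] decreases along the normal. *)
Lemma gmul_flag S l E x : signed l -> Q S -> rk S = n.+1 -> 0 < b S ->
  flag S l E -> (n < rk E + size l)%N -> E x -> U x ->
  0 < gmul iota Q U n (map minform l) b E.
Proof.
move=> sl QS rS bS; elim: l E sl => [|a l IH] E sl /=; first by move=> ->.
move=> [E' [fE' QE EE' Ea [E'a [y E'y ay]]]] nE Ex Ux.
have lt := flag_lt EE' Ea E'y ay.
have := flag_rk fE'; rewrite rS => ubE'.
have nE' : (n < rk E' + size l)%N by move: nE lt; lia.
have sl' : signed l by move=> a' a'l; apply: sl; rewrite inE a'l orbT.
have pos := IH E' sl' fE' nE' (EE' _ Ex) Ux.
have [k rkE] : exists k, rk E = k.+1.
  by have := rk_gt0 chi1 Ex; case: (rk E) => // k _; exists k.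
have rkE' : rk E' = k.+2 by move: nE lt ubE' rkE; lia.
have kn : (k.+1 + size l)%N = n by move: nE ubE' rkE rkE'; lia.
have [mc c0] := gmul_minkowski sl' kn.
have -> : (n - size (map minform l))%N = k.+1 by rewrite size_map -kn addnK.
have pg : pa_on iota Q U (minform a).
  by apply: minform_pa; apply: sl; rewrite mem_head.
have [p rp Up] := relint_open chi1 (cx_cell cQ QE) Ex oU Ux.
have Q_E' : Q E' by apply: flag_mem fE'.
have gp : minform a p = dotv 0 (iota p).
  by rewrite dot0v minformE (Ea p rp.1) min_l.
have gx z : minform a z <= dotv 0 (iota z).
  by rewrite dot0v minformE ge_min lexx.
have [_ /(_ E' Q_E' EE' rkE')] := gdot_ge chi1 cQ oU mc c0 pg QE rkE rp Up gp gx.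
apply: lt_le_trans; rewrite mulr_gt0 // sub0r dotvNl oppr_gt0.
have ft : facet iota E E'.
  by apply: (cx_facet cQ) => //; [exists x | rewrite rkE' rkE].
have nv := nvecP chi1 ft.
have [vE' _] := normal_spn chi1 ft.1 nv.
have -> : dotv (slope iota U (minform a) E') (nvec E' E) = dotv a (nvec E' E).
  apply/eqP; rewrite -subr_eq0 -dotvBl; apply/eqP.
  apply: (open_spn chi1 (cx_cell cQ Q_E') (EE' _ Ex) oU Ux) vE' => z E'z Uz.
  rewrite dotvBl -(slopeP pg Q_E' E'z Uz) minformE min_r ?subrr //.
  exact: E'a.
rewrite lt_neqAle (normal_ge0 chi1 ft.1 nv E'a Ea) andbT; apply/negP => /eqP av0.
have [H _] := normal_decomp chi1 ft.1 nv (sub_diff iota E'y (EE' _ Ex)) (chi_diff chi1 y x).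
have := spn_ann0 H Ea; rewrite !dotv_linE av0 (Ea x Ex); lra.
Qed.

End Gmul.

Section Balancing.
Variables (P0 Pb Q : set (set X)) (U : set X) (n : nat) (b : set X -> R).
Hypotheses (aPb : admissible iota P0 Pb) (aQ : admissible iota P0 Q).
Hypotheses (QPb : subdivides Q Pb) (oU : open U).
Hypothesis (Ple : forall s, Pb s -> (rk s <= n.+1)%N).
Hypotheses (mb : minkowski Pb U n b) (b0 : forall s, restr Pb U n s -> 0 < b s).

Let cPb : is_complex Pb. Proof. by case: aPb. Qed.
Let cQ : is_complex Q. Proof. by case: aQ. Qed.

Definition pullw := b \o big_cell iota Pb n.

Lemma pullw_minkowski : minkowski Q U n pullw.
Proof. exact: (pull_minkowski chi1 cPb cQ QPb Ple mb). Qed.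

Lemma pullw_gt0 s : restr Q U n s -> 0 < pullw s.
Proof.
move=> /restrP[Qs [x [sx Ux]] rs]; have [Pc sc rc] := big_cellP QPb Ple Qs rs.
by apply: b0; apply/restrP; split=> //; exists x; split=> //; apply: sc.
Qed.

Lemma pullw_cyc : cyc_eq iota P0 U n Pb b Q pullw.
Proof.
exists Q; split=> //; split=> //; split; first exact: subdivides_refl.
move=> s /restrP[Qs _ rs]; exists (pullw s).
have [Pc sc rc] := big_cellP QPb Ple Qs rs.
split; left; first by exists (big_cell iota Pb n s); split=> //; split=> //; apply/pdimP.
by exists s; split=> //; split; [apply/pdimP | split=> // x].
Qed.

(** The factor [r] leaves room to normalise convex coefficients; it becomes the [alpha] of a sum
    with one term. *)
Lemma beta_pos_minforms l k (r : R) : signed Q l -> (k + size l)%N = n -> 0 < r ->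
  beta_pos iota P0 U n Pb b k Q
    (fun s => r * gmul iota Q U n (map minform l) pullw s).
Proof.
move=> sl kn r0.
have c0 s : restr Q U n s -> 0 <= pullw s by move=> /pullw_gt0/ltW.
have [mc _] := gmul_minkowski cQ oU pullw_minkowski c0 sl kn.
split; first by rewrite -kn leq_addr.
split; first exact: minkowski_scale.
exists 1%N, (fun=> r), (fun _ i => minform (nth 0 l i)), Q, pullw; split=> //.
- move=> _ i; have pg W : pa_on iota Q W (minform (nth 0 l i)).
    apply: minform_pa; apply: sl; rewrite mem_nth //.
    by have := ltn_ord i; rewrite -[X in (_ < X - _)%N]kn addKn.
  by split=> //; apply: (minform_concave chi1); exists Q.
- by split; [exact: pullw_minkowski | exact: pullw_cyc].
apply: cyc_eq_refl => // s _; rewrite big_ord1; congr (_ * gmul _ _ _ _ _ _ _).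
have E : size l = (n - k)%N by rewrite -kn addKn.
rewrite -E; transitivity (map minform (mkseq (nth 0 l) (size l))); first by rewrite mkseq_nth.
by rewrite /mkseq -val_enum_ord -!map_comp.
Qed.

End Balancing.
End Products.

(** * Making a point a vertex *)

Section Chain.
Context {R : realType} {d : nat} {X : topologicalType} (iota : X -> 'rV[R]_d).
Context {chi : 'rV[R]_d} (chi1 : forall x, dotv chi (iota x) = 1).
Implicit Types (S E U W : set X) (P Q : set (set X)) (x y z p q : X).
Implicit Types (a h u v w : 'rV[R]_d).

Notation is_complex := (is_complex iota).
Notation relint := (relint iota).
Notation rk := (rk iota).
Notation spn := (spn iota).
Notation cuts := (cuts iota).
Notation flag := (flag iota).

Lemma spn1_sub x w : (w <= spn [set x])%MS -> (w <= iota x)%MS.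
Proof. by move/submx_trans; apply; apply: spn_min => y ->. Qed.

Lemma rk1 x : rk [set x] = 1%N.
Proof.
apply/eqP; rewrite eqn_leq (rk_gt0 chi1 (x := x)) // andbT.
apply: leq_trans (mxrankS _) (rank_leq_row (iota x)).
by apply: spn_min => y ->.
Qed.

Lemma relint_off S x : cvx iota S -> S x -> (1 < rk S)%N ->
  exists2 q, relint S q & ~~ (iota q <= spn [set x])%MS.
Proof.
move=> Scvx Sx rS; have [r rr] := relint_ex Scvx Sx.
have [rx|rx] := boolP (iota r <= spn [set x])%MS; last by exists r.
have [y Sy yx] : exists2 y, S y & ~~ (iota y <= spn [set x])%MS.
  apply: contrapT => H; have : (rk S <= rk [set x])%N.
    apply/mxrankS/spn_min => y Sy; apply: contrapT => yx; apply: H.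
    by exists y => //; apply/negP.
  by rewrite rk1 leqNgt rS.
have half : 0 <= (2^-1 : R) <= 1 by lra.
have [z Sz Ez] := Scvx r y 2^-1 rr.1 Sy half.
exists z; first by apply: (relint_seg (t := 2^-1) rr Sy Sz) => //; lra.
apply: contra yx => zx.
have -> : iota y = 2 *: iota z - iota r.
  by rewrite Ez; apply/rowP => j; rewrite !mxE; field.
by rewrite addmx_sub ?eqmx_opp ?scalemx_sub.
Qed.

Lemma indep_family S x q m : S x -> S q -> ~~ (iota q <= spn [set x])%MS ->
  (m.+2 <= rk S)%N ->
  exists v : 'I_m.+2 -> X, (forall i, S (v i)) /\ row_free (pts_mx iota v) /\
    exists i0 i1, [/\ i0 != i1, v i0 = x & v i1 = q].
Proof.
move=> Sx Sq qx; elim: m => [_|m IH rS].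
  pose v0 (i : 'I_1) := x.
  have E : pts_mx iota v0 = iota x.
    by apply/rowP => j; rewrite mxE.
  have v0f : row_free (pts_mx iota v0).
    rewrite E /row_free rank_rV; case: (iota x =P 0) => // x0.
    by have := chi1 x; rewrite x0 dotv0 => /eqP; rewrite eq_sym oner_eq0.
  have [|v [Sv vf v1 v2]] := indep_extend (x := q) (fun=> Sx) v0f Sq.
    rewrite E; apply: contra qx => qx; apply: submx_trans qx _.
    exact: spn_in.
  by exists v; split=> //; split=> //; exists (lift ord0 ord0), ord0; rewrite v2.
have [v [Sv [vf [i0 [i1 [n01 v0 v1]]]]]] := IH (ltnW rS).
have [y Sy yv] := indep_complete Sv vf rS.
have [v' [Sv' v'f _ v'l]] := indep_extend Sv vf Sy yv.
exists v'; split=> //; split=> //; exists (lift ord0 i0), (lift ord0 i1).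
by rewrite !v'l (inj_eq (@lift_inj _ _)).
Qed.

(* The forms are opposite to the dual basis of n + 2 independent points of S that
   include x and q; e is the one belonging to q. *)
Lemma vertex_chain Q S x n : is_complex Q -> Q S -> S x -> rk S = n.+2 ->
  exists (l : seq 'rV[R]_d) (e : 'rV[R]_d) (q : X) (E T : set X),
    [/\ size l = n, relint S q & ~~ (iota q <= spn [set x])%MS] /\
    let Q' := cuts Q (rcons l e) in
    [/\ Q' [set x], Q' T /\ T `<=` S, rk T = n.+2,
        flag Q' T l E & [/\ E x, E q & rk E = 2%N]].
Proof.
move=> cQ QS Sx rS.
have [|q rq qx] := relint_off (cx_cvx chi1 cQ QS) Sx; first by rewrite rS.
have Sq := rq.1; have [|v [Sv [vf [i0 [i1 [n01 v0 v1]]]]]] := indep_family (m := n) Sx Sq qx.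
  by rewrite rS.
have /row_freeP[N WN] := vf; set M := pts_mx iota v in vf WN.
pose al i : 'rV[R]_d := - (col i N)^T.
have alE i w : dotv (al i) w = - (w *m N) 0 i.
  by rewrite dotvNl dotvC dotvE mxE; congr (- _); apply: eq_bigr => k _; rewrite !mxE.
have alv i j : dotv (al i) (iota (v j)) = - (j == i)%:R.
  by rewrite alE -(row_pts_mx iota v j) -row_mul -/M WN !mxE.
have SM : (spn S <= M)%MS.
  have MS : (M <= spn S)%MS by apply: pts_mx_sub => i; apply: spn_in.
  by have /geq_leqif <- := mxrank_leqif_sup MS; rewrite (eqP vf) -rS.
have coord y : S y -> iota y = \sum_k - dotv (al k) (iota y) *: iota (v k).
  move=> Sy; have /submxP[D ED] := submx_trans (spn_in iota Sy) SM.
  rewrite [LHS]ED mulmx_sum_row; apply: eq_bigr => k _.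
  by rewrite row_pts_mx alE opprK ED -mulmxA WN mulmx1.
pose L := [seq i <- enum 'I_n.+2 | (i != i0) && (i != i1)].
have Li1 : i1 \notin L by rewrite mem_filter eqxx andbF.
have Li0 : i0 \notin L by rewrite mem_filter eqxx.
have uL : uniq L by rewrite filter_uniq // enum_uniq.
have inL i : i \in [:: i0, i1 & L].
  by rewrite !inE mem_filter mem_enum andbT; case: (i =P i0); case: (i =P i1).
have sL : size L = n.
  have : perm_eq (enum 'I_n.+2) [:: i0, i1 & L].
    apply: uniq_perm; first exact: enum_uniq.
      by rewrite /= inE negb_or n01 Li0 Li1.
    by move=> i; rewrite inL mem_enum.
  by move/perm_size; rewrite size_enum_ord /= => -[].
(* Every index but [i0], that of [x]: when these coordinates vanish, only [x] is left. *)
pose K := rcons L i1.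
have inK i : i != i0 -> i \in K.
  by move=> ni; have := inL i; rewrite mem_rcons !inE (negbTE ni).
have K0 i : i \in K -> i != i0.
  by rewrite mem_rcons inE => /orP[/eqP ->|]; [rewrite eq_sym | rewrite mem_filter => /andP[/andP[]]].
pose con (L' : seq 'I_n.+2) := [seq (al k, if k \in L' then None else Some false) | k <- K].
(* As [al k] is minus the k-th coordinate, these are the points of [S] whose coordinates in [K] are
   nonnegative, and zero for indices in [L']. *)
pose Ec (L' : seq 'I_n.+2) := [set y | S y /\ forall c, c \in con L' -> hs iota c.2 c.1 y].
have EcP L' y : Ec L' y <-> S y /\ forall k, k \in K ->
    if k \in L' then dotv (al k) (iota y) = 0 else dotv (al k) (iota y) <= 0.
  split=> -[Sy H]; split=> //.
    move=> k kK; have kc : (al k, if k \in L' then None else Some false) \in con L'.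
      by apply/mapP; exists k.
    by have := H _ kc; rewrite /hs /=; case: (k \in L').
  by move=> _ /mapP[k kK ->]; have := H k kK; rewrite /hs /=; case: (k \in L').
have Q'E L' : cuts Q (rcons (map al L) (al i1)) (Ec L').
  have := cuts_mem iota (con L') QS; rewrite -/(Ec L') /con -map_comp.
  by rewrite -map_rcons -/K; congr (cuts _ _ _); apply: eq_map.
have vE L' j : j \notin L' -> Ec L' (v j).
  move=> jL'; apply/EcP; split=> // k kK; rewrite alv.
  case: ifP => kL'; last by rewrite oppr_le0 ler0n.
  by case: eqP jL' => [->|_ _]; rewrite ?kL' ?oppr0.
have flagL L' : uniq L' -> {subset L' <= L} ->
    flag (cuts Q (rcons (map al L) (al i1))) (Ec [::]) (map al L') (Ec L').
  elim: L' => [|i L' IH] //= /andP[iL' uL'] sub.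
  have iK : i \in K by rewrite mem_rcons inE sub ?mem_head ?orbT.
  exists (Ec L'); split=> //.
  - by apply: IH => // j jL'; apply: sub; rewrite inE jL' orbT.
  - move=> y /EcP[Sy H]; apply/EcP; split=> // k /H.
    rewrite inE; case: (k == i) => //=; case: ifP => _ ->//.
  - by move=> y /EcP[Sy /(_ i iK)]; rewrite mem_head.
  split; first by move=> y /EcP[Sy /(_ i iK)]; rewrite (negbTE iL').
  by exists (v i); [exact: vE | rewrite alv eqxx oppr_lt0 ltr01].
have fl := flagL L uL (fun _ => id).
have Ex : Ec L x by rewrite -v0; apply: vE.
have Eq : Ec L q by rewrite -v1; apply: vE.
have TS : Ec [::] `<=` S by move=> y [].
have rkE : (2 <= rk (Ec L))%N.
  rewrite -(rk1 x); apply: (rk_lt _ Eq qx) => _ -> //.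
have := flag_rk fl; rewrite size_map sL => frk.
(* Ranks are squeezed: [E] has rank at least 2, the flag climbs [n] steps, and [S] has rank
   [n.+2]. *)
have rkT : rk (Ec [::]) = n.+2.
  by apply/eqP; have := rk_mono iota TS; rewrite rS; move: rkE frk; lia.
exists (map al L), (al i1), q, (Ec L), (Ec [::]); split.
  by rewrite size_map sL.
split=> //; last by split=> //; move: rkE frk; rewrite rkT; lia.
suff -> : [set x] = Ec K by exact: Q'E.
apply/seteqP; split=> y.
  by move=> ->; rewrite -v0; apply: vE; apply/negP => /K0; rewrite eqxx.
move=> /EcP[Sy H]; apply: (cell_inj (cx_cell cQ QS)) => //.
have Ey : iota y = - dotv (al i0) (iota y) *: iota x.
  rewrite [LHS](coord y Sy) (bigD1 i0) //= v0 big1 ?addr0 // => k /inK kK.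
  by have := H k kK; rewrite kK => ->; rewrite oppr0 scale0r.
have := chi1 y; rewrite {1}Ey dotvZr chi1 mulr1 => E1.
by rewrite Ey E1 scale1r.
Qed.

End Chain.

Lemma sum_nth (V : nmodType) (T : Type) (x0 : T) (s : seq T) (F : T -> V) :
  \sum_(i < size s) F (nth x0 s i) = \sum_(x <- s) F x.
Proof. by rewrite (big_nth x0) big_mkord. Qed.

(** * Weakly concave functions *)

Section OneSided.
Context {R : realType} {d : nat} {X : topologicalType} (iota : X -> 'rV[R]_d).
Context {chi : 'rV[R]_d} (chi1 : forall x, dotv chi (iota x) = 1).
Implicit Types (s t S E T : set X) (P Q : set (set X)) (x y z p q : X).
Implicit Types (a h u v w : 'rV[R]_d).

Notation is_complex := (is_complex iota).
Notation relint := (relint iota).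
Notation rk := (rk iota).
Notation spn := (spn iota).
Notation nvec := (nvec iota).
Notation minform := (minform iota).

Variables (P0 Pb : set (set X)) (U : set X) (n : nat) (b : set X -> R) (f : X -> R).
Hypotheses (aPb : admissible iota P0 Pb) (oU : open U).
Hypothesis (Ple : forall s, Pb s -> (rk s <= n.+2)%N).
Hypotheses (mb : minkowski iota Pb U n.+1 b) (b0 : forall s, restr iota Pb U n.+1 s -> 0 < b s).
Hypothesis wc : weakly_concave iota P0 U n.+1 Pb b f.

(* In the convex combination at x, the point on E is y and all the others are at
   the fixed distance e0 from x. *)
Lemma vertex_ineq Q x l E T q : admissible iota P0 Q -> subdivides Q Pb ->
  Q [set x] -> (forall s, Q s -> s x -> s `<=` U) ->
  signed iota Q l -> size l = n -> flag iota Q T l E -> Q T -> rk T = n.+2 ->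
  E x -> E q -> rk E = 2%N -> ~~ (iota q <= spn [set x])%MS ->
  exists K, forall y (t : R), 0 < t -> E y ->
    iota y = iota x + t *: (iota q - iota x) -> f y <= f x + K * t.
Proof.
move=> aQ QPb Qx QU sl ln fl QT rT Ex Eq rE qx.
have cQ : is_complex Q by case: aQ.
have cPb : is_complex Pb by case: aPb.
have QE : Q E by apply: flag_mem fl.
have Ux : U x by apply: (QU E).
have pw0 s : restr iota Q U n.+1 s -> 0 < pullw iota Pb n.+1 b s.
  exact: (pullw_gt0 QPb Ple b0).
have pw0' s : restr iota Q U n.+1 s -> 0 <= pullw iota Pb n.+1 b s by move=> /pw0/ltW.
have pwm : minkowski iota Q U n.+1 (pullw iota Pb n.+1 b).
  exact: (pullw_minkowski chi1 aPb aQ QPb Ple mb).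
have kn : (1 + size l)%N = n.+1 by rewrite ln.
pose w := gmul iota Q U n.+1 (map minform l) (pullw iota Pb n.+1 b).
have [mw w0] := gmul_minkowski chi1 cQ oU pwm pw0' sl kn.
rewrite -/w in mw w0.
have wE : 0 < w E.
  apply: (gmul_flag chi1 cQ oU pwm pw0' sl QT rT _ fl _ Ex Ux); last by rewrite rE ln.
  apply: pw0; apply/restrP; split=> //; exists x; split=> //.
  exact: (flag_sub fl).
have [sq [usq Hsq]] := cx_star x cQ.
pose LQ := [seq s <- sq | `[< [set x] `<=` s /\ rk s = 2%N >]].
have inLQ s : s \in LQ = `[< [/\ Q s, s x & rk s = 2%N] >].
  rewrite mem_filter Hsq; apply/andP/asboolP.
    by move=> [/asboolP[_ rs] /asboolP[Qs sx]].
  by move=> [Qs sx rs]; split; apply/asboolP; split=> // y ->.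
have uLQ : uniq LQ by rewrite filter_uniq.
have ELQ : E \in LQ by rewrite inLQ; apply/asboolP.
have ft s : s \in LQ -> facet iota [set x] s.
  rewrite inLQ => /asboolP[Qs sx rs]; apply: (cx_facet cQ) => //.
  - by move=> y ->.
  - by exists x.
  - by rewrite rs (rk1 chi1).
pose nv s := nvec s [set x].
have nP s : s \in LQ -> is_normal iota s [set x] (nv s).
  by move=> sL; apply: (nvecP chi1 (ft s sL)).
have bal : \sum_(s <- LQ) w s *: nv s = 0.
  have := mw 0%N erefl [set x].
  rewrite (star_sum _ _ cQ Qx (erefl x) Ux usq Hsq) -big_filter -/LQ; apply.
  by apply/restrP; split=> //; [exists x | rewrite (rk1 chi1)].
have rx : relint [set x] x by split=> // h _ hx y ->.
have [s sL|e0 e00 He0] := @small_all R _ LQ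
    (fun s e => 0 < e -> exists2 z, s z & iota z = iota x + e *: nv s).
  have := sL; rewrite inLQ => /asboolP[Qs sx rs].
  have [e1 e10 He1] := normal_path chi1 (ft s sL).1 (cx_cell cQ Qs) rx (nP s sL).
  exists e1 => // e /andP[_ ee] e_0.
  have [|z [Ez [sz _]]] := He1 e; first by rewrite e_0.
  by exists z.
have /choice[zf Hzf] : forall s, exists z, s \in LQ -> s z /\ iota z = iota x + e0 *: nv s.
  move=> s; have [sL|sL] := boolP (s \in LQ); last by exists x.
  have [||z sz Ez] := He0 e0 _ s sL => //; first by rewrite lexx ltW.
  by exists z.
pose mu := dotv (nv E) (iota q - iota x).
have [xE1 xE0 rExE] := (ft E ELQ).1.
have [nE1 _ _ _] := (is_normalP chi1 _ xE1 xE0).1 (nP E ELQ).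
have mu0 : 0 < mu.
  have [_ ] := normal_sign chi1 (ft E ELQ) (nP E ELQ) Eq (erefl x).
  by apply=> qx'; move: qx; rewrite spn_in.
have Eq' : iota q - iota x = mu *: nv E.
  have [] := normal_decomp chi1 (ft E ELQ).1 (nP E ELQ) (sub_diff iota Eq Ex) (chi_diff chi1 q x).
  rewrite -/mu => /spn1_sub/sub_rVP[r Er]; rewrite Er dotvZr chi1 mulr1 => r0.
  by apply/eqP; rewrite -subr_eq0 Er r0 scale0r.
(* The contribution of the other rays, independent of [t]; weak concavity will give
   [w E / (t * mu) * (f y - f x) <= D]. *)
pose D := \sum_(s <- LQ | s != E) w s / e0 * (f x - f (zf s)).
exists (mu / w E * D) => y t t0 Ey yE.
pose xs s := if s == E then y else zf s.
pose dd s := if s == E then t * mu else e0.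
have dd0 s : 0 < dd s by rewrite /dd; case: ifP => // _; rewrite mulr_gt0.
have xsP s : s \in LQ -> s (xs s) /\ iota (xs s) = iota x + dd s *: nv s.
  move=> sL; rewrite /xs /dd; case: eqP => [->|_]; last exact: Hzf.
  by split=> //; rewrite yE Eq' scalerA.
have w0' s : s \in LQ -> 0 <= w s.
  rewrite inLQ => /asboolP[Qs sx rs]; apply: w0; apply/restrP; split=> //.
  by exists x.
(* A balanced combination needs [nu s] times the distance to equal the weight, so [nu s] is
   proportional to [w s / dd s]; making the sum 1 rescales the weight by [Tot^-1]. *)
pose Tot := \sum_(s <- LQ) w s / dd s.
have Tot0 : 0 < Tot.
  rewrite /Tot (bigD1_seq E) //= ltr_pwDl ?divr_gt0 // big_seq_cond sumr_ge0 //.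
  by move=> s /andP[sL _]; rewrite divr_ge0 ?w0' // ltW.
pose nu s := w s / dd s / Tot.
have sgL (i : 'I_(size LQ)) : nth set0 LQ i \in LQ by rewrite mem_nth.
have dist s : s \in LQ -> nu s * dist_aff iota (xs s) [set x] = Tot^-1 * w s.
  move=> sL; have [sx Ex'] := xsP s sL.
  rewrite (dist_aff_normal chi1 (ft s sL) (nP s sL) sx (erefl x)) Ex' addrC addKr dotvZr.
  have [ts t0' _] := (ft s sL).1.
  have [-> _ _ _] := (is_normalP chi1 _ ts t0').1 (nP s sL).
  by rewrite mulr1 /nu mulrAC mulfVK ?gt_eqF // mulrC.
have := wc (x := x) (xs := fun i : 'I_(size LQ) => xs (nth set0 LQ i))
  (nu := fun i => nu (nth set0 LQ i)).
rewrite (sum_nth set0 LQ (fun s => nu s * f (xs s))) => H.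
have {}H : \sum_(s <- LQ) nu s * f (xs s) <= f x.
  apply: H.
  - split=> //.
    + move=> i; have [sx _] := xsP _ (sgL i); apply: (QU _ _ _ _ sx).
        by have := sgL i; rewrite inLQ => /asboolP[].
      by have := sgL i; rewrite inLQ => /asboolP[].
    + by move=> i; rewrite divr_ge0 ?(ltW Tot0) // divr_ge0 ?w0' // ltW.
    + by rewrite sum_nth -mulr_suml mulfV // gt_eqF.
    + rewrite (sum_nth set0 LQ (fun s => nu s *: iota (xs s))) big_seq.
      transitivity (\sum_(s <- LQ) (nu s *: iota x + Tot^-1 *: (w s *: nv s))).
        rewrite [RHS]big_seq; apply: eq_bigr => s sL; have [_ ->] := xsP s sL.
        rewrite scalerDr !scalerA; congr (_ + _ *: _).
        by rewrite /nu mulrAC mulfVK ?gt_eqF // mulrC.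
      rewrite big_split /= -scaler_sumr bal scaler0 addr0 -scaler_suml.
      by rewrite -mulr_suml mulfV ?gt_eqF // scale1r.
  - exists Q, [set x], 0%N, (fun i : 'I_(size LQ) => nth set0 LQ i), (fun s => Tot^-1 * w s).
    split; first by split=> //; apply/pdimP; rewrite (rk1 chi1).
    split.
      move=> i; have := sgL i; have [sxi _] := xsP _ (sgL i).
      rewrite inLQ => /asboolP[Qs sx rs]; split=> //; last by apply/pdimP.
        by have [] := ft _ (sgL i).
      exact: QU.
    split; first by move=> i j /eqP; rewrite nth_uniq // => /eqP/val_inj.
    split.
      move=> s Qs /pdimP rs [xs' _]; have sL : s \in LQ.
        by rewrite inLQ; apply/asboolP; split=> //; apply: xs'.
      have sm : (index s LQ < size LQ)%N by rewrite index_mem.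
      by exists (Ordinal sm); rewrite /= nth_index.
    split; last by move=> i; apply: dist.
    apply: (beta_pos_minforms chi1 aPb aQ QPb oU Ple mb b0 sl kn).
    by rewrite invr_gt0.
have : \sum_(s <- LQ) w s / dd s * (f (xs s) - f x) <= 0.
  have -> : \sum_(s <- LQ) w s / dd s * (f (xs s) - f x) =
      Tot * (\sum_(s <- LQ) nu s * f (xs s)) - Tot * f x.
    under eq_bigr do rewrite mulrBr.
    rewrite sumrB -mulr_suml -/Tot; congr (_ - _); rewrite mulr_sumr.
    by apply: eq_bigr => s _; rewrite /nu; field; rewrite !gt_eqF.
  by rewrite -mulrBr pmulr_rle0 // subr_le0.
rewrite (bigD1_seq E) //= {1}/dd {1}/xs eqxx.
have -> : \sum_(s <- LQ | s != E) w s / dd s * (f (xs s) - f x) = - D.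
  rewrite /D -sumrN; apply: eq_bigr => s nsE; rewrite /dd /xs (negbTE nsE).
  by rewrite -mulrN opprB.
rewrite subr_le0 => H2; rewrite -lerBlDl.
have {}H2 : w E / (t * mu) * (t * mu / w E) * (f y - f x) <= D * (t * mu / w E).
  rewrite mulrAC ler_wpM2r // divr_ge0 ?(ltW wE) // mulr_ge0 ?ltW //.
apply: le_trans (le_trans _ H2) _.
  by rewrite le_eqVlt; apply/orP; left; apply/eqP; field; rewrite !gt_eqF.
by rewrite le_eqVlt; apply/orP; left; apply/eqP; field; rewrite !gt_eqF.
Qed.

Lemma one_sided Q S x : admissible iota P0 Q -> subdivides Q Pb ->
  (forall s, Q s -> s x -> s `<=` U) -> Q S -> S x -> rk S = n.+2 ->
  exists2 q, relint S q & exists K, forall y (t : R), 0 < t <= 1 -> S y ->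
    iota y = iota x + t *: (iota q - iota x) -> f y <= f x + K * t.
Proof.
move=> aQ QPb QU QS Sx rS; have cQ : is_complex Q by case: aQ.
have [l [e [q [E [T [[ln rq qx]]]]]]] := vertex_chain chi1 cQ QS Sx rS.
move=> /= [Q'x [Q'T TS] rT fl [Ex Eq rE]]; exists q => //.
set Q' := cuts _ _ _ in Q'x Q'T fl.
have sub : subdivides Q' Q by apply: cuts_subdivides.
have [||s Q's sx|a al s Q's|K HK] :=
    @vertex_ineq Q' x l E T q _ _ Q'x _ _ ln fl Q'T rT Ex Eq rE qx.
- exact: admissible_cuts.
- exact: subdivides_trans sub QPb.
- have [s' [Qs' ss']] := sub s Q's; apply: (subset_trans ss').
  by apply: QU => //; apply: ss'.
- by apply: (cuts_sign Q's); rewrite mem_rcons inE al orbT.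
exists K => y t /andP[t0 t1] Sy Ey.
have cQ' : is_complex Q' by apply: cuts_complex.
have [|z Ez E'] := cx_cvx chi1 cQ' (flag_mem Q'T fl) (t := t) Ex Eq; first by rewrite ltW.
have ES : E `<=` S by apply: subset_trans (flag_sub fl) TS.
suff -> : y = z by apply: HK; rewrite // -E'.
by apply: (cell_inj (cx_cell cQ QS)) => //; [apply: ES | rewrite Ey E'].
Qed.

End OneSided.

(** * Concavity on maximal cells *)

Section CellConcave.
Context {R : realType} {d : nat} {X : topologicalType} (iota : X -> 'rV[R]_d).
Context {chi : 'rV[R]_d} (chi1 : forall x, dotv chi (iota x) = 1).
Implicit Types (s S T : set X) (P Q : set (set X)) (x y z p q : X).
Implicit Types (a h u v w : 'rV[R]_d).

Notation is_complex := (is_complex iota).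
Notation relint := (relint iota).
Notation rk := (rk iota).
Notation spn := (spn iota).
Notation nvec := (nvec iota).

Lemma crossing S a x y : cvx iota S -> S x -> S y ->
  dotv a (iota x) < 0 -> 0 < dotv a (iota y) ->
  exists z (t : R), [/\ 0 < t < 1, S z, dotv a (iota z) = 0 &
    iota z = iota x + t *: (iota y - iota x)].
Proof.
move=> Scvx Sx Sy ax ay; pose D := dotv a (iota y) - dotv a (iota x).
have D0 : 0 < D by rewrite /D; lra.
pose t := - dotv a (iota x) / D.
have t01 : 0 < t < 1.
  rewrite divr_gt0 ?oppr_gt0 //= ltr_pdivrMr // /D; lra.
have [|z Sz Ez] := Scvx x y t Sx Sy; first by case/andP: t01 => /ltW-> /ltW->.
exists z, t; split=> //; rewrite Ez !dotv_linE -/D /t mulfVK ?gt_eqF // subrr //.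
Qed.

Variables (P0 Pb : set (set X)) (U : set X) (n : nat) (b : set X -> R) (f : X -> R).
Hypotheses (aPb : admissible iota P0 Pb) (oU : open U).
Hypothesis (Ple : forall s, Pb s -> (rk s <= n.+2)%N).
Hypotheses (mb : minkowski iota Pb U n.+1 b) (b0 : forall s, restr iota Pb U n.+1 s -> 0 < b s).
Hypothesis wc : weakly_concave iota P0 U n.+1 Pb b f.

(** After a cut through [z] orthogonal to the segment, the two halves of [S] are the only maximal
    cells around the wall [T]. They carry the same weight, and the distances of [x] and [y] to [T]
    are as [t] to [1 - t], which is the balancing condition. *)
Lemma cell_concave Q S : admissible iota P0 Q -> subdivides Q Pb ->
  Q S -> S `<=` U -> rk S = n.+2 -> concave_on iota S f.
Proof.
move=> aQ QPb QS SU rS x y z t Sx Sy Sz /andP[t0 t1] Ez.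
have cQ : is_complex Q by case: aQ.
have cS := cx_cell cQ QS; have Scvx := cx_cvx chi1 cQ QS.
have [Exy|nxy] := eqVneq (iota x) (iota y).
  have -> : y = x by apply: (cell_inj cS).
  have -> : z = x by apply: (cell_inj cS); rewrite // Ez -Exy subrr scaler0 addr0.
  by rewrite -mulrDl subrK mul1r.
have [t00|tn0] := eqVneq t 0.
  have -> : z = x by apply: (cell_inj cS); rewrite // Ez t00 scale0r addr0.
  by rewrite t00; lra.
have [t11|tn1] := eqVneq t 1.
  have -> : z = y by apply: (cell_inj cS); rewrite // Ez t11 scale1r addrC subrK.
  by rewrite t11; lra.
have {tn0}t0 : 0 < t by rewrite lt_neqAle eq_sym tn0.
have {tn1}t1 : t < 1 by rewrite lt_neqAle tn1.
pose D := iota y - iota x.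
have DD : 0 < dotv D D by apply: dotv_gt0; rewrite subr_eq0 eq_sym.
pose a := D - dotv D (iota z) *: chi.
have az : dotv a (iota z) = 0 by rewrite dotvBl dotvZl chi1 mulr1 subrr.
have ax : dotv a (iota x) < 0.
  suff -> : dotv a (iota x) = - (t * dotv D D) by rewrite oppr_lt0 mulr_gt0.
  by rewrite dotvBl dotvZl chi1 mulr1 Ez -/D dotvDr dotvZr; ring.
have ay : 0 < dotv a (iota y).
  suff -> : dotv a (iota y) = (1 - t) * dotv D D by rewrite mulr_gt0 // subr_gt0.
  have -> : iota y = iota x + D by rewrite addrC subrK.
  by rewrite dotvBl dotvZl dotvDr [dotv chi _]dotvDr chi1 (chi_diff chi1) Ez -/D dotvDr dotvZr; ring.
pose T := S `&` hs iota None a.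
pose S1 := S `&` hs iota (Some false) a.
pose S2 := S `&` hs iota (Some true) a.
pose Q2 := cut iota Q a.
have aQ2 : admissible iota P0 Q2 by apply: (admissible_cuts chi1 [:: a] aQ).
have cQ2 : is_complex Q2 by case: aQ2.
have Q2Pb : subdivides Q2 Pb by apply: subdivides_trans QPb; apply: cut_subdivides.
have QT : Q2 T by exists S, None.
have QS1 : Q2 S1 by exists S, (Some false).
have QS2 : Q2 S2 by exists S, (Some true).
have Tz : T z by split.
have S1x : S1 x by split=> //; apply: ltW.
have S2y : S2 y by split=> //; apply: ltW.
have TS1 : T `<=` S1 by move=> p [Sp ap]; split=> //; rewrite /hs /= ap.
have TS2 : T `<=` S2 by move=> p [Sp ap]; split=> //; rewrite /hs /= ap.
have TS : T `<=` S by move=> p [].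
have S1S : S1 `<=` S by move=> p [].
have S2S : S2 `<=` S by move=> p [].
have aT p : T p -> dotv a (iota p) = 0 by case.
have nT p : dotv a (iota p) != 0 -> ~~ (iota p <= spn T)%MS.
  by apply: contra => /(spn_ann0 (h := a)) -> //.
have xT : ~~ (iota x <= spn T)%MS by rewrite nT // lt_eqF.
have yT : ~~ (iota y <= spn T)%MS by rewrite nT // gt_eqF.
(* [T] and [x] span [S]: a point off [T] is joined to [x] or [y] by a segment that crosses [T].
   Hence [T] has corank 1. *)
pose M := (spn T + iota x)%MS.
have MT p : T p -> (iota p <= M)%MS.
  by move=> Tp; apply: submx_trans (addsmxSl _ _); apply: spn_in.
have Mx : (iota x <= M)%MS by apply: addsmxSr.
have solve p q r (e : R) : e != 0 -> iota r = iota p + e *: (iota q - iota p) ->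
    (iota r <= M)%MS -> (iota p <= M)%MS -> (iota q <= M)%MS.
  move=> e0 Er rM pM; have -> : iota q = iota p + e^-1 *: (iota r - iota p).
    by rewrite Er (addrC (iota p) (e *: _)) addrK scalerA mulVf // scale1r addrC subrK.
  by rewrite addmx_sub ?scalemx_sub ?addmx_sub ?eqmx_opp.
have My : (iota y <= M)%MS by apply: (solve x y z t); rewrite ?gt_eqF //; apply: MT.
have SM : (spn S <= M)%MS.
  apply: spn_min => p Sp; have [ap|ap|ap] := ltgtP (dotv a (iota p)) 0.
  - have [c [r [/andP[r0 r1] Sc ac Ec]]] := crossing Scvx Sp Sy ap ay.
    apply: (solve y p c (1 - r)) => //; first by rewrite gt_eqF // subr_gt0.
      by rewrite Ec; apply/rowP => j; rewrite !mxE; ring.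
    by apply: MT.
  - have [c [r [/andP[r0 r1] Sc ac Ec]]] := crossing Scvx Sx Sp ax ap.
    by apply: (solve x p c r) => //; [rewrite gt_eqF | apply: MT].
  - by apply: MT.
have rM : (\rank M <= (rk T).+1)%N.
  apply: leq_trans (mxrank_adds_leqif _ _) _.
  by rewrite -[X in (_ <= X)%N]addn1 leq_add2l rank_leq_row.
have rT : rk T = n.+1.
  have lt := rk_lt TS Sx xT; have le := leq_trans (mxrankS SM) rM.
  rewrite rS ltnS in lt; rewrite [\rank _]rS ltnS in le.
  by apply/eqP; rewrite eqn_leq lt.
have rS1 : rk S1 = n.+2.
  apply/eqP; rewrite eqn_leq -[X in (_ <= X)%N && _]rS rk_mono //= -rT.
  exact: (rk_lt TS1 S1x xT).
have rS2 : rk S2 = n.+2.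
  apply/eqP; rewrite eqn_leq -[X in (_ <= X)%N && _]rS rk_mono //= -rT.
  exact: (rk_lt TS2 S2y yT).
have T0 : T !=set0 by exists z.
have f1 : facet iota T S1 by apply: (cx_facet cQ2); rewrite // rS1 rT.
have f2 : facet iota T S2 by apply: (cx_facet cQ2); rewrite // rS2 rT.
have ct : codim1 iota T S by split=> //; rewrite rS rT.
have nx : ~ T x by move=> /aT ax0; move: ax; rewrite ax0 ltxx.
have ny : ~ T y by move=> /aT ay0; move: ay; rewrite ay0 ltxx.
have n1 := nvecP chi1 f1; have n2 := nvecP chi1 f2.
have [_ /(_ nx) d1] := normal_sign chi1 f1 n1 S1x Tz.
have [_ /(_ ny) d2] := normal_sign chi1 f2 n2 S2y Tz.
have D1 := dist_aff_normal chi1 f1 n1 S1x Tz.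
have D2 := dist_aff_normal chi1 f2 n2 S2y Tz.
have zx : iota x - iota z = - (t *: D).
  by rewrite Ez; apply/rowP => j; rewrite !mxE; ring.
have zy : iota y - iota z = (1 - t) *: D.
  by rewrite Ez; apply/rowP => j; rewrite !mxE; ring.
(* Equal normals would put [x] and [y] on the same side of [T]. *)
have n21 : nvec S2 T = - nvec S1 T.
  have [E21|//] := normal_pm chi1 ct (normal_mono S1S n1) (normal_mono S2S n2).
  move: d1 d2; rewrite E21 zx zy dotvNr !dotvZr oppr_gt0 => d1 d2.
  by exfalso; move: d1 d2; rewrite pmulr_rlt0 // pmulr_rgt0 ?subr_gt0 //; lra.
have dd : (1 - t) * dist_aff iota x T = t * dist_aff iota y T.
  by rewrite D1 D2 n21 zx zy !dotv_linE; ring.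
have [Bp SB rB] := big_cellP QPb Ple QS rS.
set B := big_cell iota Pb n.+1 S in Bp SB rB.
have cPb : is_complex Pb by case: aPb.
have B1 : big_cell iota Pb n.+1 S1 = B.
  exact: (big_cell_eq chi1 cPb Q2Pb Ple QS1 rS1 Bp (subset_trans S1S SB)).
have B2 : big_cell iota Pb n.+1 S2 = B.
  exact: (big_cell_eq chi1 cPb Q2Pb Ple QS2 rS2 Bp (subset_trans S2S SB)).
have bB : 0 < b B.
  by apply: b0; apply/restrP; split=> //; exists x; split; [apply: SB | apply: SU].
(* Rescales the common weight [b B] of both halves to the required product of coefficient and
   distance. *)
pose al := (1 - t) * dist_aff iota x T / b B.
have al0 : 0 < al by rewrite divr_gt0 // mulr_gt0 ?subr_gt0 // D1.
pose xs (i : 'I_2) := if i == ord0 then x else y.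
pose nu (i : 'I_2) := if i == ord0 then 1 - t else t.
pose sg (i : 'I_2) := if i == ord0 then S1 else S2.
have sum2 (V : nmodType) (F : 'I_2 -> V) : \sum_(i < 2) F i = F ord0 + F (lift ord0 ord0).
  by rewrite big_ord_recl big_ord1.
have := wc (x := z) (xs := xs) (nu := nu).
rewrite sum2 /xs /nu /=; apply.
- split=> //.
  + exact: SU.
  + by move=> i; case: ifP => _; apply: SU.
  + by move=> i; case: ifP => _; rewrite ?subr_ge0 ltW.
  + by rewrite sum2 /= subrK.
  + by rewrite sum2 /= Ez; apply/rowP => j; rewrite !mxE; ring.
(* The empty product: in top dimension the balancing weight itself serves. *)
exists Q2, T, n, sg, (fun s => al *
  gmul iota Q2 U n.+1 (map (minform iota) [::]) (pullw iota Pb n.+1 b) s).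
split; first by split=> //; apply/pdimP.
split.
  move=> i; rewrite /sg; case: ifP => _; split=> //.
  - by case: f1.
  - exact: subset_trans SU.
  - by apply/pdimP.
  - by case: f2.
  - exact: subset_trans SU.
  - by apply/pdimP.
have S12 : S1 <> S2.
  by move=> E12; have := S1x; rewrite E12 => -[_]; rewrite /hs /= leNgt ax.
split.
  move=> i j; rewrite /sg; case: (eqVneq i ord0) => i0; case: (eqVneq j ord0) => j0 //.
  - by rewrite i0 j0.
  - by move=> /esym.
  - move=> _; apply/val_inj; move: i0 j0; rewrite -!val_eqE /=.
    by case: i => [[|[|i]] // ?]; case: j => [[|[|j]] // ?].
split.
  move=> s [s' [j [Qs' Es]]] /pdimP rs [Ts _].
  (* Such a point forces every cell of [Q] that contains [T] to contain [S]. *)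
  have [p Tp rp] : exists2 p, T p & relint S p.
    have [r rr] := relint_ex Scvx Sx; have Sr := rr.1.
    have [ar|ar|ar] := ltgtP (dotv a (iota r)) 0; last by exists r.
    - have [c [e [/andP[e0 e1] Sc ac Ec]]] := crossing Scvx Sr Sy ar ay.
      exists c => //; apply: (relint_seg (t := e) rr Sy Sc) => //; lra.
    - have [c [e [/andP[e0 e1] Sc ac Ec]]] := crossing Scvx Sx Sr ax ar.
      exists c => //; apply: (relint_seg (t := 1 - e) rr Sx Sc); first lra.
      by rewrite Ec; apply/rowP => i; rewrite !mxE; ring.
  have s's : s `<=` s' by rewrite Es => u [].
  have Ss' : S `<=` s' by apply: (relint_sub chi1 cQ QS Qs' rp); apply/s's/Ts.
  have ESs' : S = s'.
    apply: (cell_eq_rk chi1 cQ QS Qs' Ss'); rewrite rS.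
    exact: (sub_rk_le QPb Ple Qs').
  case: j Es => [[]|] Es.
  - by exists (lift ord0 ord0); rewrite /sg /= Es -ESs'.
  - by exists ord0; rewrite /sg /= Es -ESs'.
  - have ET : s = T by rewrite Es -ESs'.
    by move: rs; rewrite ET rT => /eqP; rewrite eqn_leq ltnn andbF.
split.
  by apply: (beta_pos_minforms chi1 aPb aQ2 Q2Pb oU Ple mb b0); rewrite ?addn0.
move=> i; rewrite /sg /= /pullw /=; case: ifP => _; rewrite ?B1 ?B2.
  by rewrite /al mulfVK // gt_eqF.
by rewrite /al mulfVK ?gt_eqF.
Qed.

End CellConcave.

(** * Rank bounds from pure dimension *)

Section Purity.
Context {R : realType} {d : nat} {X : topologicalType} (iota : X -> 'rV[R]_d).
Context {chi : 'rV[R]_d} (chi1 : forall x, dotv chi (iota x) = 1).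
Implicit Types (s S : set X) (P Q : set (set X)) (x y : X).

Notation is_complex := (is_complex iota).
Notation rk := (rk iota).

Lemma pure_dim_big P n s : is_complex P -> pure_dim iota P n -> P s ->
  exists S, [/\ P S, s `<=` S & rk S = n.+1].
Proof.
move=> cP pP Ps.
pose Pn k := `[< exists S, [/\ P S, s `<=` S & rk S = k] >].
have exn : exists k, Pn k by exists (rk s); apply/asboolP; exists s; split=> // x.
have bn k : Pn k -> (k <= d)%N by move=> /asboolP[S [_ _ <-]]; apply: rank_leq_col.
case: (ex_maxnP exn bn) => k /asboolP[S [PS sS Sk]] kmax.
exists S; split=> //; apply/pdimP; apply: pP => // S' PS' SS'.
apply/esym/(cell_eq_rk chi1 cP PS PS' SS'); rewrite Sk; apply: kmax.
by apply/asboolP; exists S'; split=> //; apply: subset_trans sS SS'.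
Qed.

Lemma rk_set0 : rk set0 = 0%N.
Proof.
apply/eqP; rewrite mxrank_eq0 -submx0.
by apply: spn_min.
Qed.

Variables (P0 : set (set X)) (n : nat).
Hypotheses (cP0 : is_complex P0) (pP0 : pure_dim iota P0 n).

(** A nonempty cell contains a cell of the common subdivision with the same rank, and that one lies
    in a maximal cell of [P0]. *)
Lemma admissible_rk_le P s : admissible iota P0 P -> P s -> (rk s <= n.+1)%N.
Proof.
move=> [cP [Q [cQ [QP QP0]]]] Ps.
have [[x sx]|s0] := pselect (s !=set0); last first.
  have -> : s = set0 by apply/seteqP; split=> // x sx; case: s0; exists x.
  by rewrite rk_set0.
have [s' [Qs' _ _ <-]] := sub_rk chi1 cP cQ QP Ps sx.
have [s0 [P0s0 s's0]] := QP0 _ Qs'.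
have [S [_ s0S <-]] := pure_dim_big cP0 pP0 P0s0.
exact/rk_mono/(subset_trans s's0).
Qed.

Lemma admissible_cover P x : admissible iota P0 P ->
  exists S, [/\ P S, S x & rk S = n.+1].
Proof.
move=> aP; have [cP [Q [cQ [QP QP0]]]] := aP.
have [/(_ x)[s0 [P0s0 s0x]] _ _ _ _] := cP0.
have [S0 [P0S0 s0S0 rS0]] := pure_dim_big cP0 pP0 P0s0.
have [s [Qs _ sx rs]] := sub_rk chi1 cP0 cQ QP0 P0S0 (s0S0 _ s0x).
have [S [PS sS]] := QP _ Qs; exists S; split=> //; first exact: sS.
apply/eqP; rewrite eqn_leq (admissible_rk_le aP) //= -rS0 -rs.
exact: rk_mono.
Qed.

End Purity.

(** * Shrinking the cells around a point *)

Section Boxes.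
Context {R : realType} {d : nat} {X : topologicalType} (iota : X -> 'rV[R]_d).
Context {chi : 'rV[R]_d} (chi1 : forall x, dotv chi (iota x) = 1).
Implicit Types (s S : set X) (P Q : set (set X)) (x y : X).

Lemma dotv_delta (v : 'rV[R]_d) j : dotv (delta_mx 0 j) v = v 0 j.
Proof.
rewrite dotvE (bigD1 j) //= mxE !eqxx mul1r big1 ?addr0 // => i /negbTE ij.
by rewrite mxE ij andbF mul0r.
Qed.

Definition box x (r : R) : seq 'rV[R]_d := flatten
  [seq [:: delta_mx 0 j - (iota x 0 j + r) *: chi; (iota x 0 j - r) *: chi - delta_mx 0 j]
     | j <- enum 'I_d].

(** The forms of [box] are the walls of a cube around [x]; as [x] is strictly inside, a cell through
    [x] cannot pass a wall. *)
Lemma box_near P x r s y : 0 < r -> cuts iota P (box x r) s -> s x -> s y ->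
  near_vec r (iota y) (iota x).
Proof.
move=> r0 Ps sx sy j.
have neg a : a \in box x r -> dotv a (iota x) < 0 -> dotv a (iota y) <= 0.
  move=> al ax; have [H|H] := cuts_sign Ps al; last exact: H.
  by have := H x sx; rewrite leNgt ax.
have inb a : a \in [:: delta_mx 0 j - (iota x 0 j + r) *: chi;
    (iota x 0 j - r) *: chi - delta_mx 0 j] -> a \in box x r.
  move=> aj; apply/flattenP; exists [:: delta_mx 0 j - (iota x 0 j + r) *: chi;
    (iota x 0 j - r) *: chi - delta_mx 0 j] => //.
  by apply/mapP; exists j; rewrite // mem_enum.
have := neg _ (inb _ (mem_head _ _)).
have := neg ((iota x 0 j - r) *: chi - delta_mx 0 j).
rewrite inb ?inE ?eqxx ?orbT // => /(_ isT).
rewrite !dotvBl !dotvZl !chi1 !dotv_delta !mulr1 ler_norml => H1 H2.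
by have := H1 _; have := H2 _; move=> /(_ ltac:(lra)) H3 /(_ ltac:(lra)) H4; lra.
Qed.

Lemma small_cells P x (U : set X) : is_complex iota P -> open U -> U x ->
  exists l, forall s, cuts iota P l s -> s x -> s `<=` U /\ bounded_on iota s.
Proof.
move=> cP oU Ux; have [sq [usq Hsq]] := cx_star x cP.
have [s|r r0 Hr] := @small_all R _ sq
    (fun s e => forall y, s y -> near_vec e (iota y) (iota x) -> U y).
  rewrite Hsq => /asboolP[Ps sx].
  have [r r0 Hr] := cell_nbhs (cx_cell cP Ps) sx oU Ux.
  by exists r => // e /andP[_ er] y sy yx; apply: Hr => // j; apply: le_trans er.
exists (box x r) => s Ps sx; split.
  have [s' [Ps' ss']] := cuts_subdivides Ps => y sy.
  apply: (Hr r _ s'); first by rewrite lexx ltW.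
  - by rewrite Hsq; apply/asboolP; split=> //; apply: ss'.
  - exact: ss'.
  - exact: (box_near r0 Ps).
exists (\sum_j `|iota x 0 j| + r) => y sy j.
have := box_near r0 Ps sx sy j; move=> H.
have -> : iota y 0 j = iota x 0 j + (iota y 0 j - iota x 0 j) by rewrite addrC subrK.
apply: le_trans (ler_normD _ _) _; apply: lerD => //.
by rewrite (bigD1 j) //= lerDl sumr_ge0.
Qed.

End Boxes.

(** * From one-sided bounds to continuity *)

Section Continuity.
Context {R : realType} {d : nat} {X : topologicalType} (iota : X -> 'rV[R]_d).
Context {chi : 'rV[R]_d} (chi1 : forall x, dotv chi (iota x) = 1).
Implicit Types (s S : set X) (P Q : set (set X)) (x y : X).
Notation relint := (relint iota).
Notation rk := (rk iota).

(** The scale [e] is the dilation factor of [cell_dilate]; [e <= 2^-1] keeps [1 - e] away from 0, as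
    the upper bound is divided by it. *)
Definition lipschitz_at (f : X -> R) S x := exists2 r, 0 < r & exists M, forall y (e : R),
  S y -> 0 < e <= 2^-1 -> near_vec (r * e) (iota y) (iota x) -> `|f y - f x| <= M * e.

Lemma concave_lipschitz (f : X -> R) S x q K : ipolyhedron iota S -> S x ->
  bounded_on iota S -> concave_on iota S f -> relint S q ->
  (forall y (t : R), 0 < t <= 1 -> S y ->
     iota y = iota x + t *: (iota q - iota x) -> f y <= f x + K * t) ->
  lipschitz_at f S x.
Proof.
move=> cS Sx bS cf rq HK; have [C HC] := concave_lower_bound chi1 cS bS cf.
have [r1 r10 H1] := cell_dilate chi1 cS Sx.
have [r2 r20 H2] := relint_ball chi1 cS rq.
exists (Num.min r1 r2); first by rewrite lt_min r10.
(* The first term serves the lower bound; the upper one gives [(1 - e) * (f y - f x) <= e * (K - C +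
   f x)], and [1 - e >= 2^-1] yields the factor 2. *)
exists (`|f x - C| + 2 * `|K - C + f x|) => y e Sy /andP[e0 e1] yx.
have nA := ler_norm (f x - C); have nB := ler_norm (K - C + f x).
have pA := normr_ge0 (f x - C); have pB := normr_ge0 (K - C + f x).
have lower : f x - e * (f x - C) <= f y.
  have [|z Sz Ez] := H1 y e Sy e0.
    by move=> j; apply: le_trans (yx j) _; rewrite ler_pM2r // ge_min lexx.
  have e01 : 0 <= e <= 1 by lra.
  have := cf x z y e Sx Sz Sy e01 Ez; have := ler_wpM2l (ltW e0) (HC z Sz); lra.
have upper : (1 - e) * f y <= f x + K * e - e * C.
  (* The displacement of [q] solves [x + e (q - x) = (1 - e) y + e w] for [w]. *)
  have [||j|w Sw Ew] := H2 (((1 - e) / e) *: (iota x - iota y)).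
  - by rewrite scalemx_sub // sub_diff.
  - by rewrite dotvZr (chi_diff chi1) mulr0.
  - have c0 : 0 <= (1 - e) / e by rewrite divr_ge0 ?ltW //; lra.
    rewrite !mxE normrM (ger0_norm c0) distrC mulrAC ler_pdivrMr //.
    apply: (le_trans (ler_piMl (normr_ge0 _) _)); first lra.
    by apply: le_trans (yx j) _; rewrite ler_pM2r // ge_min lexx orbT.
  have e01 : 0 <= e <= 1 by lra.
  have [p Sp Ep] := cell_cvx chi1 cS (t := e) Sx rq.1 e01.
  have Ep' : iota p = iota y + e *: (iota w - iota y).
    rewrite Ep Ew; apply/rowP => j; rewrite !mxE; field.
    by rewrite gt_eqF.
  have fp : f p <= f x + K * e by apply: HK => //; lra.
  have := cf y w p e Sy Sw Sp e01 Ep'.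
  have := ler_wpM2l (ltW e0) (HC w Sw); lra.
have := ler_wpM2l (ltW e0) nA; have := ler_wpM2l (ltW e0) nB.
have := mulr_ge0 (ltW e0) pA; have := mulr_ge0 (ltW e0) pB.
move: lower upper e0 e1; clear.
move: `|f x - C| `|K - C + f x| (f x) (f y) => A B fx fy.
move=> lower upper e0 e1 pB pA nB nA; rewrite ler_norml; apply/andP; split; first lra.
have [fyx|fyx] := leP (fy - fx) 0; first lra.
have : 2^-1 * (fy - fx) <= (1 - e) * (fy - fx) by rewrite ler_wpM2r //; lra.
lra.
Qed.
(** The case of dimension 0: the cell is a single point. *)
Lemma point_lipschitz (f : X -> R) S x : ipolyhedron iota S -> S x -> rk S = 1%N ->
  lipschitz_at f S x.
Proof.
move=> cS Sx rS; exists 1 => //; exists 0 => y e Sy _ _.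
suff -> : y = x by rewrite subrr normr0 mul0r.
apply: (cell_inj cS) => //; have xS : [set x] `<=` S by move=> z ->.
have := submx_trans (spn_in iota Sy) (spn_eq_rk xS _).
rewrite rS (rk1 chi1) => /(_ isT)/spn1_sub/sub_rVP[a Ea].
by have := chi1 y; rewrite Ea dotvZr chi1 mulr1 => ->; rewrite scale1r.
Qed.

Lemma lipschitz_nbhs (f : X -> R) S x (eps : R) : ipolyhedron iota S -> S x ->
  lipschitz_at f S x -> 0 < eps ->
  exists V : set X, [/\ open V, V x & forall y, S y -> V y -> `|f y - f x| < eps].
Proof.
move=> cS Sx [r r0 [M HM]] eps0.
have M0 : 0 < `|M| + 1 by rewrite ltr_wpDl.
pose e := Num.min 2^-1 (eps / (2 * (`|M| + 1))).
have e0 : 0 < e by rewrite lt_min invr_gt0 ltr0n divr_gt0 // mulr_gt0.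
have [V [Vopen Vx HV]] := cell_cont cS Sx (mulr_gt0 r0 e0).
exists V; split=> // y Sy Vy; apply: le_lt_trans (HM y e Sy _ (HV y Sy Vy)) _.
  by rewrite e0 ge_min lexx.
have He : e * (2 * (`|M| + 1)) <= eps.
  by rewrite -ler_pdivlMr ?mulr_gt0 // ge_min lexx orbT.
have := ler_wpM2r (ltW e0) (ler_norm M); lra.
Qed.

(** Every cell that meets a small neighbourhood of [x] contains [x], so finitely many estimates
    suffice. *)
Lemma cells_continuous (f : X -> R) Q (U : set X) x : is_complex iota Q ->
  (forall y, exists S, [/\ Q S, S y & S x -> lipschitz_at f S x]) ->
  f @ within U (nbhs x) --> f x.
Proof.
move=> cQ cov; apply/cvgrPdist_lt => eps eps0.
have [sq [_ Hsq]] := cx_star x cQ.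
have [N [Nopen Nx HN]] := cx_loc x cQ.
have [V [Vopen Vx HV]] : exists V : set X, [/\ open V, V x &
    forall s, s \in sq -> lipschitz_at f s x ->
      forall y, s y -> V y -> `|f y - f x| < eps].
  have : forall s, s \in sq -> Q s /\ s x by move=> s; rewrite Hsq => /asboolP.
  elim: sq {Hsq} => [|s sq IH] sqP; first by exists setT; split=> //; exact: openT.
  have [|V [Vopen Vx HV]] := IH; first by move=> s' s'q; apply: sqP; rewrite inE s'q orbT.
  have [Qs sx] := sqP s (mem_head _ _).
  have [lip|nlip] := pselect (lipschitz_at f s x); last first.
    by exists V; split=> // s'; rewrite inE => /orP[/eqP -> //|]; apply: HV.
  have [V' [V'open V'x HV']] := lipschitz_nbhs (cx_cell cQ Qs) sx lip eps0.
  exists (V `&` V'); split=> //; first exact: openI.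
  move=> s'; rewrite inE => /orP[/eqP -> _ y sy [_ V'y]|s'q lip' y s'y [Vy _]].
    exact: HV'.
  exact: (HV s').
have : nbhs x (N `&` V) by apply: open_nbhs_nbhs; split; [exact: openI|split].
rewrite /within /= near_simpl => /filterS; apply=> y [Ny Vy] _.
have [S [QS Sy lip]] := cov y.
have Sx : S x by apply: HN => //; exists y.
rewrite distrC; apply: (HV S) => //; last exact: lip.
by rewrite Hsq; apply/asboolP.
Qed.

End Continuity.

Theorem theorem6p2 (R : realType) (d : nat) (X : topologicalType)
    (iota : X -> 'rV[R]_d) (P0 : set (set X)) (n : nat) (U : set X)
    (Pb : set (set X)) (b : set X -> R) (f : X -> R) :
  second_countable_space X ->
  euclidean_poly iota P0 ->
  pure_dim iota P0 n ->
  open U ->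
  balancing iota P0 U n Pb b ->
  weakly_concave iota P0 U n Pb b f ->
  {within U, continuous f}.
Proof.
move=> _ [[chi chi1] cP0] pP0 oU [aPb [mb b0]] wc.
apply/subspace_continuousP => x Ux.
have cPb : is_complex iota Pb by case: aPb.
have [l Hl] := small_cells chi1 cPb oU Ux.
set Q := cuts iota Pb l in Hl.
have aQ : admissible iota P0 Q by apply: (admissible_cuts chi1).
have QPb : subdivides Q Pb by apply: cuts_subdivides.
have cQ : is_complex iota Q by case: aQ.
have Ple s : Pb s -> (rk iota s <= n.+1)%N.
  exact: (admissible_rk_le chi1 cP0 pP0 aPb).
apply: (cells_continuous U cQ) => y.
have [S [QS Sy rS]] := admissible_cover chi1 cP0 pP0 y aQ.
exists S; split=> // Sx; have cS := cx_cell cQ QS.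
case: n => [|m] in pP0 mb b0 wc Ple rS *; first exact: (point_lipschitz chi1).
have QU s : Q s -> s x -> s `<=` U by move=> Qs sx; have [] := Hl s Qs sx.
have [_ bS] := Hl S QS Sx.
have [q rq [K HK]] := one_sided chi1 aPb oU Ple mb b0 wc aQ QPb QU QS Sx rS.
apply: (concave_lipschitz chi1 cS Sx bS _ rq HK).
exact: (cell_concave chi1 aPb oU Ple mb b0 wc aQ QPb QS (QU S QS Sx) rS).
Qed.
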